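(* Let $m\ge 2$ and let $\psi:M^m\to\bar M^{n+1}=I\times_hP$ be a complete mean curvature flow soliton with respect to $X=h(t)\partial_t$ and constant $c<0$, with $M$ connected, and let $o\in M$ be fixed. Assume that $P$ has constant sectional curvature $\kappa$, that $\mathrm{Ric}_M\le\Lambda g$ for some constant $\Lambda$, where $g$ is the induced metric, and that $\sup_M(|II|^2-(m-1)\varkappa)<+\infty$, where $\varkappa$ is evaluated at $\pi\circ\psi$ and $$\varkappa(t)=\min\Big\{-\frac{h''(t)}{h(t)},\ \frac{\kappa}{h^2(t)}-\frac{h'(t)^2}{h^2(t)}\Big\},\qquad t\in I.$$ Let, for some $\chi\in C^1(\mathbb R)$ with $\chi\ge0$ on $\hat\eta(I)$, the function $\hat\eta(t)=\int_{t_0}^th(s)\,ds$ satisfy $\hat\eta'=\chi(\hat\eta)^{1/2}$ on $I$. Furthermore, assume $$\lim_{x\to\infty}\eta(x)=+\infty$$ and $$\sup_M\big(|II|^2-(m-1)\varkappa\big)<-c\inf_Mh'(\pi\circ\psi)\le-c\sup_Mh'(\pi\circ\psi)<+\infty.$$ Then there exist constants $\mu,C>0$ such that $$\int_{B_R(o)}e^{c\eta}\,dM\le C\,R^\mu\quad\text{for }R\gg1,$$ where $B_R(o)$ is the geodesic ball of $M$ of radius $R$ centered at $o$.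
   Context: $I\subset\mathbb R$ is an open interval, $t_0\in I$ is fixed, $h:I\to(0,\infty)$ is smooth, $(P^n,g_0)$ is a Riemannian manifold, and $\bar M^{n+1}=I\times_hP$ is $I\times P$ with metric $dt^2+h(t)^2g_0$; $\pi(t,p)=t$. An isometric immersion $\psi:M^m\to\bar M^{n+1}$ is a mean curvature flow soliton with respect to $X$ if $c\,X^\perp=\mathbf H$ along $\psi$ for some constant $c\in\mathbb R$, where $\perp$ is projection on the normal bundle, $II$ is the second fundamental form and $\mathbf H$ is the non-normalized mean curvature vector (the trace of $II$). It is complete if $M$ with the induced metric is complete. $\eta(x)=\hat\eta(\pi(\psi(x)))$ for $x\in M$, and $dM$ is the induced volume element. *)

(* Defs.v *)
From HB Require Import structures.
From mathcomp Require Import all_boot all_order all_algebra.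
From mathcomp Require Import all_classical all_reals all_analysis.

Set Implicit Arguments.
Unset Strict Implicit.
Unset Printing Implicit Defensive.
Import Order.TTheory GRing.Theory Num.Theory numFieldNormedType.Exports.
Local Open Scope classical_set_scope.
Local Open Scope ring_scope.

(* Tangent vectors are handled as row vectors of components in a chart.  Hence
   a bilinear form with Gram matrix G is u *m G *m v^T, and the library's
   Jacobian ''J f y' has the partial derivatives of f as its ROWS
   ('D_u f y = u *m 'J f y). *)

Section EuclideanSpace.
Context {R : realType}.

Definition partial (m : nat) (V : normedModType R) (i : 'I_m)
    (f : 'rV[R]_m -> V) : 'rV[R]_m -> V :=
  'D_(delta_mx 0 i) f.

(* C^oo on an open set D of R^m: all iterated partial derivatives exist and
   are continuous at the points of D. *)
Definition smooth_on (m : nat) (V : normedModType R) (D : set 'rV[R]_m)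
    (f : 'rV[R]_m -> V) : Prop :=
  forall (s : seq 'I_m) (y : 'rV[R]_m), D y ->
    {for y, continuous (foldr (@partial m V) f s)} /\
    forall i : 'I_m, derivable (foldr (@partial m V) f s) y (delta_mx 0 i).

Definition smooth_real_on (D : set R) (f : R -> R) : Prop :=
  forall (k : nat) (t : R), D t -> derivable (derive1n k f) t 1.

Definition inner (n : nat) (G : 'M[R]_n) (u v : 'rV[R]_n) : R :=
  (u *m G *m v^T) 0 0.

(* Integral over R^n with respect to Lebesgue measure, written as an iterated
   integral; it is only applied to nonnegative Borel functions, for which this
   is Tonelli's formula. *)
Fixpoint lebesgue_integral_rV (n : nat) : ('rV[R]_n -> \bar R) -> \bar R :=
  match n with
  | 0 => fun f => f 0
  | k.+1 => fun f =>
      (\int[lebesgue_measure]_(x in [set: R])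
         lebesgue_integral_rV (fun y : 'rV[R]_k => f (row_mx x%:M y)))%E
  end.

Section MetricInCoordinates.
Variables (n : nat) (G : 'rV[R]_n -> 'M[R]_n).
Implicit Types (a b c d e : 'I_n) (x u v : 'rV[R]_n).

(* Gamma^a_bc *)
Definition christoffel a b c x : R :=
  2^-1 * \sum_d invmx (G x) a d *
    (partial b (fun y => G y d c) x + partial c (fun y => G y d b) x
     - partial d (fun y => G y b c) x).

(* R^a_bcd, with Rm(d_c, d_d) d_b = R^a_bcd d_a and
   Rm(X, Y) = [nabla_X, nabla_Y] - nabla_[X, Y]. *)
Definition riemann a b c d x : R :=
  partial c (christoffel a d b) x - partial d (christoffel a c b) x
  + \sum_e (christoffel a c e x * christoffel e d b x
            - christoffel a d e x * christoffel e c b x).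

(* Ric(u, v) is the trace of w |-> Rm(w, u) v. *)
Definition ricci x u v : R :=
  \sum_a \sum_b \sum_d riemann a b a d x * u 0 d * v 0 b.

(* K(u, v) = <Rm(u, v) v, u> / (|u|^2 |v|^2 - <u, v>^2) *)
Definition sectional x u v : R :=
  inner (G x)
    (\row_a \sum_b \sum_c \sum_d riemann a b c d x * u 0 c * v 0 d * v 0 b) u
  / (inner (G x) u u * inner (G x) v v - inner (G x) u v ^+ 2).

End MetricInCoordinates.
End EuclideanSpace.

(* A family of charts together with the coordinate expression of a metric in
   each of them; the axioms are in [riemannian_manifold].  [param i] inverts
   [coord i] between [dom i] and the open set [coord i @` dom i], and is
   irrelevant elsewhere.  [chart_at x] is a chart around x: tensors at x are
   evaluated in that chart. *)
Record manifold_data (R : realType) (n : nat) := ManifoldData {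
  carrier :> ptopologicalType ;
  index : Type ;
  chart_at : carrier -> index ;
  dom : index -> set carrier ;
  coord : index -> carrier -> 'rV[R]_n ;
  param : index -> 'rV[R]_n -> carrier ;
  metric : index -> 'rV[R]_n -> 'M[R]_n }.

Arguments chart_at {R n m} _ : rename.
Arguments dom {R n m} _ _ : rename.
Arguments coord {R n m} _ _ : rename.
Arguments param {R n m} _ _ : rename.
Arguments metric {R n m} _ _ : rename.

HB.instance Definition _ (T U : ptopologicalType) := Pointed.on (T * U)%type.

Section Manifolds.
Context {R : realType}.

Definition transition (n : nat) (M : manifold_data R n) (i j : index M)
    (y : 'rV[R]_n) : 'rV[R]_n :=
  coord j (param i y).

Definition overlap (n : nat) (M : manifold_data R n) (i j : index M) :
    set 'rV[R]_n :=
  coord i @` (dom i `&` dom j).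

Record smooth_manifold (n : nat) (M : manifold_data R n) : Prop := {
  manifold_hausdorff : hausdorff_space M ;
  manifold_second_countable : @second_countable M ;
  manifold_cover : forall x : M, dom (chart_at x) x ;
  manifold_dom_open : forall i : index M, open (dom i) ;
  manifold_image_open : forall i : index M, open (coord i @` dom i) ;
  manifold_coordK : forall (i : index M) (x : M),
    dom i x -> param i (coord i x) = x ;
  manifold_coord_cont : forall i : index M,
    {within dom i, continuous (coord i)} ;
  manifold_param_cont : forall i : index M,
    {within coord i @` dom i, continuous (param i)} ;
  manifold_transition : forall i j : index M,
    smooth_on (overlap i j) (transition i j) }.

Record riemannian_manifold (n : nat) (M : manifold_data R n) : Prop := {
  riemannian_manifold_smooth : smooth_manifold M ;
  metric_smooth : forall i : index M, smooth_on (coord i @` dom i) (metric i) ;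
  metric_sym : forall (i : index M) (y : 'rV[R]_n),
    (coord i @` dom i) y -> (metric i y)^T = metric i y ;
  metric_posdef : forall (i : index M) (y u : 'rV[R]_n),
    (coord i @` dom i) y -> u != 0 -> 0 < inner (metric i y) u u ;
  metric_change : forall (i j : index M) (y : 'rV[R]_n), overlap i j y ->
    let J := 'J (transition i j) y in
    metric i y = J *m metric j (transition i j y) *m J^T }.

Definition metric_at (n : nat) (M : manifold_data R n) (x : M) : 'M[R]_n :=
  metric (chart_at x) (coord (chart_at x) x).

Definition ricci_le (n : nat) (M : manifold_data R n) (L : R) : Prop :=
  forall (x : M) (u : 'rV[R]_n),
    ricci (metric (chart_at x)) (coord (chart_at x) x) u u
      <= L * inner (metric_at x) u u.

Definition constant_sectional_curvature (n : nat) (M : manifold_data R n)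
    (k : R) : Prop :=
  forall (x : M) (u v : 'rV[R]_n), row_free (col_mx u v) ->
    sectional (metric (chart_at x)) (coord (chart_at x) x) u v = k.

(* Distance, balls and completeness.  Concatenations of C^1 curves can be
   reparametrized so as to stop at the corners, hence the infimum over C^1
   curves is the infimum over piecewise C^1 curves. *)

Definition C1_curve (n : nat) (M : manifold_data R n) (gam : R -> M) : Prop :=
  forall t : R, 0 <= t <= 1 ->
    let local := coord (chart_at (gam t)) \o gam in
    [/\ {for t, continuous gam},
        \forall s \near t, derivable local s 1
      & {for t, continuous (derive1 local)}].

Definition speed (n : nat) (M : manifold_data R n) (gam : R -> M) (t : R) : R :=
  let v := derive1 (coord (chart_at (gam t)) \o gam) t in
  Num.sqrt (inner (metric_at (gam t)) v v).

Definition curve_length (n : nat) (M : manifold_data R n) (gam : R -> M) :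
    \bar R :=
  (\int[lebesgue_measure]_(t in `[0%R, 1%R]) (speed gam t)%:E)%E.

Definition geodesic_dist (n : nat) (M : manifold_data R n) (x y : M) : \bar R :=
  ereal_inf [set curve_length gam | gam in
    [set gam : R -> M | [/\ C1_curve gam, gam 0 = x & gam 1 = y]]].

Definition geodesic_ball (n : nat) (M : manifold_data R n) (o : M) (r : R) :
    set M :=
  [set x | (geodesic_dist o x < r%:E)%E].

Definition complete_manifold (n : nat) (M : manifold_data R n) : Prop :=
  forall u : nat -> M,
    (forall eps : R, 0 < eps -> exists N : nat, forall p q : nat,
       (N <= p)%N -> (N <= q)%N -> (geodesic_dist (u p) (u q) < eps%:E)%E) ->
    exists l : M, forall eps : R, 0 < eps -> exists N : nat, forall p : nat,
       (N <= p)%N -> (geodesic_dist (u p) l < eps%:E)%E.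

Definition borelType (T : ptopologicalType) := g_sigma_algebraType (@open T).

(* The Riemannian volume element: the Borel measure which in every chart is
   sqrt (det g_ij) times Lebesgue measure.  By second countability this
   determines it uniquely. *)
Definition is_riemannian_volume (n : nat) (M : manifold_data R n)
    (vol : {measure set (borelType M) -> \bar R}) : Prop :=
  forall (i : index M) (A : set M),
    @measurable _ (borelType M) A -> A `<=` dom i ->
    vol A = lebesgue_integral_rV (fun y =>
      (\1_(coord i @` A) y * Num.sqrt (\det (metric i y)))%:E).

(* Maps x : M |-> psi x : N between manifolds.  In the pointwise definitions,
   the charts are [chart_at x] and [chart_at (psi x)]. *)

Section Immersions.
Variables (m n : nat) (M : manifold_data R m) (N : manifold_data R n).
Variable psi : M -> N.

Definition local_rep (i : index M) (j : index N) (y : 'rV[R]_m) : 'rV[R]_n :=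
  coord j (psi (param i y)).

Definition smooth_map : Prop :=
  continuous psi /\
  forall (i : index M) (j : index N),
    smooth_on (coord i @` (dom i `&` psi @^-1` dom j)) (local_rep i j).

Definition isometric_immersion : Prop :=
  smooth_map /\
  forall (i : index M) (j : index N) (x : M), dom i x -> dom j (psi x) ->
    let J := 'J (local_rep i j) (coord i x) in
    row_free J /\
    metric i (coord i x) = J *m metric j (coord j (psi x)) *m J^T.

Definition local_at (x : M) : 'rV[R]_m -> 'rV[R]_n :=
  local_rep (chart_at x) (chart_at (psi x)).

Definition differential_at (x : M) : 'M[R]_(m, n) :=
  'J (local_at x) (coord (chart_at x) x).

(* w minus its orthogonal projection on the range of the differential, the
   latter being w |-> g^kl <w, d_k psi> d_l psi. *)
Definition normal_part (x : M) (w : 'rV[R]_n) : 'rV[R]_n :=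
  let J := differential_at x in
  let G := metric_at (psi x) in
  w - w *m G *m J^T *m invmx (J *m G *m J^T) *m J.

(* Covariant derivative along psi, for the Levi-Civita connection of N, of
   the coordinate field d_l psi in the direction d_k. *)
Definition covariant_derivative (x : M) (k l : 'I_m) : 'rV[R]_n :=
  let J := differential_at x in
  let j := chart_at (psi x) in
  \row_a (partial k (partial l (local_at x)) (coord (chart_at x) x) 0 a
    + \sum_b \sum_c
        christoffel (metric j) a b c (coord j (psi x)) * J k b * J l c).

Definition second_fundamental_form (x : M) (k l : 'I_m) : 'rV[R]_n :=
  normal_part x (covariant_derivative x k l).

Definition mean_curvature (x : M) : 'rV[R]_n :=
  \sum_k \sum_l invmx (metric_at x) k l *: second_fundamental_form x k l.

Definition second_fundamental_form_sqnorm (x : M) : R :=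
  let gV := invmx (metric_at x) in
  \sum_k \sum_l \sum_p \sum_q gV k p * gV l q *
    inner (metric_at (psi x))
      (second_fundamental_form x k l) (second_fundamental_form x p q).

(* [X z] are the components at z of a vector field of N in [chart_at z]. *)
Definition mcf_soliton (X : N -> 'rV[R]_n) (c : R) : Prop :=
  isometric_immersion /\
  forall x : M, c *: normal_part x (X (psi x)) = mean_curvature x.

End Immersions.

(* Warped product I x_h P.  It is carried by the open subset I x P of R x P,
   which is the union of the chart domains; the charts are id x (chart of P). *)

Definition warped_metric (n : nat) (h : R -> R) (G : 'rV[R]_n -> 'M[R]_n)
    (z : 'rV[R]_(1 + n)) : 'M[R]_(1 + n) :=
  block_mx 1%:M 0 0 (h (lsubmx z 0 0) ^+ 2 *: G (rsubmx z)).

Definition warped_product (n : nat) (I : set R) (h : R -> R)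
    (P : manifold_data R n) : manifold_data R (1 + n) :=
  @ManifoldData R (1 + n) (R * P)%type (index P)
    (fun z => chart_at z.2)
    (fun i => I `*` dom i)
    (fun i z => row_mx z.1%:M (coord i z.2))
    (fun i w => (lsubmx w 0 0, param i (rsubmx w)))
    (fun i => warped_metric h (metric i)).

(* X = h(t) d_t *)
Definition warped_field (n : nat) (I : set R) (h : R -> R)
    (P : manifold_data R n) (z : warped_product I h P) : 'rV[R]_(1 + n) :=
  row_mx (h z.1)%:M 0.

(* The oriented integral of h from t0 to t. *)
Definition eta_hat (h : R -> R) (t0 t : R) : R :=
  if t0 <= t then \int[lebesgue_measure]_(s in `[t0, t]) h s
  else - \int[lebesgue_measure]_(s in `[t, t0]) h s.

Definition varkappa (h : R -> R) (k t : R) : R :=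
  Num.min (- (derive1n 2 h t / h t))
    (k / h t ^+ 2 - derive1 h t ^+ 2 / h t ^+ 2).

Definition C1_real (f : R -> R) : Prop :=
  (forall u : R, derivable f u 1) /\ continuous (derive1 f).

Definition tends_to_pinfty_at_infinity (T : topologicalType) (f : T -> R) :
    Prop :=
  forall A : R, exists2 K : set T, compact K & forall x, ~ K x -> A < f x.

End Manifolds.

(* Main.v *)
(* Since [eta' = h] and [psi] is a soliton, in every chart
     div(w grad eta) = <grad w, grad eta> + w (m h' + c (h^2 - |grad eta|^2)),
   and the integral of the left hand side vanishes for compactly supported
   [w].  With [w = phi(eta) e^(c eta)], where [phi(s) = max(0, 2k - s)^2 / k^2],
   the terms in [c |grad eta|^2] cancel and [phi' <= 0] leaves
     0 <= int_M phi(eta) e^(c eta) (m h' + c h^2).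
   The gap hypothesis and [|II|^2 >= 0] give
   [lambda + c h' <= -(m - 1) h''/h] along [psi] for some [lambda > 0].  If
   [eta] is unbounded, this forces [h' >= lambda / -c], hence [h^2] grows at
   least linearly in [eta], so that [m h' + c h^2 <= -1] outside a compact set
   [{eta <= A}], while it is bounded above everywhere.  Thus the integrals of
   [phi(eta) e^(c eta)] are bounded independently of [k], and the total weighted
   volume of [M] is finite. *)
Require Import Defs.
From HB Require Import structures.
From mathcomp Require Import all_boot all_order all_algebra.
From mathcomp Require Import all_classical all_reals all_analysis.
From mathcomp Require Import perm measurable_realfun ring lra.
(* Restores [Defs.index], shadowed by [seq.index]. *)
Import Defs.
Set Implicit Arguments.
Unset Strict Implicit.
Unset Printing Implicit Defensive.
Import Order.TTheory GRing.Theory Num.Theory numFieldNormedType.Exports.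
Local Open Scope classical_set_scope.
Local Open Scope ring_scope.

(** * Calculus in coordinates *)

Section Calculus.
Context {R : realType}.

(** The volume is given only through integrals in charts, and the soliton equation at [x] only in
    the chart chosen at [x]. Two detours result. The equation is first carried to every point of an
    arbitrary fixed chart, where the divergence differentiates it. The vanishing of the integral is
    then proved by Riemann sums on a cube of a chart on whose faces the flux is zero. A compactly
    supported [w] is reduced to this case by peeling off factors: with cutoffs [z1, z2, ...] such
    that each [1 - z] lives in a chart and the product of the [z] vanishes on the support,
    [w = w (1 - z1) + w z1 (1 - z2) + ...]. The field [h d_t] is the gradient of [eta_hat] and its
    covariant derivative is [h'] times the identity; this is where [m h'] comes from. The function
    [phi] is a squared positive part because it must be [C^1], nonincreasing and zero for large [s],
    so that [phi(eta)] has compact support when [eta] is proper. Division by [k^2] keeps [phi >= 1]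
    on [s <= k], and bounds [phi] on [s >= -D] independently of [k]. The total mass being finite,
    every positive exponent [mu] serves; the proof takes [mu = 1]. *)

Lemma rV_norm_le (m : nat) (v : 'rV[R]_m) (c : R) :
  0 <= c -> (forall i, `|v 0 i| <= c) -> `|v| <= c.
Proof.
move=> c0 vc; rewrite /Num.norm /= mx_normrE; apply: bigmax_le => // -[i j] _ /=.
by rewrite ord1.
Qed.

Lemma rV_norm_ge (m : nat) (v : 'rV[R]_m) (i : 'I_m) : `|v 0 i| <= `|v|.
Proof.
rewrite [leRHS]/Num.norm /= mx_normrE.
exact: (le_bigmax _ (fun ij : 'I_1 * 'I_m => `|v ij.1 ij.2|) (0, i)).
Qed.

Lemma is_derive_line (V : normedModType R) (f : V -> R) (y v : V) (t : R) :
  derivable f (y + t *: v) v ->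
  is_derive t 1 (fun s => f (y + s *: v)) ('D_v f (y + t *: v)).
Proof.
move=> fd.
have E : (fun h : R => h^-1 *: (((fun s => f (y + s *: v)) \o shift t) (h *: 1)
    - f (y + t *: v)))
  = (fun h : R => h^-1 *: ((f \o shift (y + t *: v)) (h *: v) - f (y + t *: v))).
  apply/funext => h /=; congr (_ *: (f _ - _)).
  by rewrite [h *: 1]mulr1 scalerDl addrCA.
by apply: DeriveDef; rewrite ?/derivable ?/derive E.
Qed.

(** Derivability is assumed in the direction [v] only, so that the result applies before [f] is
    known to be differentiable. *)
Lemma MVT_line_ge0 (V : normedModType R) (f : V -> R) (y v : V) (s : R) :
  0 <= s -> (forall t, 0 <= t <= s -> derivable f (y + t *: v) v) ->
  exists2 t, 0 <= t <= s & f (y + s *: v) - f y = s * 'D_v f (y + t *: v).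
Proof.
move=> s0 fd; pose g t := f (y + t *: v).
have gd (t : R) : 0 <= t <= s -> is_derive t (1 : R) g ('D_v f (y + t *: v)).
  by move=> ts; apply: is_derive_line; exact: fd.
have [||t] := @MVT_segment _ g (fun t => 'D_v f (y + t *: v)) 0 s s0.
- by move=> x; rewrite in_itv /= => /andP[x0 xs]; apply: gd; rewrite !ltW.
- apply: derivable_within_continuous => x; rewrite in_itv /= => /gd [].
  by [].
- by rewrite in_itv /= /g scale0r addr0 subr0 mulrC => tI E; exists t.
Qed.

Lemma MVT_line (V : normedModType R) (f : V -> R) (y v : V) (s : R) :
  (forall t, `|t| <= `|s| -> derivable f (y + t *: v) v) ->
  exists2 t, `|t| <= `|s| & f (y + s *: v) - f y = s * 'D_v f (y + t *: v).
Proof.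
move=> fd; have [s0|s0] := leP 0 s.
  have [|t /andP[t0 ts] E] := @MVT_line_ge0 V f y v s s0.
    by move=> t /andP[t0 ts]; apply: fd; rewrite !ger0_norm.
  by exists t => //; rewrite !ger0_norm.
have Ns0 : 0 <= - s by rewrite oppr_ge0 ltW.
(* For negative [s] the segment is run backwards, from [y + s v] by [- s]. *)
have [|t /andP[t0 ts] E] := @MVT_line_ge0 V f (y + s *: v) v (- s) Ns0.
  move=> t /andP[t0 ts]; rewrite -addrA -scalerDl; apply: fd.
  by rewrite !ler0_norm ?(ltW s0) // -?lerBrDl ?sub0r // opprD lerBlDl -lerBlDr opprK ?subrr ?addNr.
have {}E := esym E; exists (s + t).
  by rewrite !ler0_norm ?(ltW s0) // -?lerBrDl ?sub0r // opprD lerBlDl -lerBlDr opprK ?subrr ?addNr.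
move: E; rewrite -addrA -scalerDl -[y + s *: v + _]addrA -scalerDl subrr scale0r addr0.
by move=> E; rewrite -opprB -E mulNr opprK.
Qed.

(** The candidate for the differential of a function whose row of partial derivatives is [c]. *)
Definition dotr (m : nat) (c h : 'rV[R]_m) : R := \sum_i h 0 i * c 0 i.

Lemma dotr_is_linear (m : nat) (c : 'rV[R]_m) : linear (dotr c).
Proof.
move=> a u v; rewrite /dotr scaler_sumr -big_split /=; apply: eq_bigr => i _.
by rewrite !mxE mulrDl /GRing.scale /= mulrA.
Qed.

HB.instance Definition _ m c :=
  GRing.isLinear.Build R 'rV[R]_m R _ (dotr c) (@dotr_is_linear m c).

Lemma dotr_continuous m (c : 'rV[R]_m) : continuous (dotr c).
Proof.
move=> x; apply: differentiable_continuous.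
have -> : dotr c = \sum_i (fun h : 'rV[R]_m => c 0 i *: (h 0 i : R)).
  by apply/funext => h; rewrite fct_sumE; apply: eq_bigr => i _; rewrite mulrC.
apply: differentiable_sum => i; apply: differentiableZ.
exact: differentiable_coord.
Qed.

(* Moves the coordinates from [y] to [y + h] one at a time and applies the
   one-dimensional mean value theorem to each of these moves. *)
Lemma differentiable_partial (m : nat) (f : 'rV[R]_m -> R) (y : 'rV[R]_m) :
  (\forall z \near y, forall i, derivable f z (delta_mx 0 i)) ->
  (forall i, {for y, continuous (partial i f)}) ->
  differentiable f y.
Proof.
move=> fd fc.
pose c := \row_i partial i f y.
suff key : (f \o shift y : 'rV[R]_m -> R^o)
    = cst (f y : R^o) + (dotr c : 'rV[R]_m -> R^o) +o_ (0 : 'rV[R]_m) id.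
  have E := @diff_unique R 'rV[R]_m R f (dotr c) y (@dotr_continuous m c) key.
  apply/diff_locallyP; rewrite E; split => //; exact: dotr_continuous.
  apply/eqaddoP => e e0.
  have [d d0 dP] : exists2 d, 0 < d & forall z, `|z - y| <= d ->
      forall i, derivable f z (delta_mx 0 i) /\
        `|partial i f z - partial i f y| <= e / (m%:R + 1).
    (* The tolerance is shared among the [m] coordinate moves; [m + 1] in place of [m] covers
       [m = 0]. *)
    have e'0 : 0 < e / (m%:R + 1) by rewrite divr_gt0 // ltr_wpDl.
    have : \forall z \near y, forall i, derivable f z (delta_mx 0 i) /\
        `|partial i f z - partial i f y| <= e / (m%:R + 1).
      apply: (@filter_forall _ _ (fun i z => derivable f z (delta_mx 0 i) /\
        `|partial i f z - partial i f y| <= e / (m%:R + 1)) (nbhs y)) => i.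
      have /cvgrPdist_le /(_ _ e'0) := fc i.
      by apply: filterS2 fd => z fdz cz; split; [exact: fdz|rewrite distrC].
    move=> /nbhs_ballP [d /= d0 dP]; exists (d / 2); first by rewrite divr_gt0.
    move=> z zy; apply: dP; rewrite -ball_normE /= distrC.
    by rewrite (le_lt_trans zy) // ltr_pdivrMr // ltr_pMr // ltr1n.
  have hnear : \forall h \near (0 : 'rV[R]_m), `|h| <= d by exact: nbhs0_le.
  apply: filterS hnear => h hd.
  have -> : (f \o shift y - (cst (f y) + dotr c)) h
     = f (h + y) - f y - dotr c h by rewrite !fctE opprD addrA.
  (* [y + H k] is the [k]-th corner of the staircase from [y] to [y + h]. *)
  pose H k : 'rV[R]_m := \row_i (if (i < k)%N then h 0 i else 0).
  have HS (k : 'I_m) : H k.+1 = H k + h 0 k *: delta_mx 0 k.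
    apply/rowP => i; rewrite !mxE ltnS leq_eqVlt /= -val_eqE /=.
    case: (ltngtP i k) => [||E]; rewrite ?mulr0 ?addr0 //= mulr1 add0r.
    by congr (h 0 _); apply: val_inj.
  have Hm : H m = h by apply/rowP => i; rewrite !mxE ltn_ord.
  have H0 : H 0%N = 0 by apply/rowP => i; rewrite !mxE.
  have -> : f (h + y) - f y = \sum_(k < m) (f (y + H k.+1) - f (y + H k)).
    rewrite -(big_mkord xpredT (fun k => f (y + H k.+1) - f (y + H k))).
    by rewrite (telescope_sumr (fun k => f (y + H k))) // Hm H0 addr0 (addrC h).
  rewrite /dotr -sumrB; apply: le_trans (ler_norm_sum _ _ _) _.
  have step (k : 'I_m) : `|f (y + H k.+1) - f (y + H k) - h 0 k * c 0 k|
      <= `|h| * (e / (m%:R + 1)).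
    have near_seg t : `|t| <= `|h 0 k| ->
        `|y + H k + t *: delta_mx 0 k - y| <= d.
      move=> th; apply: le_trans hd; rewrite addrAC (addrC y) addrK.
      apply: rV_norm_le => // i; rewrite !mxE /= eq_sym.
      case: (eqVneq k i) => [<-|ki].
        rewrite ltnn add0r mulr1; apply: le_trans th _; exact: rV_norm_ge.
      rewrite mulr0 addr0; case: ifP => _; last by rewrite normr0.
      exact: rV_norm_ge.
    have [|t th] := @MVT_line _ f (y + H k) (delta_mx 0 k) (h 0 k).
      by move=> t th; apply: (dP _ _ k).1; exact: near_seg.
    rewrite -addrA -HS => ->; rewrite mxE -mulrBr normrM ler_pM //.
      exact: rV_norm_ge.
    by have [_] := dP _ (near_seg _ th) k.
  apply: le_trans (ler_sum _ (fun k _ => step k)) _.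
  rewrite sumr_const card_ord -[X in X <= _]mulr_natl.
  apply: (@le_trans _ _ (e * `|h| * (m%:R / (m%:R + 1)))).
    by rewrite le_eqVlt; apply/orP; left; apply/eqP; ring.
  rewrite ler_piMr // ?mulr_ge0 ?(ltW e0) // ler_pdivrMr ?ltr_wpDl // mul1r.
  by rewrite lerDl.
Qed.

End Calculus.

Section Calculus2.
Context {R : realType}.

(** The mean value theorem is applied along [u] to the difference [f (z + s v) - f z], and then
    along [v] to ['D_u f]. *)
Lemma second_difference (V : normedModType R) (f : V -> R) (y u v : V) (s : R) :
  (forall t t', `|t| <= `|s| -> `|t'| <= `|s| ->
     derivable f (y + t *: u + t' *: v) u /\
     derivable ('D_u f) (y + t *: u + t' *: v) v) ->
  exists t t', [/\ `|t| <= `|s|, `|t'| <= `|s| &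
    f (y + s *: u + s *: v) - f (y + s *: u) - f (y + s *: v) + f y
     = s * (s * 'D_v ('D_u f) (y + t *: u + t' *: v))].
Proof.
move=> fd.
pose g z := f (z + s *: v) - f z.
have dsh (z : V) : derivable f (z + s *: v) u ->
    is_derive z u (fun z => f (z + s *: v)) ('D_u f (z + s *: v)).
  move=> fdz.
  have E : (fun h : R => h^-1 *: (((fun z => f (z + s *: v)) \o shift z) (h *: u)
       - f (z + s *: v)))
    = (fun h : R => h^-1 *: ((f \o shift (z + s *: v)) (h *: u) - f (z + s *: v))).
    by apply/funext => h /=; rewrite addrA.
  by apply: DeriveDef; rewrite ?/derivable ?/derive E.
have gd t : `|t| <= `|s| -> is_derive (y + t *: u) u g
    ('D_u f (y + t *: u + s *: v) - 'D_u f (y + t *: u)).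
  move=> ts.
  have H1 := dsh _ (fd t s ts (lexx _)).1.
  have H2 : is_derive (y + t *: u) u f ('D_u f (y + t *: u)).
    apply: derivableP; have := (fd t 0 ts _).1; rewrite normr0 scale0r addr0.
    by apply.
  exact: is_deriveB.
have [t ts|t ts E] := @MVT_line _ _ g y u s; first by have [] := gd t ts.
have [t' ts'|t' ts' E'] := @MVT_line _ _ ('D_u f) (y + t *: u) v s.
  exact: (fd t t' ts ts').2.
exists t, t'; split => //; rewrite -E'.
have [_ <-] := gd t ts; rewrite -E /g; ring.
Qed.

(** The second difference over a small square is symmetric in the two directions. Hence the two
    mixed derivatives take a common value, at two points of the square, and continuity at [y] brings
    both within [e / 2] of it. *)
Lemma partial_comm (m : nat) (f : 'rV[R]_m -> R) (y : 'rV[R]_m) (i j : 'I_m) :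
  (\forall z \near y, [/\ derivable f z (delta_mx 0 i),
     derivable f z (delta_mx 0 j), derivable (partial i f) z (delta_mx 0 j)
     & derivable (partial j f) z (delta_mx 0 i)]) ->
  {for y, continuous (partial j (partial i f))} ->
  {for y, continuous (partial i (partial j f))} ->
  partial j (partial i f) y = partial i (partial j f) y.
Proof.
move=> fd c1 c2; apply/eqP; rewrite -subr_eq0 -normr_le0.
apply/ler_addgt0Pr => e e0; rewrite add0r.
have e20 : 0 < e / 2 by rewrite divr_gt0.
have /cvgrPdist_le /(_ _ e20) n1 := c1.
have /cvgrPdist_le /(_ _ e20) n2 := c2.
have [d /= d0 dP] := (nbhs_ballP _ _).1 (filterI fd (filterI n1 n2)).
(* Points of the square are at distance at most [2 * s < d] from [y]. *)
pose s := d / 3.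
have s0 : 0 < s by rewrite divr_gt0.
have inb (t t' : R) (k l : 'I_m) : `|t| <= `|s| -> `|t'| <= `|s| ->
    ball y d (y + t *: delta_mx 0 k + t' *: delta_mx 0 l).
  rewrite (gtr0_norm s0) => ts ts'; rewrite -ball_normE /= distrC -[X in X - y]addrA [X in X - y]addrC addrK.
  rewrite (le_lt_trans (ler_normD _ _)) // !normrZ.
  have n1' q : `|delta_mx 0 q : 'rV[R]_m| <= 1.
    apply: rV_norm_le => // p; rewrite !mxE; case: eqP => _ /=.
      by case: eqP; rewrite ?normr1 ?normr0.
    by rewrite normr0.
  apply: (@le_lt_trans _ _ (s * 1 + s * 1)).
    by apply: lerD; apply: ler_pM.
  by rewrite /s; lra.
have [t t' ts ts'|t [t' [ts ts' E]]] :=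
    @second_difference _ f y (delta_mx 0 i) (delta_mx 0 j) s.
  by have [[a _ b _] _] := dP _ (inb t t' i j ts ts'); split; [exact: a|exact: b].
have [r r' rs rs'|r [r' [rs rs' E']]] :=
    @second_difference _ f y (delta_mx 0 j) (delta_mx 0 i) s.
  by have [[_ a _ b] _] := dP _ (inb r r' j i rs rs'); split; [exact: a|exact: b].
have [_ [+ _]] := dP _ (inb t t' i j ts ts').
have [_ [_ +]] := dP _ (inb r r' j i rs rs').
have EE : partial j (partial i f) (y + t *: delta_mx 0 i + t' *: delta_mx 0 j)
   = partial i (partial j f) (y + r *: delta_mx 0 j + r' *: delta_mx 0 i).
  set A := LHS; set B := RHS.
  have EA : s * (s * A) = s * (s * B).
    rewrite -[LHS]E -[RHS]E' [y + s *: delta_mx 0 j + _]addrAC.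
    set p := f _; set q := f _; set r0 := f _; set r1 := f _.
    by rewrite -!addrA; congr (_ + _); rewrite addrCA.
  by have := mulfI (lt0r_neq0 s0) (mulfI (lt0r_neq0 s0) EA).
rewrite /= EE => b1 b2.
move: b1 b2; set q := partial i (partial j f) (_ + _ + _).
set A := partial j (partial i f) y; set B := partial i (partial j f) y => b2 b1.
apply: le_trans (ler_distD q A B) _.
rewrite (splitr e); apply: lerD.
  exact: b1.
rewrite distrC; exact: b2.
Qed.

(* [nearW] for neighbourhoods of a point: the [Filter] instance of a matrix
   space is not inferred by [apply: nearW]. *)
Lemma near_always (T : topologicalType) (z : T) (P : T -> Prop) :
  (forall x, P x) -> \forall x \near z, P x.
Proof. by move=> Px; apply: filterS (@filterT _ (nbhs z) _). Qed.

Lemma continuous_near_eq (T U : topologicalType) (f g : T -> U) (z : T) :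
  (\forall x \near z, f x = g x) -> {for z, continuous f} -> {for z, continuous g}.
Proof.
move=> fg cf; have {}cf : f x @[x --> z] --> g z.
  by rewrite -(nbhs_singleton fg).
by apply: cvg_trans cf; apply: near_eq_cvg; apply: filterS fg.
Qed.

Lemma continuous_add (T : topologicalType) (f g : T -> R) (z : T) :
  {for z, continuous f} -> {for z, continuous g} ->
  {for z, continuous (fun x => f x + g x)}.
Proof. by move=> fz gz; apply: cvgD; [exact: fz|exact: gz]. Qed.

Lemma continuous_mul (T : topologicalType) (f g : T -> R) (z : T) :
  {for z, continuous f} -> {for z, continuous g} ->
  {for z, continuous (fun x => f x * g x)}.
Proof. by move=> fz gz; apply: cvgM; [exact: fz|exact: gz]. Qed.

Lemma continuous_cst (T : topologicalType) (k : R) (z : T) :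
  {for z, continuous (fun _ : T => k)}.
Proof. exact: cvg_cst. Qed.

Lemma continuous_sum (T : topologicalType) (I : Type) (r : seq I) (P : pred I)
    (F : I -> T -> R) (z : T) :
  (forall k, P k -> {for z, continuous (F k)}) ->
  {for z, continuous (fun x => \sum_(k <- r | P k) F k x)}.
Proof.
move=> Fz; elim: r => [|a r IH].
  apply: (@continuous_near_eq _ _ (fun=> 0)); last exact: continuous_cst.
  by apply: near_always => x; rewrite big_nil.
case Pa : (P a).
  apply: (@continuous_near_eq _ _ (fun x => F a x + \sum_(k <- r | P k) F k x)).
    by apply: near_always => x; rewrite big_cons Pa.
  by apply: continuous_add => //; exact: Fz.
by apply: continuous_near_eq IH; apply: near_always => x; rewrite big_cons Pa.
Qed.

(** Stated on a neighbourhood of [y]: this gives differentiability at [y] through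
    [differentiable_partial], and makes the property itself hold near [y], as is needed to
    differentiate formulas for partial derivatives again. *)
Definition C1at (m : nat) (f : 'rV[R]_m -> R) (y : 'rV[R]_m) : Prop :=
  \forall z \near y, forall i,
    derivable f z (delta_mx 0 i) /\ {for z, continuous (partial i f)}.

Section C1.
Variable m : nat.
Implicit Types (f g : 'rV[R]_m -> R) (y z : 'rV[R]_m).

Lemma C1at_near f y : C1at f y -> \forall z \near y, C1at f z.
Proof. by move=> /near_join; apply: filterS. Qed.

Lemma C1at_differentiable f y : C1at f y -> differentiable f y.
Proof.
move=> fy; apply: differentiable_partial => [|i].
  by apply: filterS fy => z fz i; case: (fz i).
by have := nbhs_singleton fy; move=> /(_ i) [].
Qed.

Lemma C1at_continuous f y : C1at f y -> {for y, continuous f}.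
Proof. by move=> /C1at_differentiable /differentiable_continuous. Qed.

Lemma C1at_partial_continuous f y i :
  C1at f y -> {for y, continuous (partial i f)}.
Proof. by move=> fy; have := nbhs_singleton fy => /(_ i) []. Qed.

(** The pattern of several closure rules below: a formula for the partial derivatives valid near
    [y], and the continuity of that formula. *)
Lemma C1atI f y (df : 'I_m -> 'rV[R]_m -> R) :
  (\forall z \near y, differentiable f z /\
     forall i, partial i f z = df i z) ->
  (\forall z \near y, forall i, {for z, continuous (df i)}) -> C1at f y.
Proof.
move=> fd dc.
apply: filterS2 (near_join fd) dc => z fz dcz i.
split; first by apply: diff_derivable; case: (nbhs_singleton fz).
have cz := dcz i.
apply: continuous_near_eq cz; by apply: filterS fz => x [_ ->].
Qed.

Lemma partial_near_eq f g y i :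
  (\forall z \near y, f z = g z) -> partial i f y = partial i g y.
Proof. exact: near_eq_derive. Qed.

Lemma C1at_near_eq f g y : (\forall z \near y, f z = g z) -> C1at f y -> C1at g y.
Proof.
move=> fg; apply: filterS2 (near_join fg) => z fgz fz0 i; have [fz cz] := fz0 i.
split; first exact: near_eq_derivable fz.
apply: continuous_near_eq cz; have := near_join fgz.
by apply: filterS => x /(partial_near_eq i) ->.
Qed.

Lemma C1at_derivable f y i : C1at f y -> derivable f y (delta_mx 0 i).
Proof. by move=> /C1at_differentiable /diff_derivable. Qed.

Lemma partial_cst (k : R) y i : partial i (fun _ : 'rV[R]_m => k) y = 0.
Proof. exact: derive_cst. Qed.

Lemma C1at_cst (k : R) y : C1at (fun _ => k) y.
Proof.
apply: (@C1atI _ _ (fun _ _ => 0)).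
  apply: near_always => z; split; first exact: differentiable_cst.
  by move=> i; exact: partial_cst.
by apply: near_always => z i; exact: continuous_cst.
Qed.

Lemma partialD f g y i : C1at f y -> C1at g y ->
  partial i (fun z => f z + g z) y = partial i f y + partial i g y.
Proof. by move=> fy gy; apply: deriveD; apply: C1at_derivable. Qed.

Lemma C1atD f g y : C1at f y -> C1at g y -> C1at (fun z => f z + g z) y.
Proof.
move=> fy gy; have fn := C1at_near fy; have gn := C1at_near gy.
apply: (@C1atI _ _ (fun i z => partial i f z + partial i g z)).
  apply: filterS2 fn gn => z fz gz; split; last by move=> i; exact: partialD.
  by apply: differentiableD; apply: C1at_differentiable.
apply: filterS2 fn gn => z fz gz i.
exact: continuous_add (C1at_partial_continuous fz) (C1at_partial_continuous gz).
Qed.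

Lemma partialM f g y i : C1at f y -> C1at g y ->
  partial i (fun z => f z * g z) y = partial i f y * g y + f y * partial i g y.
Proof.
move=> fy gy; rewrite /partial (@deriveM _ _ f g); try exact: C1at_derivable.
by rewrite addrC /GRing.scale /= mulrC.
Qed.

Lemma C1atM f g y : C1at f y -> C1at g y -> C1at (fun z => f z * g z) y.
Proof.
move=> fy gy; have fn := C1at_near fy; have gn := C1at_near gy.
apply: (@C1atI _ _ (fun i z => partial i f z * g z + f z * partial i g z)).
  apply: filterS2 fn gn => z fz gz; split; last by move=> i; exact: partialM.
  by apply: differentiableM; apply: C1at_differentiable.
apply: filterS2 fn gn => z fz gz i.
have cf := C1at_continuous fz; have cg := C1at_continuous gz.
have df := @C1at_partial_continuous f z i fz; have dg := @C1at_partial_continuous g z i gz.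
exact: continuous_add (continuous_mul df cg) (continuous_mul cf dg).
Qed.

Lemma C1at_sum (I : Type) (r : seq I) (P : pred I) (F : I -> 'rV[R]_m -> R) y :
  (forall k, P k -> C1at (F k) y) -> C1at (fun z => \sum_(k <- r | P k) F k z) y.
Proof.
move=> Fy; elim: r => [|a r IH].
  by apply: (@C1at_near_eq (fun=> 0)); [apply: near_always => z; rewrite big_nil|
    exact: C1at_cst].
case Pa : (P a).
  apply: (@C1at_near_eq (fun z => F a z + \sum_(k <- r | P k) F k z)).
    by apply: near_always => z; rewrite big_cons Pa.
  by apply: C1atD => //; exact: Fy.
by apply: C1at_near_eq IH; apply: near_always => z; rewrite big_cons Pa.
Qed.

Lemma C1at_prod (I : Type) (r : seq I) (P : pred I) (F : I -> 'rV[R]_m -> R) y :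
  (forall k, P k -> C1at (F k) y) -> C1at (fun z => \prod_(k <- r | P k) F k z) y.
Proof.
move=> Fy; elim: r => [|a r IH].
  by apply: (@C1at_near_eq (fun=> 1)); [apply: near_always => z; rewrite big_nil|
    exact: C1at_cst].
case Pa : (P a).
  apply: (@C1at_near_eq (fun z => F a z * \prod_(k <- r | P k) F k z)).
    by apply: near_always => z; rewrite big_cons Pa.
  by apply: C1atM => //; exact: Fy.
by apply: C1at_near_eq IH; apply: near_always => z; rewrite big_cons Pa.
Qed.

Lemma partial_sum (I : Type) (r : seq I) (P : pred I) (F : I -> 'rV[R]_m -> R) y i :
  (forall k, P k -> C1at (F k) y) ->
  partial i (fun z => \sum_(k <- r | P k) F k z) y
    = \sum_(k <- r | P k) partial i (F k) y.
Proof.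
move=> Fy; elim: r => [|a r IH].
  rewrite big_nil; apply: etrans (partial_cst 0 y i); apply: partial_near_eq.
  by apply: near_always => z; rewrite big_nil.
rewrite big_cons; case Pa : (P a).
  rewrite -IH -partialD; [|exact: Fy|exact: C1at_sum].
  by apply: partial_near_eq; apply: near_always => z; rewrite big_cons Pa.
by rewrite -IH; apply: partial_near_eq; apply: near_always => z; rewrite big_cons Pa.
Qed.

End C1.
End Calculus2.

Section Calculus3.
Context {R : realType}.

Definition C1R (g : R -> R) (u : R) : Prop :=
  \forall v \near u, derivable g v 1 /\ {for v, continuous (derive1 g)}.

Lemma partial_comp1 (m : nat) (g : R -> R) (f : 'rV[R]_m -> R) y i :
  differentiable f y -> derivable g (f y) 1 ->
  partial i (fun z => g (f z)) y = derive1 g (f y) * partial i f y.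
Proof.
move=> fy gy; have gd : differentiable g (f y) by apply/derivable1_diffP.
rewrite /partial deriveE; last exact: (differentiable_comp fy gd).
rewrite (@diff_comp _ _ _ _ f g) // deriveE //= deriv1E // mulrC.
by [].
Qed.

Lemma C1at_comp1 (m : nat) (g : R -> R) (f : 'rV[R]_m -> R) y :
  C1at f y -> C1R g (f y) -> C1at (fun z => g (f z)) y.
Proof.
move=> fy gy; have fn := C1at_near fy.
have gn : \forall z \near y, C1R g (f z).
  by apply: (C1at_continuous fy); apply: near_join gy.
apply: (@C1atI _ _ _ _ (fun i z => derive1 g (f z) * partial i f z)).
  apply: filterS2 fn gn => z fz gz.
  have [dg _] := nbhs_singleton gz; have df := C1at_differentiable fz.
  split; last by move=> i; exact: partial_comp1.
  by apply: (differentiable_comp df); apply/derivable1_diffP.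
apply: filterS2 fn gn => z fz gz i.
have [_ cg] := nbhs_singleton gz.
apply: (@continuous_mul _ _ (fun z => derive1 g (f z)) (partial i f)).
  by apply: (@continuous_comp _ _ _ f (derive1 g)); [exact: C1at_continuous|exact: cg].
exact: C1at_partial_continuous.
Qed.

Lemma differentiable_entries (V : normedModType R) (n : nat) (T : V -> 'rV[R]_n) y :
  (forall a, differentiable (fun z => T z 0 a) y) -> differentiable T y.
Proof.
move=> Ty.
have -> : T = \sum_(a < n) (fun z => T z 0 a *: (delta_mx 0 a : 'rV[R]_n)).
  by apply/funext => z; rewrite fct_sumE {1}[T z]row_sum_delta.
apply: differentiable_sum => a; exact: differentiableZl.
Qed.

Lemma jacobian_entry (m n : nat) (T : 'rV[R]_m -> 'rV[R]_n) y k a :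
  differentiable T y -> 'J T y k a = partial k (fun z => T z 0 a) y.
Proof.
move=> Ty; rewrite /jacobian mxE -deriveE // derive_mx ?mxE //.
exact: diff_derivable.
Qed.

Lemma partial_chain (m n : nat) (f : 'rV[R]_n -> R) (T : 'rV[R]_m -> 'rV[R]_n) y k :
  differentiable f (T y) -> (forall a, differentiable (fun z => T z 0 a) y) ->
  partial k (fun z => f (T z)) y
    = \sum_a partial k (fun z => T z 0 a) y * partial a f (T y).
Proof.
move=> fy Ty; have dT := differentiable_entries Ty.
rewrite /partial deriveE; last exact: (differentiable_comp dT fy).
rewrite (@diff_comp _ _ _ _ T f) //= -[X in 'd f _ X]deriveE //.
rewrite derive_mx; last exact: diff_derivable.
rewrite [X in 'd f _ X]row_sum_delta linear_sum; apply: eq_bigr => a _.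
by rewrite linearZ /= mxE -(@deriveE _ _ _ f).
Qed.

Lemma C1at_chain (m n : nat) (f : 'rV[R]_n -> R) (T : 'rV[R]_m -> 'rV[R]_n) y :
  C1at f (T y) -> (forall a, C1at (fun z => T z 0 a) y) ->
  C1at (fun z => f (T z)) y.
Proof.
move=> fy Ty.
have Tn : \forall z \near y, forall a, C1at (fun z => T z 0 a) z.
  by apply: (@filter_forall _ _ (fun a z => C1at (fun z => T z 0 a) z) (nbhs y))
    => a; apply: C1at_near.
have cT z : (forall a, C1at (fun z => T z 0 a) z) -> {for z, continuous T}.
  move=> Tz; apply: differentiable_continuous; apply: differentiable_entries => a.
  exact: C1at_differentiable.
have fn : \forall z \near y, C1at f (T z).
  by apply: (cT _ Ty); apply: C1at_near.
apply: (@C1atI _ _ _ _ (fun k z =>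
   \sum_a partial k (fun z => T z 0 a) z * partial a f (T z))).
  apply: filterS2 fn Tn => z fz Tz.
  have df := C1at_differentiable fz.
  have dT a := C1at_differentiable (Tz a).
  split; last by move=> i; exact: partial_chain.
  by apply: (differentiable_comp _ df); exact: differentiable_entries.
apply: filterS2 fn Tn => z fz Tz i.
apply: (@continuous_sum R _ _ _ _ (fun a z =>
   partial i (fun z => T z 0 a) z * partial a f (T z))) => a _.
apply: (@continuous_mul _ _ (partial i (fun z => T z 0 a))
   (fun z => partial a f (T z))); first exact: C1at_partial_continuous.
by apply: (@continuous_comp _ _ _ T (partial a f)); [exact: cT|exact: C1at_partial_continuous].
Qed.

Lemma C1R_inv (u : R) : u != 0 -> C1R (fun v => v^-1) u.
Proof.
have n0 (v : R) : v != 0 -> \forall w \near v, w != 0.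
  by move=> v0; apply: (@open_nbhs_nbhs _ v [set x : R | x != 0]); split => //; exact: open_neq.
have E v : v != 0 -> derive1 (fun v : R => v^-1) v = - (v ^- 2).
  move=> v0; rewrite derive1E; have := @deriveV R R id v 1 v0 (@derivable_id _ _ _ _).
  by rewrite derive_id /= => ->; rewrite /GRing.scale /= mulr1.
move=> /n0; apply: filterS => v v0; split.
  exact: (derivableV v0 (@derivable_id _ _ _ _)).
apply: (@continuous_near_eq _ _ (fun w : R => - (w ^- 2))).
  by apply: filterS (n0 _ v0) => w /E.
apply: cvgN; apply: cvgV; first by rewrite expf_neq0.
exact: exprn_continuous.
Qed.

Lemma smooth_on_partial (m : nat) (V : normedModType R) (D : set 'rV[R]_m)
  (f : 'rV[R]_m -> V) i : smooth_on D f -> smooth_on D (partial i f).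
Proof.
(* [foldr] applies the last index of the list first. *)
move=> sf s y Dy; have := sf (rcons s i) y Dy.
by rewrite -cats1 foldr_cat.
Qed.

Lemma smooth_on_entry (m p q : nat) (D : set 'rV[R]_m)
  (f : 'rV[R]_m -> 'M[R]_(p, q)) a b :
  open D -> smooth_on D f -> smooth_on D (fun z => f z a b).
Proof.
move=> oD sf.
have E s z : D z -> foldr (@partial R m R) (fun z => f z a b) s z
    = foldr (@partial R m 'M[R]_(p, q)) f s z a b.
  elim: s z => [//|i s IH] z Dz /=.
  rewrite (@partial_near_eq _ _ _ (fun z => foldr (@partial R m 'M[R]_(p, q)) f s z a b)).
    rewrite /partial derive_mx ?mxE //; exact: (sf s z Dz).2.
  by apply: filterS (open_nbhs_nbhs (conj oD Dz)) => x; exact: IH.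
move=> s y Dy; have [c d] := sf s y Dy.
have nD := open_nbhs_nbhs (conj oD Dy).
split.
- apply: (@continuous_near_eq _ _ (fun z => foldr (@partial R m 'M[R]_(p, q)) f s z a b)).
    by apply: filterS nD => z Dz; rewrite E.
  by apply: (@continuous_comp _ _ _ (foldr (@partial R m 'M[R]_(p, q)) f s) (fun M : 'M[R]_(p, q) => M a b)); [exact: c|exact: coord_continuous].
- move=> i; have /derivable_mxP /(_ a b) := d i.
  by apply: near_eq_derivable; apply: filterS nD => z Dz; rewrite E.
Qed.

Lemma smooth_on_C1at (m : nat) (D : set 'rV[R]_m) (f : 'rV[R]_m -> R) y :
  open D -> D y -> smooth_on D f -> C1at f y.
Proof.
move=> oD Dy sf; apply: filterS (open_nbhs_nbhs (conj oD Dy)) => z Dz i.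
by have [_ /(_ i) d] := sf [::] z Dz; have [c _] := sf [:: i] z Dz.
Qed.

Lemma smooth_on_partial_comm (m : nat) (D : set 'rV[R]_m) (f : 'rV[R]_m -> R) y i j :
  open D -> D y -> smooth_on D f ->
  partial i (partial j f) y = partial j (partial i f) y.
Proof.
move=> oD Dy sf; apply/esym/partial_comm.
- apply: filterS (open_nbhs_nbhs (conj oD Dy)) => z Dz.
  by split; [have [_] := sf [::] z Dz|have [_] := sf [::] z Dz
    |have [_] := sf [:: i] z Dz|have [_] := sf [:: j] z Dz]; apply.
- by have [] := sf [:: j; i] y Dy.
- by have [] := sf [:: i; j] y Dy.
Qed.

End Calculus3.

(** * Linear algebra *)

Section LinearAlgebra.
Context {R : realType}.

(** Induction on the size through the Schur complement [D'] of the corner entry. The factorization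
    gives the sign of the determinant and a square root of the inverse. *)
Lemma inner_cholesky (n : nat) (A : 'M[R]_n) :
  A^T = A -> (forall u, u != 0 -> 0 < inner A u u) ->
  exists E : 'M[R]_n, E *m E^T = A /\ E \in unitmx.
Proof.
elim: n A => [|n IH]; last rewrite -[n.+1]/(1 + n)%N; move=> A At Apos.
  exists 1%:M; split; last by rewrite unitmx1.
  by apply/matrixP => -[].
pose a := A 0 0; pose b := ursubmx A; pose D := drsubmx A.
have EA : A = block_mx a%:M b b^T D.
  rewrite -[LHS]submxK; congr block_mx.
    apply/matrixP => i j; rewrite !ord1 !mxE; congr (A _ _); exact: val_inj.
  by rewrite -[LHS]trmxK trmx_dlsub At.
have a0 : 0 < a.
  have /Apos : delta_mx 0 0 != 0 :> 'rV[R]_(1 + n).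
    by apply/eqP => /rowP /(_ 0); rewrite !mxE /= => /eqP; rewrite oner_eq0.
  by rewrite /inner -rowE trmx_delta -colE !mxE.
pose s := Num.sqrt a.
have s0 : s != 0 by rewrite sqrtr_eq0 -ltNge.
have ss : s * s = a by rewrite -expr2 sqr_sqrtr // ltW.
pose D' := D - a^-1 *: (b^T *m b).
have Dt : D^T = D by rewrite /D trmx_drsub At.
have [||E' [EE Eu]] := IH D'.
- by rewrite /D' linearB linearZ /= trmx_mul trmxK Dt.
- move=> u u0.
  (* Among the vectors ending in [u], this one minimizes the form of [A]; the minimum is the value
     of the form of [D'] at [u]. *)
  pose v : 'rV[R]_(1 + n) := row_mx (- a^-1 *: (u *m b^T)) u.
  have v0 : v != 0.
    by apply: contraNneq u0 => /(congr1 rsubmx); rewrite row_mxKr linear0 => ->.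
  have := Apos v v0; rewrite /inner {1}EA /v mul_row_block tr_row_mx mul_row_col.
  set q := u *m b^T.
  have -> : - a^-1 *: q *m a%:M + u *m b^T = 0.
    by rewrite mul_mx_scalar scalerA mulrN mulfV ?gt_eqF // scaleN1r addNr.
  rewrite mul0mx add0r /D' mulmxBr mulmxBl -/q.
  rewrite -scalemxAl -scalemxAr mulmxDl addrC.
  by rewrite -scalemxAl mulmxA -scalemxAl scaleNr.
exists (block_mx s%:M 0 (s^-1 *: b^T) E'); split.
- rewrite tr_block_mx mulmx_block EA trmx0 !(mul0mx, mulmx0, addr0).
  rewrite tr_scalar_mx -scalar_mxM ss; congr block_mx.
  + by rewrite linearZ /= trmxK mul_scalar_mx scalerA mulfV // scale1r.
  + by rewrite mul_mx_scalar scalerA mulfV // scale1r.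
  + rewrite EE linearZ /= trmxK -scalemxAl -scalemxAr scalerA -invfM ss /D'.
    by rewrite addrC subrK.
- by rewrite unitmxE det_lblock det_scalar1 unitrM unitfE s0 -unitmxE.
Qed.

Section Posdef.
Variables (n : nat) (A : 'M[R]_n).
Hypothesis At : A^T = A.
Hypothesis Apos : forall u, u != 0 -> 0 < inner A u u.

Lemma posdef_det_gt0 : 0 < \det A.
Proof.
have [E [<- Eu]] := inner_cholesky At Apos.
by rewrite det_mulmx det_tr -expr2 exprn_even_gt0 //= -unitfE -unitmxE.
Qed.

Lemma posdef_unitmx : A \in unitmx.
Proof. by rewrite unitmxE unitfE gt_eqF // posdef_det_gt0. Qed.

Lemma posdef_invmx_factor : exists F : 'M[R]_n, invmx A = F^T *m F.
Proof.
have [E [EA Eu]] := inner_cholesky At Apos.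
exists (invmx E); rewrite trmx_inv -[LHS]mulmx1.
have <- : A *m (invmx E^T *m invmx E) = 1%:M.
  by rewrite -EA -mulmxA (mulmxA E^T) mulmxV ?unitmx_tr // mul1mx mulmxV.
by rewrite mulKmx // posdef_unitmx.
Qed.

End Posdef.

(* Writing [A^-1 = F^T F], the sum is the squared norm of the array
   [\sum_(k, l) F r k * F s l * T k l]. *)
Lemma tensor_sqnorm_ge0 (m n : nat) (A : 'M[R]_m) (G : 'M[R]_n)
    (T : 'I_m -> 'I_m -> 'rV[R]_n) :
  A^T = A -> (forall u, u != 0 -> 0 < inner A u u) ->
  (forall u, 0 <= inner G u u) ->
  0 <= \sum_k \sum_l \sum_p \sum_q invmx A k p * invmx A l q
         * inner G (T k l) (T p q).
Proof.
move=> At Apos Gpos.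
have [F ->] := posdef_invmx_factor At Apos.
pose W r s := \sum_k \sum_l (F r k * F s l) *: T k l.
suff -> : \sum_k \sum_l \sum_p \sum_q (F^T *m F) k p * (F^T *m F) l q
         * inner G (T k l) (T p q) = \sum_r \sum_s inner G (W r s) (W r s).
  by do 2![apply: sumr_ge0 => ? _].
have innerE r s : inner G (W r s) (W r s) = \sum_k \sum_l \sum_p \sum_q
    (F r k * F s l * (F r p * F s q)) * inner G (T k l) (T p q).
  rewrite /inner /W !mulmx_suml summxE; apply: eq_bigr => k _.
  rewrite !mulmx_suml summxE; apply: eq_bigr => l _.
  rewrite linear_sum mulmx_sumr summxE; apply: eq_bigr => p _.
  rewrite linear_sum mulmx_sumr summxE; apply: eq_bigr => q _.
  by rewrite linearZ /= -!scalemxAl -scalemxAr scalerA mxE.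
under [RHS]eq_bigr do under eq_bigr do rewrite innerE.
pose t k l p q r s := F r k * F s l * (F r p * F s q) * inner G (T k l) (T p q).
transitivity (\sum_k \sum_l \sum_p \sum_q \sum_r \sum_s t k l p q r s).
  do 4![apply: eq_bigr => ? _]; rewrite !mxE big_distrlr mulr_suml.
  apply: eq_bigr => r _; rewrite mulr_suml; apply: eq_bigr => s _.
  by rewrite !mxE /t /=; ring.
have ex (f : 'I_m -> 'I_m -> 'I_m -> 'I_m -> 'I_m -> R) :
    \sum_s \sum_k \sum_l \sum_p \sum_q f s k l p q
    = \sum_k \sum_l \sum_p \sum_q \sum_s f s k l p q.
  rewrite exchange_big; apply: eq_bigr => k _.
  rewrite exchange_big; apply: eq_bigr => l _.
  by rewrite exchange_big; apply: eq_bigr => p _; rewrite exchange_big.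
rewrite -ex; apply: eq_bigr => r _.
by rewrite -ex; apply: eq_bigr.
Qed.

End LinearAlgebra.

Section MatrixCalculus.
Context {R : realType} {m : nat}.
Implicit Types (y z : 'rV[R]_m) (i : 'I_m).

Lemma partial_prod (I : eqType) (r : seq I) (F : I -> 'rV[R]_m -> R) y i :
  uniq r -> (forall k, C1at (F k) y) ->
  partial i (fun z => \prod_(k <- r) F k z) y
   = \sum_(k <- r) partial i (F k) y * \prod_(j <- r | j != k) F j y.
Proof.
move=> + Fy; elim: r => [_|a r IH /= /andP[ar ur]].
  rewrite big_nil; apply: etrans (partial_cst 1 y i); apply: partial_near_eq.
  by apply: near_always => z; rewrite big_nil.
transitivity (partial i (fun z => F a z * \prod_(k <- r) F k z) y).
  by apply: partial_near_eq; apply: near_always => z; rewrite big_cons.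
rewrite partialM ?IH //; last exact: C1at_prod.
rewrite big_cons big_cons eqxx /=; congr (_ * _ + _).
  rewrite big_seq_cond [RHS]big_seq_cond; apply: eq_bigl => j.
  by case: (boolP (j \in r)) => //= jr; apply/esym; apply: contraNneq ar => <-.
rewrite mulr_sumr; apply: eq_big_seq => k kr.
rewrite big_cons (_ : a != k = true); last by apply: contraNneq ar => ->.
by rewrite mulrCA.
Qed.

Section Det.
Variables (n : nat) (G : 'rV[R]_m -> 'M[R]_n) (y : 'rV[R]_m).
Hypothesis Gy : forall a b, C1at (fun z => G z a b) y.

Lemma C1at_det : C1at (fun z => \det (G z)) y.
Proof.
apply: C1at_sum => s _; apply: C1atM; first exact: C1at_cst.
by apply: C1at_prod => k _; exact: Gy.
Qed.

(** Jacobi's formula. The Leibniz rule gives the sum of the determinants with one row differentiated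
    (the matrices [A k]), and each is expanded along that row. *)
Lemma partial_det i :
  partial i (fun z => \det (G z)) y
    = \sum_a \sum_b partial i (fun z => G z a b) y * cofactor (G y) a b.
Proof.
pose A k : 'M[R]_n := \matrix_(a, b)
  if a == k then partial i (fun z => G z a b) y else G y a b.
have -> : \sum_a \sum_b partial i (fun z => G z a b) y * cofactor (G y) a b
   = \sum_a \det (A a).
  apply: eq_bigr => a _; rewrite (expand_det_row _ a); apply: eq_bigr => b _.
  rewrite mxE eqxx; congr (_ * _); rewrite /cofactor; congr (_ * \det _).
  by apply/matrixP => p q; rewrite !mxE eq_sym (negbTE (neq_lift _ _)).
rewrite partial_sum; last first.
  move=> s _; apply: C1atM; first exact: C1at_cst.
  by apply: C1at_prod => k _; exact: Gy.
rewrite exchange_big /=; apply: eq_bigr => s _.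
rewrite partialM; [|exact: C1at_cst|by apply: C1at_prod => k _; exact: Gy].
rewrite partial_cst mul0r add0r -mulr_sumr; congr (_ * _).
rewrite (@partial_prod _ _ (fun k z => G z k (s k))) ?index_enum_uniq //.
apply: eq_bigr => k _; rewrite [RHS](bigD1 k) //= mxE eqxx; congr (_ * _).
by apply: eq_bigr => j jk; rewrite mxE (negbTE jk).
Qed.

End Det.

Section Inv.
Variables (n : nat) (G : 'rV[R]_m -> 'M[R]_n) (y : 'rV[R]_m).
Hypothesis Gy : forall a b, C1at (fun z => G z a b) y.
Hypothesis Gu : \forall z \near y, G z \in unitmx.

Let D i : 'M[R]_n := \matrix_(a, b) partial i (fun z => G z a b) y.

Lemma C1at_invmx a b : C1at (fun z => invmx (G z) a b) y.
Proof.
apply: (@C1at_near_eq _ _ (fun z => (\det (G z))^-1 * cofactor (G z) b a)).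
  by apply: filterS Gu => z Gz; rewrite /invmx Gz !mxE.
apply: C1atM.
  apply: (@C1at_comp1 _ _ (fun v => v^-1)); first exact: C1at_det.
  by apply: C1R_inv; rewrite -unitfE -unitmxE (nbhs_singleton Gu).
apply: C1atM; first exact: C1at_cst.
apply: C1at_det => p q; apply: C1at_near_eq (Gy (lift b p) (lift a q)).
by apply: near_always => z; rewrite !mxE.
Qed.

(** Obtained by differentiating [invmx (G z) *m G z = 1] entry by entry. *)
Lemma partial_invmx i a b :
  partial i (fun z => invmx (G z) a b) y = - (invmx (G y) *m D i *m invmx (G y)) a b.
Proof.
pose B := invmx (G y).
pose dB : 'M[R]_n := \matrix_(a, b) partial i (fun z => invmx (G z) a b) y.
have Gyu := nbhs_singleton Gu.
suff : dB *m G y + B *m D i = 0.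
  move=> /(congr1 (mulmx^~ (invmx (G y)))); rewrite mulmxDl mul0mx mulmxK //.
  by move=> /eqP; rewrite addr_eq0 => /eqP /matrixP /(_ a b); rewrite !mxE.
apply/matrixP => p q; rewrite !mxE -big_split /=.
rewrite (_ : \sum_(j < n) _ =
   partial i (fun z => \sum_j invmx (G z) p j * G z j q) y); last first.
  rewrite partial_sum => [|j _]; last by apply: C1atM; [exact: C1at_invmx|exact: Gy].
  apply: eq_bigr => j _; rewrite partialM; [|exact: C1at_invmx|exact: Gy].
  by rewrite !mxE.
apply: etrans (partial_cst ((1%:M : 'M[R]_n) p q) y i); apply: partial_near_eq.
by apply: filterS Gu => z Gz; rewrite -(mulVmx Gz) mxE.
Qed.

Lemma partial_det_trace i :
  partial i (fun z => \det (G z)) y = \det (G y) * \tr (invmx (G y) *m D i).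
Proof.
rewrite partial_det // /mxtrace mulr_sumr exchange_big /=; apply: eq_bigr => b _.
rewrite mxE mulr_sumr; apply: eq_bigr => a _.
have Gyu := nbhs_singleton Gu.
have d0 : \det (G y) != 0 by rewrite -unitfE -unitmxE.
by rewrite /invmx Gyu !mxE; field.
Qed.

End Inv.
End MatrixCalculus.

(** The pointwise algebra behind the Laplacian of [eta]. Here [A] is the induced metric, [B] its
    inverse, [dA p] its derivative in the direction [p], [J] the Jacobian of the immersion, [G] the
    ambient metric, [K k l] the covariant derivative of the [l]-th coordinate field along the
    [k]-th, [e] the column of first derivatives of [eta] and [dde] its Hessian matrix of second
    partials. The left side is the Laplacian of [eta]. With [V] the trace of [K], the soliton
    equation says that [c X] and [V] have equal normal parts; pairing these with [X] gives the right
    side, up to a tangential term [om B e]. *)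
Lemma soliton_algebra (R : realType) (m n : nat) (A B : 'M[R]_m)
    (dA : 'I_m -> 'M[R]_m) (J : 'M[R]_(m, n)) (G : 'M[R]_n)
    (K : 'I_m -> 'I_m -> 'rV[R]_n) (X : 'rV[R]_n) (dde : 'M[R]_m) (c dh h2 : R) :
  let N := fun w => w - w *m G *m J^T *m B *m J in
  let e := J *m G *m X^T in
  B^T = B -> B *m A = 1%:M -> A^T = A ->
  (forall p k l, dA p k l = (K p k *m G *m J^T) 0 l + (K p l *m G *m J^T) 0 k) ->
  (forall k l, K k l = K l k) ->
  c *: N X = \sum_k \sum_l B k l *: N (K k l) ->
  (forall k l, (K k l *m G *m X^T) 0 0 = dde k l - dh * A k l) ->
  (X *m G *m X^T) 0 0 = h2 -> G^T = G ->
  \sum_p \sum_q (B p q * dde p q - (B *m dA p *m B) p q * e q 0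
      + 2^-1 * \tr (B *m dA p) * B p q * e q 0)
    = m%:R * dh + c * (h2 - \sum_p \sum_q B p q * e p 0 * e q 0).
Proof.
move=> N e Bt BA At dAE Ks sol KX XX Gt.
pose V := \sum_k \sum_l B k l *: K k l.
pose om : 'rV[R]_m := V *m G *m J^T.
have NV : c *: N X = N V.
  rewrite sol /N /V !mulmx_suml -sumrB; apply: eq_bigr => k _.
  rewrite !mulmx_suml -sumrB; apply: eq_bigr => l _.
  by rewrite -!scalemxAl -scalerBr.
have NE w : (N w *m G *m X^T) 0 0
    = (w *m G *m X^T) 0 0 - ((w *m G *m J^T) *m B *m e) 0 0.
  by rewrite /N !mulmxBl [LHS]mxE [X in _ + X]mxE /e !mulmxA.
have eT : e^T = X *m G *m J^T by rewrite /e !trmx_mul trmxK Gt mulmxA.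
have quad : (e^T *m B *m e) 0 0 = \sum_p \sum_q B p q * e p 0 * e q 0.
  rewrite mxE exchange_big /=; apply: eq_bigr => q _.
  by rewrite mxE mulr_suml; apply: eq_bigr => p _; rewrite mxE; ring.
have VX : (V *m G *m X^T) 0 0 = \sum_k \sum_l B k l * dde k l - m%:R * dh.
  have -> : m%:R * dh = \sum_k \sum_l B k l * (dh * A k l).
    have -> : m%:R = \tr (B *m A) :> R by rewrite BA mxtrace1.
    rewrite mulr_suml; apply: eq_bigr => k _; rewrite mxE mulr_suml.
    by apply: eq_bigr => l _; rewrite -[in RHS]At mxE; ring.
  rewrite -sumrB /V !mulmx_suml summxE; apply: eq_bigr => k _.
  rewrite -sumrB !mulmx_suml summxE; apply: eq_bigr => l _.
  by rewrite -!scalemxAl mxE KX mulrBr.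
have main : c * (h2 - \sum_p \sum_q B p q * e p 0 * e q 0)
   = \sum_k \sum_l B k l * dde k l - m%:R * dh - (om *m B *m e) 0 0.
  rewrite -VX -NE -NV -!scalemxAl mxE NE XX -eT quad; ring.
rewrite main addrCA addrA subrK.
(* [tau r] is the logarithmic derivative of the volume density. Differentiating the inverse metric
   contributes [- (om + tau)] and the density contributes [tau], so that exactly [- om] remains,
   which is the tangential term of [main]. *)
pose tau r := \sum_p \sum_l B p l * (K p r *m G *m J^T) 0 l.
have omE r : om 0 r = \sum_p \sum_l B p l * (K p l *m G *m J^T) 0 r.
  rewrite /om /V !mulmx_suml summxE; apply: eq_bigr => k _.
  rewrite !mulmx_suml summxE; apply: eq_bigr => l _.
  by rewrite -!scalemxAl mxE.
have div1 r : \sum_p \sum_l B p l * dA p l r = om 0 r + tau r.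
  rewrite omE /tau -big_split; apply: eq_bigr => p _.
  by rewrite -big_split; apply: eq_bigr => l _; rewrite dAE mulrDr.
have tr1 p : 2^-1 * \tr (B *m dA p) = tau p.
  have -> : \tr (B *m dA p) = tau p + tau p.
    rewrite /mxtrace /tau -{2}(exchange_big _ _ _ _ _
      (fun l q => B q l * (K q p *m G *m J^T) 0 l)) -big_split.
    apply: eq_bigr => k _; rewrite mxE -big_split; apply: eq_bigr => l _ /=.
    rewrite dAE mulrDr addrC (Ks p k) (Ks p l); congr (_ + _).
    by congr (_ * _); rewrite -[in RHS]Bt mxE.
  by field.
rewrite (eq_bigr (fun p => \sum_q B p q * dde p q - \sum_q (B *m dA p *m B) p q * e q 0
   + \sum_q tau p * B p q * e q 0)); last first.
  by move=> p _; rewrite -sumrB -big_split; apply: eq_bigr => q _; rewrite /= tr1.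
rewrite big_split sumrB /= -addrA; congr (_ + _).
have -> : \sum_p \sum_q (B *m dA p *m B) p q * e q 0
  = \sum_p \sum_q (om 0 p + tau p) * B p q * e q 0.
  rewrite exchange_big [RHS]exchange_big; apply: eq_bigr => q _ /=.
  rewrite -!mulr_suml; congr (_ * _).
  transitivity (\sum_p \sum_r (\sum_l B p l * dA p l r) * B r q).
    apply: eq_bigr => p _; rewrite mxE; apply: eq_bigr => r _; by rewrite mxE.
  rewrite exchange_big /=; apply: eq_bigr => r _; by rewrite -mulr_suml div1.
have -> : (om *m B *m e) 0 0 = \sum_p \sum_q om 0 p * B p q * e q 0.
  rewrite mxE exchange_big; apply: eq_bigr => q _ /=.
  by rewrite mxE mulr_suml; apply: eq_bigr.
rewrite addrC -sumrB -sumrN; apply: eq_bigr => p _.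
by rewrite -sumrB -sumrN; apply: eq_bigr => q _; ring.
Qed.

(** * Vanishing flux integrals *)

Section Grid.
Context {R : realType}.

Lemma compact_uniformly_continuous (V : normedModType R) (K : set V) (f : V -> R)
    (e : R) :
  compact K -> (forall y, K y -> {for y, continuous f}) -> 0 < e ->
  exists2 d, 0 < d & forall x y, K x -> K y -> `|x - y| < d -> `|f x - f y| <= e.
Proof.
move=> cK fc e0.
have /compact_near_coveringP cov := cK.
pose P (d : R) (x : V) := forall y, K y -> `|x - y| < d -> `|f x - f y| <= e.
have [x Kx|d /= d0 dP] := cov R (0^'+) P _.
  have e20 : 0 < e / 2 by rewrite divr_gt0.
  have /cvgrPdist_le /(_ _ e20) /nbhs_ballP [r /= r0 rP] := fc x Kx.
  have r20 : 0 < r / 2 by rewrite divr_gt0.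
  exists (ball x (r / 2), [set d : R | d < r / 2]); first split => /=.
  - exact: nbhsx_ballx.
  - exact: nbhs_right_lt.
  move=> [z d] [/= xz dr] y Ky zy.
  have H w : ball x r w -> `|f x - f w| <= e / 2 by move=> /rP.
  have bz : ball x r z.
    by move: xz; rewrite -!ball_normE /= => xz; rewrite (lt_le_trans xz) // ler_pdivrMr // ler_pMr // ler1n.
  have bY : ball x r y.
    move: xz; rewrite -!ball_normE /= => xz.
    rewrite (le_lt_trans (ler_distD z _ _)) // (splitr r) ltrD //.
    exact: lt_trans zy dr.
  rewrite (le_trans (ler_distD (f x) _ _)) // (splitr e) lerD //; last exact: H.
  by rewrite distrC; exact: H.
have d20 : 0 < d / 2 by rewrite divr_gt0.
exists (d / 2) => // x y Kx Ky xy.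
apply: (dP (d / 2)) Kx y Ky xy => //.
rewrite /= sub0r normrN gtr0_norm // ltr_pdivrMr // ltr_pMr // ltr1n.
by [].
Qed.

Lemma compact_bounded_above (T : topologicalType) (K : set T) (f : T -> R) :
  compact K -> (forall y, K y -> {for y, continuous f}) ->
  exists C, forall y, K y -> f y <= C.
Proof.
move=> cK fc.
have [[y0 Ky0]|K0] := pselect (K !=set0); last first.
  by exists 0 => y Ky; exfalso; apply: K0; exists y.
have [|c _ cP] := @compact_EVT_max _ _ f K (ex_intro _ y0 Ky0) cK.
  by apply: continuous_in_subspaceT => y; rewrite inE => /fc.
by exists (f c) => y Ky; apply: cP; rewrite inE.
Qed.

(** Half-open, so that the cells of a grid are disjoint; the closed version [cbox] provides
    compactness. *)
Definition box (m : nat) (b : 'rV[R]_m) (l : R) : set 'rV[R]_m :=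
  [set y | forall k, b 0 k <= y 0 k < b 0 k + l].

Definition cbox (m : nat) (b : 'rV[R]_m) (l : R) : set 'rV[R]_m :=
  [set y | forall k, b 0 k <= y 0 k <= b 0 k + l].

Lemma sub_box_cbox (m : nat) (b : 'rV[R]_m) l : box b l `<=` cbox b l.
Proof. by move=> y by_ k; have /andP[-> /ltW ->] := by_ k. Qed.

Lemma compact_cbox (m : nat) (b : 'rV[R]_m) l : compact (cbox b l).
Proof.
have := @rV_compact R m (fun k => `[b 0 k, b 0 k + l]%classic) (fun k => @segment_compact R _ _).
suff -> : cbox b l = [set v : 'rV[R]_m | forall k, `[b 0 k, b 0 k + l]%classic (v 0 k)] by [].
by apply/seteqP; split => y yb k; have := yb k; rewrite /= in_itv.
Qed.

Lemma integral_near_cst (d : measure_display) (X : measurableType d)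
    (mu : {measure set X -> \bar R}) (f : X -> R) (A : set X) (v e : R) :
  measurable A ->
  (mu A < +oo)%E -> measurable_fun A f -> (forall x, A x -> `|f x - v| <= e) ->
  [/\ mu.-integrable A (EFin \o f), (\int[mu]_(x in A) (f x)%:E)%E \is a fin_num &
  `|fine (\int[mu]_(x in A) (f x)%:E)%E - v * fine (mu A)| <= e * fine (mu A)].
Proof.
move=> mA Afin mf fv.
have muA : mu A = (fine (mu A))%:E.
  by rewrite fineK // ge0_fin_numE.
have intf : mu.-integrable A (EFin \o f).
  apply: measurable_bounded_integrable => //.
  exists (`|v| + e); split; first exact: num_real.
  move=> M vM x Ax /=; rewrite (le_trans _ (ltW vM)) //.
  rewrite -[f x](subrK v) addrC (le_trans (ler_normD _ _)) // lerD2l.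
  exact: fv.
have intv : mu.-integrable A (EFin \o (fun=> v)).
  apply: measurable_bounded_integrable => //.
  exists `|v|; split; first exact: num_real.
  by move=> M vM x Ax /=; rewrite ltW.
have fin := integrable_fin_num mA intf; split; [exact: intf|exact: fin|].
have Iv : (\int[mu]_(x in A) v%:E = (v * fine (mu A))%:E)%E.
  by rewrite (integral_cst _ mA v%:E) muA.
have E : (\int[mu]_(x in A) (f x - v)%:E)%E
  = (fine (\int[mu]_(x in A) (f x)%:E)%E - v * fine (mu A))%:E.
  under eq_integral do rewrite EFinB.
  rewrite (integralB_EFin mA intf intv) Iv -{1}(fineK fin) //.
have mfv : measurable_fun A (fun x => f x - v).
  by apply: measurable_funB => //; exact: measurable_cst.
have mfE := (measurable_EFinP A (fun x => f x - v)).2 mfv.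
rewrite -lee_fin EFinM -muA -(integral_cst _ mA).
rewrite -abse_EFin -E (le_trans (le_abse_integral mu mA mfE)) //.
apply: ge0_le_integral => //.
exact: measurableT_comp.
Qed.

Section FluxZero.
Variables (d : measure_display) (X : measurableType d).
Variable mu : {measure set X -> \bar R}.
Variables (m : nat) (phi : X -> 'rV[R]_m) (W : set X) (rho : 'rV[R]_m -> R).
Variables (a : 'rV[R]_m) (l : R) (p : 'I_m).
Hypothesis l0 : 0 < l.
Let K := cbox a l.
Let cell b s := W `&` phi @^-1` (box b s).
Hypothesis cell_measurable : forall b s, cbox b s `<=` K -> measurable (cell b s).
(** The link between [mu] and its density [rho] in the coordinates [phi]: only cells on which [rho]
    is pinched between two constants are compared, so that no change of variables is involved. *)
Hypothesis cell_measure : forall b s u v, cbox b s `<=` K -> 0 <= s -> 0 <= u -> u <= v ->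
  (forall y, box b s y -> u <= rho y <= v) ->
  ((u * s ^+ m)%:E <= mu (cell b s) <= (v * s ^+ m)%:E)%E.
Hypothesis rho_continuous : forall y, K y -> {for y, continuous rho}.
Hypothesis rho_gt0 : forall y, K y -> 0 < rho y.
Variable F : 'rV[R]_m -> R.
Hypothesis F_derivable : forall y, K y -> derivable F y (delta_mx 0 p).
Hypothesis dF_continuous : forall y, K y -> {for y, continuous (partial p F)}.
Hypothesis F0 : forall y, K y -> y 0 p = a 0 p \/ y 0 p = a 0 p + l -> F y = 0.
Variable f : X -> R.
Hypothesis f_measurable : measurable_fun (cell a l) f.
Hypothesis fE : forall x, cell a l x -> f x * rho (phi x) = partial p F (phi x).

(* Riemann sums: on a cell [Q] of side [s], the integral of [f] is
   [s ^+ m * partial p F xi] up to a uniformly small relative error, where [xi]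
   in [Q] is given by the mean value theorem along the p-th edge of [Q] through
   its corner.  The increments of [F] along these edges telescope to [0]. *)
Lemma flux_zero : mu.-integrable (cell a l) (EFin \o f) /\
  (\int[mu]_(x in cell a l) (f x)%:E = 0)%E.
Proof.
pose g y := partial p F y / rho y.
have gc y : K y -> {for y, continuous g}.
  move=> Ky; apply: (@continuous_mul _ _ (partial p F) (fun y => (rho y)^-1)).
    exact: dF_continuous.
  by apply: (@continuousV _ _ rho); [rewrite gt_eqF //; exact: rho_gt0|exact: rho_continuous].
have cK : compact K by exact: compact_cbox.
have [C1 C1P] := compact_bounded_above cK rho_continuous.
have [C2 C2P] : exists C, forall y, K y -> `|g y| <= C.
  apply: compact_bounded_above => // y Ky.
  by apply: (@continuous_comp _ _ _ g (fun v => `|v|)); [exact: gc|exact: norm_continuous].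
pose C := Num.max 0 (Num.max C1 C2).
have C0 : 0 <= C by rewrite le_max lexx.
have rhoC y : K y -> rho y <= C.
  by move=> /C1P H; rewrite (le_trans H) // !le_max lexx orbT.
have gC y : K y -> `|g y| <= C.
  by move=> /C2P H; rewrite (le_trans H) // !le_max lexx !orbT.
have fgE x : cell a l x -> f x = g (phi x).
  move=> cx; rewrite /g -fE // mulfK // gt_eqF //; apply: rho_gt0.
  by apply: sub_box_cbox; case: cx.
have cellK : cbox a l `<=` K by [].
have cell_ub b s : cbox b s `<=` K -> 0 <= s ->
    (0 <= mu (cell b s) <= (C * s ^+ m)%:E)%E.
  move=> bK s0; have := @cell_measure b s 0 C bK s0 (lexx 0) C0; rewrite mul0r.
  by apply=> y /sub_box_cbox /bK Ky; rewrite (ltW (rho_gt0 Ky)) rhoC.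
have cell_lty b s : cbox b s `<=` K -> 0 <= s -> (mu (cell b s) < +oo)%E.
  by move=> bK s0; have /andP[_ /le_lt_trans] := cell_ub b s bK s0; apply; rewrite ltry.
suff : forall e, 0 < e -> `|fine (\int[mu]_(x in cell a l) (f x)%:E)%E|
    <= 2 * C * l ^+ m * e.
  move=> H.
  have mc := cell_measurable cellK.
  have [||intf fin _] := @integral_near_cst _ _ mu f (cell a l) 0 C mc _ f_measurable.
  - by apply: cell_lty => //; exact: ltW.
  - move=> x cx; rewrite subr0 fgE //; apply: gC.
    by apply: sub_box_cbox; case: cx.
  split; first exact: intf.
  rewrite -(fineK fin); congr (_%:E); apply/eqP; rewrite -normr_le0.
  apply/ler_addgt0Pr => e e0; rewrite add0r.
  pose D := 2 * C * l ^+ m + 1.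
  have D0 : 0 < D by rewrite ltr_wpDl // !mulr_ge0 // exprn_ge0 // ltW.
  apply: le_trans (H (e / D) _) _; first by rewrite divr_gt0.
  rewrite mulrA ler_pdivrMr // mulrC ler_pM2l // /D lerDl.
  by [].
move=> e e0.
have [d1 d10 d1P] := compact_uniformly_continuous cK gc e0.
have [d2 d20 d2P] := compact_uniformly_continuous cK rho_continuous e0.
pose dd := Num.min d1 d2.
have dd0 : 0 < dd by rewrite lt_min d10.
(* With [N + 1] cells per edge the side falls below [dd], the modulus of uniform continuity common
   to [g] and [rho]. *)
pose N := Num.truncn (l / dd).
have Ndd : l / N.+1%:R < dd.
  rewrite ltr_pdivrMr // mulrC -ltr_pdivrMr //.
  by have /andP[_] := truncn_itv (ltW (divr_gt0 l0 dd0)).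
pose s := l / N.+1%:R.
have s0 : 0 < s by rewrite divr_gt0.
have sl : s * N.+1%:R = l by rewrite divfK.
pose corner (w : {ffun 'I_m -> 'I_N.+1}) : 'rV[R]_m := \row_k (a 0 k + (w k)%:R * s).
have boxK w : cbox (corner w) s `<=` K.
  move=> y yw k; have := yw k; rewrite mxE => /andP[y1 y2].
  apply/andP; split.
    by apply: le_trans y1; rewrite lerDl mulr_ge0 ?ler0n ?(ltW s0).
  apply: (le_trans y2).
  rewrite -addrA lerD2l -sl -[X in _ + X]mul1r -mulrDl mulrC ler_pM2l //.
  by rewrite natr1 ler_nat ltn_ord.
have subbox w : box (corner w) s `<=` box a l.
  move=> y yw k; have := yw k; rewrite mxE => /andP[y1 y2].
  apply/andP; split.
    by apply: le_trans y1; rewrite lerDl mulr_ge0 ?ler0n ?(ltW s0).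
  apply: (lt_le_trans y2).
  rewrite -addrA lerD2l -sl -[X in _ + X]mul1r -mulrDl mulrC ler_pM2l //.
  by rewrite natr1 ler_nat ltn_ord.
have cover_box y : box a l y -> exists w, box (corner w) s y.
  move=> ya.
  have ex k : exists j : 'I_N.+1, a 0 k + j%:R * s <= y 0 k < a 0 k + j%:R * s + s.
    have /andP[y1 y2] := ya k.
    have q0 : 0 <= (y 0 k - a 0 k) / s by rewrite divr_ge0 ?subr_ge0 // ltW.
    have /andP[t1 t2] := truncn_itv q0.
    have tN : (Num.truncn ((y 0 k - a 0 k) / s)%R < N.+1)%N.
      by rewrite truncn_lt_nat // ltr_pdivrMr // mulrC sl ltrBlDl.
    exists (Ordinal tN) => /=; move: t1 t2.
    rewrite ler_pdivlMr // ltr_pdivrMr // => t1 t2.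
    rewrite -lerBrDl t1 /= -addrA -ltrBlDl (lt_le_trans t2) //.
    by rewrite -natr1 mulrDl mul1r.
  exists [ffun k => projT1 (cid (ex k))] => k; rewrite mxE ffunE.
  exact: (projT2 (cid (ex k))).
have box_inj y w w' : box (corner w) s y -> box (corner w') s y -> w = w'.
  move=> yw yw'; apply/ffunP => k; apply: val_inj; apply/eqP.
  have H (u v : {ffun 'I_m -> 'I_N.+1}) : box (corner u) s y ->
      box (corner v) s y -> (u k <= v k)%N.
    move=> /(_ k) /andP[+ _] /(_ k) /andP[_]; rewrite !mxE => y2 y1.
    have := le_lt_trans y2 y1; rewrite -addrA ltrD2l -[X in _ + X]mul1r -mulrDl.
    by rewrite ltr_pM2r // natr1 ltr_nat ltnS.
  by rewrite eqn_leq !H.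
have mcell w : measurable (cell (corner w) s) := cell_measurable (@boxK w).
have cell_fin w : (mu (cell (corner w) s) < +oo)%E.
  by apply: cell_lty; [exact: boxK|exact: ltW].
have mfw w : measurable_fun (cell (corner w) s) f.
  apply: measurable_funS f_measurable; first exact: cell_measurable.
  by move=> x [Wx bx]; split => //; exact: subbox bx.
have splitI : (\int[mu]_(x in cell a l) (f x)%:E
    = \sum_(w : {ffun 'I_m -> 'I_N.+1}) \int[mu]_(x in cell (corner w) s) (f x)%:E)%E.
  have bigE : cell a l = \big[setU/set0]_(w <- index_enum {ffun 'I_m -> 'I_N.+1})
      cell (corner w) s.
    apply/seteqP; split => x; rewrite -bigcup_seq /=.
      move=> [Wx /cover_box [w wx]]; exists w => //=.
      exact: mem_index_enum.
    by move=> [w _ [Wx wx]]; split => //; exact: subbox wx.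
  rewrite {1}bigE integral_bigsetU_EFin //.
  - exact: index_enum_uniq.
  - by move=> w w' _ _ [x [[_ xw] [_ xw']]]; exact: box_inj xw xw'.
  - by rewrite -bigE; apply/measurable_EFinP.
have sm0 : 0 < s ^+ m by rewrite exprn_gt0.
pose ep : 'rV[R]_m := delta_mx 0 p.
have xiP w : exists2 xi, cbox (corner w) s xi &
    F (corner w + s *: ep) - F (corner w) = s * partial p F xi.
  have edge t : 0 <= t <= s -> cbox (corner w) s (corner w + t *: ep).
    move=> /andP[t0 ts] k; rewrite !mxE /= lerDl lerD2l.
    by case: (k == p); rewrite ?mulr1 ?mulr0 ?t0 ?ts ?lexx ?(ltW s0).
  have [|t ts E] := @MVT_line_ge0 _ _ F (corner w) ep s (ltW s0).
    by move=> t /edge /boxK /F_derivable.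
  by exists (corner w + t *: ep) => //; exact: edge.
pose xi w := projT1 (cid2 (xiP w)).
have xiK w : cbox (corner w) s (xi w) by rewrite /xi; case: cid2.
have xiE w : F (corner w + s *: ep) - F (corner w) = s * partial p F (xi w).
  by rewrite /xi; case: cid2.
have close w y : cbox (corner w) s y -> `|y - xi w| < dd.
  move=> yw; apply: le_lt_trans Ndd; apply: rV_norm_le; first exact: ltW.
  move=> k; rewrite !mxE ler_norml; have := yw k; have := xiK w k; rewrite -/s; lra.
have cell_est w : (\int[mu]_(x in cell (corner w) s) (f x)%:E \is a fin_num)%E /\
    `|fine (\int[mu]_(x in cell (corner w) s) (f x)%:E)%E
      - partial p F (xi w) * s ^+ m| <= 2 * C * e * s ^+ m.
  have xiKK := boxK _ _ (xiK w).
  have [|_ fin est] := @integral_near_cst _ _ mu f (cell (corner w) s) (g (xi w)) e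
      (mcell w) (cell_fin w) (mfw w).
    move=> x [Wx bx]; have cx := sub_box_cbox bx.
    rewrite fgE; last by split => //; exact: subbox bx.
    apply: d1P => //; first exact: boxK cx.
    by apply: lt_le_trans (close _ _ cx) _; rewrite ge_min lexx.
  split=> //.
  set mw := fine (mu _) in est; set I := fine _ in est *.
  (* The lower bound for [rho] on the cell is [rho (xi w) - e], cut off at 0 because [cell_measure]
     asks for a nonnegative one. *)
  have [u0 [uP]] : exists u0, 0 <= u0 /\ `|u0 - rho (xi w)| <= e /\
      forall y, box (corner w) s y -> u0 <= rho y.
    exists (Num.max 0 (rho (xi w) - e)); split; first by rewrite le_max lexx.
    have r0 := rho_gt0 xiKK; split.
      by rewrite maxEle; case: ifP => h; rewrite ler_norml; move: h; lra.
    move=> y yw; have cy := sub_box_cbox yw; have Ky := boxK _ _ cy.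
    rewrite ge_max (ltW (rho_gt0 Ky)) /=.
    have := d2P y (xi w) Ky xiKK; rewrite ler_norml => H.
    have /H /andP[] : `|y - xi w| < d2.
      by apply: lt_le_trans (close _ _ cy) _; rewrite ge_min lexx orbT.
    by move=> *; lra.
  move=> [u1 u2].
  have mE : mu (cell (corner w) s) = mw%:E by rewrite /mw fineK // ge0_fin_numE.
  have mwC : 0 <= mw <= C * s ^+ m.
    by have := cell_ub _ _ (@boxK w) (ltW s0); rewrite mE !lee_fin.
  have mwE : `|mw - rho (xi w) * s ^+ m| <= e * s ^+ m.
    have u0v : u0 <= rho (xi w) + e by move: u1; rewrite ler_norml; lra.
    have := @cell_measure (corner w) s u0 (rho (xi w) + e) (@boxK w) (ltW s0) uP u0v.
    rewrite mE !lee_fin => H.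
    have /H /andP[H1 H2] : forall y, box (corner w) s y -> u0 <= rho y <= rho (xi w) + e.
      move=> y yw; rewrite u2 //=; have cy := sub_box_cbox yw; have Ky := boxK _ _ cy.
      have := d2P y (xi w) Ky xiKK; rewrite ler_norml => {}H.
      have /H /andP[] : `|y - xi w| < d2.
        by apply: lt_le_trans (close _ _ cy) _; rewrite ge_min lexx orbT.
      by move=> *; lra.
    rewrite ler_norml; move: u1; rewrite ler_norml => /andP[u1 _].
    apply/andP; split; last by move: H2; rewrite mulrDl; lra.
    rewrite -subr_ge0; have : 0 <= (u0 - rho (xi w) + e) * s ^+ m.
      by rewrite mulr_ge0 ?(ltW sm0) //; lra.
    by rewrite mulrDl mulrBl; lra.
  have gE : partial p F (xi w) = g (xi w) * rho (xi w).
    by rewrite /g mulfVK // gt_eqF // rho_gt0.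
  rewrite gE -mulrA.
  have -> : I - g (xi w) * (rho (xi w) * s ^+ m)
    = (I - g (xi w) * mw) + g (xi w) * (mw - rho (xi w) * s ^+ m) by ring.
  rewrite (le_trans (ler_normD _ _)) //.
  have -> : 2 * C * e * s ^+ m = e * (C * s ^+ m) + C * (e * s ^+ m) by ring.
  apply: lerD; first by rewrite (le_trans est) // ler_wpM2l ?(ltW e0) //; case/andP: mwC.
  by rewrite normrM ler_pM // gC.
have sum0 : \sum_(w : {ffun 'I_m -> 'I_N.+1}) partial p F (xi w) = 0.
  apply: (mulfI (lt0r_neq0 s0)); rewrite mulr0 mulr_sumr.
  under eq_bigr do rewrite -xiE.
  pose upd (w : {ffun 'I_m -> 'I_N.+1}) j := [ffun k => if k == p then j else w k].
  (* Cells are grouped in columns along the [p]-th axis, each named by its cell with [p]-th index 0;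
     the class of any other name is empty. *)
  rewrite (partition_big (fun w => upd w ord0) xpredT) //=.
  apply: big1 => v _.
  have [vp|vp] := eqVneq (v p) ord0; last first.
    rewrite big1 // => w /eqP wv; move: vp; by rewrite -wv ffunE eqxx eqxx.
  rewrite (reindex_onto (fun j => upd v j) (fun w => w p)) /=; last first.
    by move=> w /eqP <-; apply/ffunP => k; rewrite !ffunE; case: eqP => // ->.
  (* [F] at the grid points of the column, with [j] running up to [N.+1], the opposite face; [h]
     vanishes at both ends. *)
  pose h (j : nat) := F (\row_k (if k == p then a 0 k + j%:R * s else corner v 0 k)).
  rewrite (eq_bigr (fun j : 'I_N.+1 => h j.+1 - h j)); last first.
    move=> j _; congr (F _ - F _); apply/rowP => k; rewrite !mxE ffunE.
      case: eqP => kp; last by rewrite andbF mulr0 addr0.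
      by rewrite eqxx /= -natr1; ring.
    by case: eqP.
  rewrite (eq_bigl xpredT); last first.
    move=> j; apply/andP; split; apply/eqP; last by rewrite ffunE eqxx.
    by apply/ffunP => k; rewrite !ffunE; case: eqP => // ->.
  rewrite -(big_mkord xpredT (fun j => h j.+1 - h j)) telescope_sumr //.
  have hK j : (j <= N.+1)%N -> K (\row_k (if k == p then a 0 k + j%:R * s else corner v 0 k)).
    move=> jN k; rewrite !mxE; case: ifP => _.
      rewrite lerDl mulr_ge0 ?(ltW s0) //= lerD2l -sl mulrC ler_pM2l // ler_nat //.
    have := boxK v (corner v); rewrite /K /cbox /=.
    have H : cbox (corner v) s (corner v) by move=> q; rewrite lexx lerDl ltW.
    by move=> /(_ H k); rewrite mxE.
  rewrite /h !F0 ?subrr //; try exact: hK.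
    by left; rewrite mxE eqxx mul0r addr0.
  by right; rewrite mxE eqxx mulrC sl.
(* By [sum0], subtracting the Riemann sum changes nothing, and only the errors of the cells are
   left. *)
have -> : fine (\int[mu]_(x in cell a l) (f x)%:E)%E
   = \sum_(w : {ffun 'I_m -> 'I_N.+1}) (fine (\int[mu]_(x in cell (corner w) s) (f x)%:E)%E
       - partial p F (xi w) * s ^+ m).
  rewrite sumrB -mulr_suml sum0 mul0r subr0 splitI.
  rewrite -[RHS]/(fine (\sum_w _)%:E) -sumEFin; congr fine.
  by apply: eq_bigr => w _; rewrite fineK //; case: (cell_est w).
rewrite (le_trans (ler_norm_sum _ _ _)) //.
rewrite (le_trans (ler_sum _ (fun w _ => (cell_est w).2))) //.
rewrite sumr_const card_ffun !card_ord -[X in X <= _]mulr_natr natrX.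
have <- : s ^+ m * N.+1%:R ^+ m = l ^+ m by rewrite -exprMn sl.
by rewrite le_eqVlt; apply/orP; left; apply/eqP; ring.
Qed.

End FluxZero.
End Grid.

(** * Volumes of coordinate boxes *)

Section BoxVolume.
Context {R : realType}.

(* The library's [ge0_le_integral] assumes measurability, which is not available
   for the inner integrals of [lebesgue_integral_rV]. *)
Lemma ge0_le_integral_any d (T : measurableType d) (mu : {measure set T -> \bar R})
    (D : set T) (f g : T -> \bar R) :
  (forall x, D x -> (0 <= f x)%E) -> (forall x, D x -> (f x <= g x)%E) ->
  (\int[mu]_(x in D) f x <= \int[mu]_(x in D) g x)%E.
Proof.
move=> f0 fg; have g0 x : D x -> (0 <= g x)%E.
  by move=> Dx; exact: le_trans (f0 x Dx) (fg x Dx).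
rewrite !ge0_integralE //; apply: le_ereal_sup => _ [h /= hf <-]; exists h => //= x.
apply: le_trans (hf x) _; rewrite /patch; case: ifPn => //; rewrite inE.
exact: fg.
Qed.

Lemma lebesgue_integral_rV_ge0 (n : nat) (f : 'rV[R]_n -> \bar R) :
  (forall y, (0 <= f y)%E) -> (0 <= lebesgue_integral_rV f)%E.
Proof.
elim: n f => [|n IH] f f0 /=; first exact: f0.
by apply: integral_ge0 => x _; apply: IH.
Qed.

Lemma le_lebesgue_integral_rV (n : nat) (f g : 'rV[R]_n -> \bar R) :
  (forall y, (0 <= f y)%E) -> (forall y, (f y <= g y)%E) ->
  (lebesgue_integral_rV f <= lebesgue_integral_rV g)%E.
Proof.
elim: n f g => [|n IH] f g f0 fg /=; first exact: fg.
apply: ge0_le_integral_any => x _; last exact: IH.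
exact: lebesgue_integral_rV_ge0.
Qed.

(** The constant [k] has to vary in the induction: for fixed first coordinate, the indicator of its
    interval is absorbed in the constant of the inner integral. *)
Lemma lebesgue_integral_rV_box (n : nat) (b : 'rV[R]_n) (s k : R) :
  0 <= s -> 0 <= k ->
  lebesgue_integral_rV (fun y => (k * \1_(box b s) y)%:E) = (k * s ^+ n)%:E.
Proof.
move=> s0; elim: n b k => [|n IH] b k k0.
  rewrite /= indicE mem_set ?mulr1 ?expr0 //=; by case.
rewrite /=.
pose J : set R := `[b 0 0, b 0 0 + s[%classic.
have mJ : measurable J by exact: measurable_itv.
pose b' : 'rV[R]_n := \row_i b 0 (lift 0 i).
transitivity (\int[lebesgue_measure]_(x in [set: R]) ((k * s ^+ n) * \1_J x)%:E)%E.
  apply: eq_integral => x _.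
  rewrite (_ : (fun y : 'rV[R]_n => _) = (fun y => ((k * \1_J x) * \1_(box b' s) y)%:E)).
    by rewrite IH ?mulr_ge0 //; congr (_%:E); ring.
  apply/funext => y; congr (_%:E); rewrite -mulrA; congr (_ * _).
  have row0 : (row_mx x%:M y : 'rV[R]_(1 + n)) 0 0 = x.
    by rewrite mxE; case: splitP => // j _; rewrite !mxE ord1 eqxx.
  have rowl (i : 'I_n) : (row_mx x%:M y : 'rV[R]_(1 + n)) 0 (lift 0 i) = y 0 i.
    rewrite mxE; case: splitP => [j|j].
      by rewrite ord1.
    by rewrite /= /bump /= !add1n => -[] /val_inj ->.
  have E : box b s (row_mx x%:M y) <-> J x /\ box b' s y.
    split=> [H|[Jx H] k'].
      split; first by have := H 0; rewrite row0 /J /= in_itv.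
      by move=> i; have := H (lift 0 i); rewrite rowl mxE.
    have [j ->|->] := unliftP (0 : 'I_n.+1) k'.
      by rewrite rowl; have := H j; rewrite mxE.
    by rewrite row0; move: Jx; rewrite /J /= in_itv.
  rewrite !indicE -natrM mulnb; congr (_%:R); congr nat_of_bool.
  apply/idP/andP.
    by rewrite inE => /E [Jx by_]; split; rewrite inE.
  by rewrite !inE => -[Jx by_]; apply/E.
under eq_integral do rewrite EFinM.
rewrite ge0_integralZl_EFin //.
- have -> : (\int[lebesgue_measure]_(x in [set: R]) (\1_J x)%:E)%E = lebesgue_measure J.
    have := @integral_indic _ _ R lebesgue_measure [set: R] measurableT J mJ.
    by rewrite (_ : J `&` [set: R] = J) ?setIT.
  rewrite lebesgue_measure_itv /= lte_fin ltrDl.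
  case: ltP => sp; last by rewrite (le_anti (introT andP (conj sp s0))) mule0 expr0n mulr0.
  by rewrite -EFinD addrAC subrr add0r -EFinM exprSr mulrA.
- by apply/measurable_EFinP; exact: measurable_indic.
- by rewrite mulr_ge0 // exprn_ge0.
Qed.

End BoxVolume.

Section Charts.
Context {R : realType} {m : nat} {M : manifold_data R m}.
Hypothesis sM : smooth_manifold M.
Implicit Types (i j : index M) (x : M) (y : 'rV[R]_m).

Definition chart_image i : set 'rV[R]_m := coord i @` dom i.

Lemma chart_imageP i x : dom i x -> chart_image i (coord i x).
Proof. by move=> ix; exists x. Qed.

Lemma paramK i y : chart_image i y -> coord i (param i y) = y.
Proof. by move=> [x ix <-]; rewrite (manifold_coordK sM). Qed.

Lemma dom_param i y : chart_image i y -> dom i (param i y).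
Proof. by move=> [x ix <-]; rewrite (manifold_coordK sM). Qed.

Lemma coord_continuous_at i x : dom i x -> {for x, continuous (coord i)}.
Proof.
move=> ix; have := @manifold_coord_cont _ _ _ sM i.
rewrite (continuous_open_subspace _ (@manifold_dom_open _ _ _ sM i)); apply.
by rewrite inE.
Qed.

Lemma param_continuous_at i y : chart_image i y -> {for y, continuous (param i)}.
Proof.
move=> iy; have := @manifold_param_cont _ _ _ sM i.
rewrite (continuous_open_subspace _ (@manifold_image_open _ _ _ sM i)); apply.
by rewrite inE.
Qed.

Lemma near_dom i x : dom i x -> \forall z \near x, dom i z.
Proof. by move=> ix; apply: open_nbhs_nbhs; split => //; exact: manifold_dom_open. Qed.

Lemma near_chart_image i y : chart_image i y -> \forall z \near y, chart_image i z.
Proof. by move=> iy; apply: open_nbhs_nbhs; split => //; exact: manifold_image_open. Qed.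

Lemma open_coord_preimage i (U : set 'rV[R]_m) :
  open U -> open (dom i `&` coord i @^-1` U).
Proof.
move=> oU; rewrite openE => x [ix Ux].
have n1 : nbhs x (coord i @^-1` U).
  by apply: (coord_continuous_at ix); apply: open_nbhs_nbhs.
exact: filterI (near_dom ix) n1.
Qed.

Lemma open_param_preimage i (U : set M) :
  open U -> open (chart_image i `&` param i @^-1` U).
Proof.
move=> oU; rewrite openE => y [iy Uy].
have n1 : nbhs y (param i @^-1` U).
  by apply: (param_continuous_at iy); apply: open_nbhs_nbhs.
exact: filterI (near_chart_image iy) n1.
Qed.

Lemma borel_open (U : set M) : open U -> @measurable _ (borelType M) U.
Proof. by move=> oU; apply: sub_sigma_algebra. Qed.

Definition chart_box i (b : 'rV[R]_m) (s : R) : set M :=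
  dom i `&` coord i @^-1` (box b s).

(** Each half-open condition on a coordinate is a difference of two open conditions. *)
Lemma chart_box_measurable i b s : @measurable _ (borelType M) (chart_box i b s).
Proof.
pose lt_set (k : 'I_m) (t : R) : set 'rV[R]_m := [set y | y 0 k < t].
have olt k t : open (lt_set k t).
  rewrite /lt_set -[X in open X]/((fun y : 'rV[R]_m => y 0 k) @^-1` [set r | r < t]).
  apply: open_comp; last exact: open_lt.
  by move=> y _; exact: coord_continuous.
have mlt k t : @measurable _ (borelType M) (dom i `&` coord i @^-1` lt_set k t).
  by apply: borel_open; exact: open_coord_preimage.
have md : @measurable _ (borelType M) (dom i).
  by apply: borel_open; exact: manifold_dom_open.
have -> : chart_box i b s = dom i `&` \big[setI/setT]_(k < m)
   ((dom i `&` coord i @^-1` lt_set k (b 0 k + s)) `\`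
    (dom i `&` coord i @^-1` lt_set k (b 0 k))).
  apply/seteqP; split => x.
    move=> [ix bx]; split => //; rewrite -bigcap_seq => k _ /=.
    have /andP[b1 b2] := bx k; split => //= -[_].
    by rewrite /lt_set /= ltNge b1.
  move=> [ix]; rewrite -bigcap_seq => H; split => // k.
  have [|[_ /= h1] h2] := H k; first exact: mem_index_enum.
  rewrite /lt_set /= in h1 h2; rewrite h1 andbT leNgt; apply/negP => h; exact: h2.
apply: measurableI => //; apply: bigsetI_measurable => k _.
exact: measurableD.
Qed.

Variable vol : {measure set (borelType M) -> \bar R}.
Hypothesis vM : is_riemannian_volume vol.

(** Monotonicity between the constants [u] and [v] on the box, whose integrals are explicit. This
    provides [cell_measure] for the Riemannian volume. *)
Lemma chart_box_volume i b s u v : cbox b s `<=` chart_image i -> 0 <= s -> 0 <= u -> u <= v ->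
  (forall y, box b s y -> u <= Num.sqrt (\det (metric i y)) <= v) ->
  ((u * s ^+ m)%:E <= vol (chart_box i b s) <= (v * s ^+ m)%:E)%E.
Proof.
move=> bi s0 u0 uv H.
have im : coord i @` chart_box i b s = box b s.
  apply/seteqP; split => [y [x [_ bx] <-] //|y yb].
  have iy := bi _ (sub_box_cbox yb).
  exists (param i y); last exact: paramK.
  by split; [exact: dom_param|rewrite /= paramK].
rewrite (@vM i _ (@chart_box_measurable i b s)); last by move=> x [].
rewrite -(lebesgue_integral_rV_box b s0 u0) -(lebesgue_integral_rV_box b s0 (le_trans u0 uv)) im.
apply/andP; split; apply: le_lebesgue_integral_rV => y; rewrite lee_fin.
- by rewrite mulr_ge0.
- rewrite mulrC indicE; case: (boolP (y \in _)) => [|_]; last by rewrite !mul0r.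
  by rewrite inE => /H /andP[h _]; rewrite !mul1r.
- by rewrite mulr_ge0 // sqrtr_ge0.
- rewrite [leRHS]mulrC indicE; case: (boolP (y \in _)) => [|_]; last by rewrite !mul0r.
  by rewrite inE => /H /andP[_ h]; rewrite !mul1r.
Qed.

End Charts.

(** * Divergence, Levi-Civita connection and warped products *)

Section Divergence.
Context {R : realType}.

Lemma near_gt (t v : R) : t < v -> \forall w \near v, t < w.
Proof.
by move=> tv; apply: (@open_nbhs_nbhs _ v [set w | t < w]); split => //; exact: open_gt.
Qed.

Lemma C1R_sqrt (v : R) : 0 < v -> C1R (@Num.sqrt R) v.
Proof.
have E (w : R) : 0 < w -> derive1 (@Num.sqrt R) w = (2 * Num.sqrt w)^-1.
  by move=> w0; rewrite derive1E; exact: derive_sqrt.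
move=> /near_gt; apply: filterS => w w0; split.
  by have [] := is_derive1_sqrt w0.
apply: (@continuous_near_eq _ _ (fun u : R => (2 * Num.sqrt u)^-1)).
  by apply: filterS (near_gt w0) => u /E.
apply: (@continuousV _ _ (fun u : R => 2 * Num.sqrt u)).
  by rewrite mulf_neq0 // sqrtr_eq0 -ltNge.
apply: (@continuous_mul _ _ (fun=> 2)); first exact: continuous_cst.
exact: sqrt_continuous.
Qed.

Variable m : nat.
Implicit Types (y z : 'rV[R]_m).

(** [F] is the flux of [w grad eta] times the volume density. The factor of [w y] is the Laplacian
    of [eta], expanded in the shape of the left side of [soliton_algebra]. *)
Lemma divergence_expand (G : 'rV[R]_m -> 'M[R]_m) (w eta : 'rV[R]_m -> R) y :
  (forall a b, C1at (fun z => G z a b) y) ->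
  (\forall z \near y, 0 < \det (G z)) ->
  C1at w y -> (forall q, C1at (partial q eta) y) ->
  let dG p : 'M[R]_m := \matrix_(a, b) partial p (fun z => G z a b) y in
  let B := invmx (G y) in
  let F p z := Num.sqrt (\det (G z)) * (w z * \sum_q invmx (G z) p q * partial q eta z) in
  (forall p, C1at (F p) y) /\
  \sum_p partial p (F p) y = Num.sqrt (\det (G y)) *
   (w y * \sum_p \sum_q (B p q * partial p (partial q eta) y
       - (B *m dG p *m B) p q * partial q eta y
       + 2^-1 * \tr (B *m dG p) * B p q * partial q eta y)
    + \sum_p \sum_q B p q * partial p w y * partial q eta y).
Proof.
move=> Gy G0 wy ey dG B F.
have Gu : \forall z \near y, G z \in unitmx.
  by apply: filterS G0 => z z0; rewrite unitmxE unitfE gt_eqF.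
have dy := C1at_det Gy.
have d0 := nbhs_singleton G0.
have sy : C1at (fun z => Num.sqrt (\det (G z))) y.
  by apply: (C1at_comp1 dy); exact: C1R_sqrt.
have ie p q : C1at (fun z => invmx (G z) p q * partial q eta z) y.
  by apply: C1atM; [exact: C1at_invmx|exact: ey].
have Vy p : C1at (fun z => \sum_q invmx (G z) p q * partial q eta z) y.
  by apply: C1at_sum => q _; exact: ie.
have Wy p : C1at (fun z => w z * \sum_q invmx (G z) p q * partial q eta z) y.
  exact: C1atM.
split=> [p|]; first exact: C1atM.
have ds p : partial p (fun z => Num.sqrt (\det (G z))) y
    = Num.sqrt (\det (G y)) * (2^-1 * \tr (B *m dG p)).
  rewrite (@partial_comp1 _ _ (@Num.sqrt R) (fun z => \det (G z))).
  - rewrite derive1E derive_sqrt // (partial_det_trace Gy Gu) -/B.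
    have s0 : Num.sqrt (\det (G y)) != 0 by rewrite sqrtr_eq0 -ltNge.
    rewrite [LHS]mulrA [RHS]mulrA; congr (_ * _).
    by rewrite -[X in _ * X](sqr_sqrtr (ltW d0)); field.
  - exact: C1at_differentiable.
  - by have [] := is_derive1_sqrt d0.
rewrite mulrDr mulrA mulr_sumr mulr_sumr -big_split; apply: eq_bigr => p _ /=.
rewrite (partialM p sy (Wy p)) (partialM p wy (Vy p)) ds partial_sum; last by move=> q _; exact: ie.
have -> : \sum_q partial p (fun z => invmx (G z) p q * partial q eta z) y
  = \sum_q (B p q * partial p (partial q eta) y
     - (B *m dG p *m B) p q * partial q eta y).
  apply: eq_bigr => q _.
  rewrite (partialM p (@C1at_invmx _ _ _ _ _ Gy Gu p q) (ey q)).
  by rewrite (partial_invmx Gy Gu) -/B -/(dG p); ring.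
set s := Num.sqrt _; set t := \tr _.
rewrite -/B !sumrB big_split /= sumrB.
have -> : \sum_q 2^-1 * t * B p q * partial q eta y
   = 2^-1 * t * \sum_q B p q * partial q eta y.
  by rewrite mulr_sumr; apply: eq_bigr => q _; ring.
have -> : \sum_q B p q * partial p w y * partial q eta y
   = partial p w y * \sum_q B p q * partial q eta y.
  by rewrite mulr_sumr; apply: eq_bigr => q _; ring.
ring.
Qed.

End Divergence.

Section MetricCompat.
Context {R : realType}.

Lemma christoffel_lowered (n : nat) (G : 'rV[R]_n -> 'M[R]_n) x b c e :
  (G x)^T = G x -> G x \in unitmx ->
  \sum_a christoffel G a b c x * G x a e
   = 2^-1 * (partial b (fun y => G y e c) x + partial c (fun y => G y e b) x
             - partial e (fun y => G y b c) x).
Proof.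
move=> Gt Gu; rewrite /christoffel.
have iv : (invmx (G x))^T = invmx (G x) by rewrite trmx_inv Gt.
have ivE a d : invmx (G x) a d = invmx (G x) d a by rewrite -{1}iv mxE.
pose L d := partial b (fun y => G y d c) x + partial c (fun y => G y d b) x
             - partial d (fun y => G y b c) x.
transitivity (\sum_d 2^-1 * L d * (invmx (G x) *m G x) d e).
  under eq_bigr do rewrite mulr_sumr mulr_suml.
  rewrite exchange_big /=; apply: eq_bigr => d _.
  rewrite mxE mulr_sumr; apply: eq_bigr => a _.
  by rewrite (ivE a d) /L; ring.
rewrite mulVmx // (bigD1 e) //= mxE eqxx mulr1 big1 ?addr0 // => d de.
by rewrite mxE (negbTE de) mulr0.
Qed.

Lemma mx3E (m n q : nat) (u : 'M[R]_(m, n)) (G : 'M[R]_n) (J : 'M[R]_(q, n)) i l :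
  (u *m G *m J^T) i l = \sum_a \sum_b u i a * G a b * J l b.
Proof.
rewrite mxE exchange_big; apply: eq_bigr => b _ /=.
by rewrite !mxE mulr_suml; apply: eq_bigr.
Qed.

Variables (m n : nat) (D : set 'rV[R]_m) (f : 'rV[R]_m -> 'rV[R]_n).
Hypothesis oD : open D.
Hypothesis fD : smooth_on D f.

Lemma smooth_entry a : smooth_on D (fun z => f z 0 a).
Proof. exact: smooth_on_entry. Qed.

Lemma smooth_differentiable y : D y -> differentiable f y.
Proof.
move=> Dy; apply: differentiable_entries => a; apply: C1at_differentiable.
exact: smooth_on_C1at oD Dy (smooth_entry a).
Qed.

Lemma jacobian_smooth y k a : D y -> 'J f y k a = partial k (fun z => f z 0 a) y.
Proof. by move=> Dy; apply: jacobian_entry; exact: smooth_differentiable. Qed.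

Lemma partial_entry y k a : D y -> partial k f y 0 a = partial k (fun z => f z 0 a) y.
Proof.
move=> Dy; rewrite /partial derive_mx ?mxE //.
by have [_] := fD [::] Dy; apply.
Qed.

Lemma partial2_entry y p k a : D y ->
  partial p (partial k f) y 0 a = partial p (partial k (fun z => f z 0 a)) y.
Proof.
move=> Dy; rewrite {1}/partial derive_mx ?mxE; last first.
  by have [_] := fD [:: k] Dy; apply.
apply: partial_near_eq; apply: filterS (open_nbhs_nbhs (conj oD Dy)) => z.
exact: partial_entry.
Qed.

Variable G : 'rV[R]_n -> 'M[R]_n.

(** The formula of [covariant_derivative], for an arbitrary local representation and metric in place
    of those of the preferred charts. *)
Definition cov_derivative y (p k : 'I_m) : 'rV[R]_n :=
  \row_a (partial p (partial k f) y 0 a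
    + \sum_b \sum_c christoffel G a b c (f y) * 'J f y p b * 'J f y k c).

Variable y : 'rV[R]_m.
Hypothesis Dy : D y.
Hypothesis GC : forall a b, C1at (fun x => G x a b) (f y).
Hypothesis Gt : \forall x \near f y, (G x)^T = G x.
Hypothesis Gu : G (f y) \in unitmx.

(** Christoffel symbols of the first kind at [f y], the lowered index coming first. *)
Let low b c d : R := 2^-1 * (partial c (fun x => G x b d) (f y)
   + partial d (fun x => G x b c) (f y) - partial b (fun x => G x c d) (f y)).

Lemma partial_metric_sym c a b :
  partial c (fun x => G x a b) (f y) = partial c (fun x => G x b a) (f y).
Proof.
by apply: partial_near_eq; apply: filterS Gt => x Gx; rewrite -[in LHS]Gx mxE.
Qed.

Lemma christoffel_sym a b c : christoffel G a b c (f y) = christoffel G a c b (f y).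
Proof.
rewrite /christoffel; apply: (f_equal (fun v => 2^-1 * v)); apply: eq_bigr => d _.
apply: (f_equal (fun v => _ * v)); rewrite (partial_metric_sym d c b).
apply: (f_equal (fun v => v - _)); exact: addrC.
Qed.

Lemma cov_derivativeE p k a : cov_derivative y p k 0 a
  = partial p (partial k (fun z => f z 0 a)) y
    + \sum_b \sum_c christoffel G a b c (f y) * 'J f y p b * 'J f y k c.
Proof. by rewrite [LHS]mxE (partial2_entry p k a Dy). Qed.

Lemma cov_derivative_sym p k : cov_derivative y p k = cov_derivative y k p.
Proof.
apply/rowP => a; rewrite !cov_derivativeE.
rewrite (smooth_on_partial_comm p k oD Dy (smooth_entry a)).
apply: (f_equal (fun v => _ + v)).
rewrite exchange_big; apply: eq_bigr => b _; apply: eq_bigr => c _ /=.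
by rewrite mulrAC christoffel_sym.
Qed.

Lemma cov_derivative_lowered p k l :
  (cov_derivative y p k *m G (f y) *m ('J f y)^T) 0 l
   = \sum_a \sum_b partial p (partial k (fun z => f z 0 a)) y * G (f y) a b * 'J f y l b
    + \sum_b \sum_c \sum_d low b c d * 'J f y p c * 'J f y k d * 'J f y l b.
Proof.
rewrite mx3E.
under eq_bigr do under eq_bigr do rewrite cov_derivativeE mulrDl mulrDl.
under eq_bigr do rewrite big_split.
rewrite big_split; congr (_ + _); rewrite exchange_big; apply: eq_bigr => b _ /=.
under eq_bigr do rewrite !mulr_suml.
rewrite exchange_big; apply: eq_bigr => c _ /=.
under eq_bigr do rewrite !mulr_suml.
rewrite exchange_big; apply: eq_bigr => d _ /=.
rewrite /low -christoffel_lowered ?(nbhs_singleton Gt) // !mulr_suml.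
by apply: eq_bigr => a _; ring.
Qed.

(** The Levi-Civita connection along [f] is metric. The terms with second derivatives of [f] agree
    on both sides, and the others reduce to [low b c d + low d c b], which is the derivative of
    [G d b] in the direction [c]. *)
Lemma metric_compat p k l :
  partial p (fun z => ('J f z *m G (f z) *m ('J f z)^T) k l) y
   = (cov_derivative y p k *m G (f y) *m ('J f y)^T) 0 l
   + (cov_derivative y p l *m G (f y) *m ('J f y)^T) 0 k.
Proof.
pose fa a z := f z 0 a.
have fC a k' : C1at (partial k' (fa a)) y.
  by apply: (smooth_on_C1at oD Dy); apply: smooth_on_partial; exact: smooth_entry.
have fa1 a : C1at (fa a) y by exact: smooth_on_C1at oD Dy (smooth_entry a).
have GfC a b : C1at (fun z => G (f z) a b) y by apply: (@C1at_chain R m n (fun x => G x a b) f y (GC a b)) => c; exact: fa1.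
transitivity (partial p (fun z => \sum_a \sum_b
    partial k (fa a) z * G (f z) a b * partial l (fa b) z) y).
  apply: partial_near_eq; apply: filterS (open_nbhs_nbhs (conj oD Dy)) => z Dz.
  rewrite mx3E; apply: eq_bigr => a _; apply: eq_bigr => b _.
  by rewrite !jacobian_smooth.
have t1 a b : C1at (fun z => partial k (fa a) z * G (f z) a b) y by exact: C1atM.
have t2 a b : C1at (fun z => partial k (fa a) z * G (f z) a b * partial l (fa b) z) y.
  exact: C1atM.
rewrite partial_sum => [|a _]; last by apply: C1at_sum.
rewrite (eq_bigr (fun a => \sum_b
   (partial p (partial k (fa a)) y * G (f y) a b * 'J f y l b
    + ((\sum_c partial c (fun x => G x a b) (f y) * 'J f y p c * 'J f y k a * 'J f y l b)
    + partial p (partial l (fa b)) y * G (f y) b a * 'J f y k a)))); last first.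
  move=> a _; rewrite partial_sum //; apply: eq_bigr => b _.
  rewrite (partialM p (t1 a b) (fC b l)) (partialM p (fC a k) (GfC a b)).
  rewrite (@partial_chain _ _ _ (fun x => G x a b)); first last.
  - by move=> c; exact: C1at_differentiable (fa1 c).
  - exact: C1at_differentiable (GC a b).
  rewrite !jacobian_smooth // -/(fa a) -/(fa b) mulr_sumr mulrDl mulr_suml -addrA.
  congr (_ + (_ + _)).
    by apply: eq_bigr => c _; rewrite jacobian_smooth // -/(fa c); ring.
  have -> : G (f y) b a = G (f y) a b by rewrite -[in LHS](nbhs_singleton Gt) mxE.
  by ring.
under eq_bigr do rewrite big_split big_split.
rewrite big_split big_split /= !cov_derivative_lowered -!addrA; congr (_ + _).
rewrite [LHS]addrC [RHS]addrCA; congr (_ + _); first by rewrite exchange_big.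
rewrite [X in _ + X]exchange_big /=.
transitivity (\sum_b \sum_c \sum_d
   partial c (fun x => G x d b) (f y) * 'J f y p c * 'J f y k d * 'J f y l b).
  rewrite exchange_big; apply: eq_bigr => b _ /=; by rewrite exchange_big.
have -> : \sum_c \sum_b \sum_d low b c d * 'J f y p c * 'J f y l d * 'J f y k b
  = \sum_b \sum_c \sum_d low d c b * 'J f y p c * 'J f y l b * 'J f y k d.
  rewrite [RHS]exchange_big; apply: eq_bigr => c _ /=; by rewrite exchange_big.
rewrite -big_split; apply: eq_bigr => b _ /=.
rewrite -big_split; apply: eq_bigr => c _ /=.
rewrite -big_split; apply: eq_bigr => d _ /=.
rewrite /low (partial_metric_sym c d b) (partial_metric_sym d c b).
rewrite (partial_metric_sym b d c); by field.
Qed.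

End MetricCompat.

Section Coordinates.
Context {R : realType}.

Lemma derive_coord (m : nat) (a : 'I_m) (y v : 'rV[R]_m) :
  'D_v (fun z : 'rV[R]_m => z 0 a) y = v 0 a.
Proof.
apply: lim_near_cst => //; near=> h.
rewrite /= !mxE addrK /GRing.scale /= mulrA mulVf ?mul1r //.
by near: h; exact: nbhs_dnbhs_neq.
Unshelve. all: by end_near. Qed.

Lemma partial_coord (m : nat) (a i : 'I_m) (y : 'rV[R]_m) :
  partial i (fun z : 'rV[R]_m => z 0 a) y = (a == i)%:R.
Proof. by rewrite /partial derive_coord mxE eqxx. Qed.

Lemma C1at_coord (m : nat) (a : 'I_m) (y : 'rV[R]_m) : C1at (fun z => z 0 a) y.
Proof.
apply: (@C1atI _ _ _ _ (fun i _ => (a == i)%:R)).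
  apply: near_always => z; split; first exact: differentiable_coord.
  by move=> i; exact: partial_coord.
by apply: near_always => z i; exact: continuous_cst.
Qed.

Lemma smooth_real_C1R (I : set R) (h : R -> R) t k :
  open I -> I t -> smooth_real_on I h -> C1R (derive1n k h) t.
Proof.
move=> oI It hI; apply: filterS (open_nbhs_nbhs (conj oI It)) => u Iu.
split; first exact: hI.
apply: differentiable_continuous; apply/derivable1_diffP.
exact: (hI k.+1 u Iu).
Qed.

Section Warped.
Variables (n : nat) (I : set R) (h : R -> R) (E : set 'rV[R]_n).
Variable G : 'rV[R]_n -> 'M[R]_n.
Hypothesis oI : open I.
Hypothesis h0 : forall t, I t -> 0 < h t.
Hypothesis hI : smooth_real_on I h.
Hypothesis oE : open E.
Hypothesis GE : smooth_on E G.
Hypothesis Gt : forall y, E y -> (G y)^T = G y.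
Hypothesis Gpos : forall y u, E y -> u != 0 -> 0 < inner (G y) u u.

Let W := warped_metric h G.

Definition warped_domain : set 'rV[R]_(1 + n) :=
  [set z : 'rV[R]_(1 + n) | I (z 0 0) /\ E (rsubmx z)].

Lemma ord0_lshift : (0 : 'I_(1 + n)) = lshift n (0 : 'I_1).
Proof. exact: val_inj. Qed.

Lemma lsubmx00 (z : 'rV[R]_(1 + n)) : lsubmx z 0 0 = z 0 0.
Proof. by rewrite mxE -ord0_lshift. Qed.

Lemma rsubmx_continuous : continuous (@rsubmx R 1 1 n).
Proof. exact: continuous_rsubmx. Qed.

Lemma open_warped_domain : open warped_domain.
Proof.
rewrite openE => z [Iz Ez].
have n1 : nbhs z ((fun z : 'rV[R]_(1 + n) => z 0 0) @^-1` I).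
  by apply: (@coord_continuous R 1 (1 + n) 0 0 z); apply: open_nbhs_nbhs.
have n2 : nbhs z (rsubmx @^-1` E).
  by have c := @rsubmx_continuous z; apply: (c E); apply: open_nbhs_nbhs.
exact: filterI n1 n2.
Qed.

Lemma near_warped_domain z : warped_domain z -> \forall x \near z, warped_domain x.
Proof. by move=> Dz; apply: open_nbhs_nbhs; split => //; exact: open_warped_domain. Qed.

Lemma warped00 z : W z 0 0 = 1.
Proof. by rewrite /W /warped_metric ord0_lshift block_mxEul mxE. Qed.

Lemma warped0r z b : W z 0 (rshift 1 b) = 0.
Proof. by rewrite /W /warped_metric ord0_lshift block_mxEur mxE. Qed.

Lemma warpedr0 z b : W z (rshift 1 b) 0 = 0.
Proof. by rewrite /W /warped_metric ord0_lshift block_mxEdl mxE. Qed.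

Lemma warpedrr z b c : W z (rshift 1 b) (rshift 1 c) = h (z 0 0) ^+ 2 * G (rsubmx z) b c.
Proof. by rewrite /W /warped_metric block_mxEdr mxE lsubmx00. Qed.

Variant ord_1n_spec : 'I_(1 + n) -> Type :=
  | Ord1nZero : ord_1n_spec 0
  | Ord1nShift b : ord_1n_spec (rshift 1 b).

Lemma ord_1nP b : ord_1n_spec b.
Proof.
case: (split_ordP b) => j ->; last by constructor.
by rewrite (ord1 j) -ord0_lshift; constructor.
Qed.

Lemma warped_sym z : warped_domain z -> (W z)^T = W z.
Proof.
move=> [_ Ez]; apply/matrixP => b c; rewrite mxE.
case: (ord_1nP b) => [|{}b]; case: (ord_1nP c) => [|{}c]; rewrite ?warped0r ?warpedr0 //.
by rewrite !warpedrr -[in RHS](Gt Ez) mxE.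
Qed.

Lemma inner_warped z (u : 'rV[R]_(1 + n)) :
  inner (W z) u u = u 0 0 ^+ 2 + h (z 0 0) ^+ 2 * inner (G (rsubmx z)) (rsubmx u) (rsubmx u).
Proof.
rewrite /inner -{1 2}[u]hsubmxK /W /warped_metric mul_row_block tr_row_mx mul_row_col.
rewrite !mulmx0 addr0 add0r mulmx1 mxE lsubmx00; congr (_ + _).
  by rewrite mxE big_ord1 [_^T _ _]mxE !lsubmx00 expr2.
by rewrite -scalemxAr -scalemxAl mxE.
Qed.

Lemma warped_posdef z u : warped_domain z -> u != 0 -> 0 < inner (W z) u u.
Proof.
move=> [Iz Ez] u0; rewrite inner_warped.
have hp : 0 < h (z 0 0) ^+ 2 by rewrite exprn_gt0 // h0.
have [ru|ru] := eqVneq (rsubmx u) 0.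
  have u00 : u 0 0 != 0.
    apply: contraNneq u0 => u00; rewrite -[u]hsubmxK ru.
    have -> : lsubmx u = 0 by apply/matrixP => i j; rewrite !ord1 lsubmx00 u00 mxE.
    by rewrite row_mx0.
  by rewrite ltr_pwDl ?exprn_even_gt0 // ru /inner mul0mx mul0mx mxE mulr0.
by rewrite ltr_wpDl ?sqr_ge0 // mulr_gt0 // Gpos.
Qed.

Lemma warped_unitmx z : warped_domain z -> W z \in unitmx.
Proof.
move=> Dz; apply: posdef_unitmx; first exact: warped_sym.
by move=> u; exact: warped_posdef.
Qed.

Lemma C1at_warp z : warped_domain z -> C1at (fun x => h (x 0 0) ^+ 2) z.
Proof.
move=> [Iz _]; have hc : C1at (fun x => h (x 0 0)) z.
  apply: (@C1at_comp1 _ _ h (fun x : 'rV[R]_(1 + n) => x 0 0)); first exact: C1at_coord.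
  exact: (@smooth_real_C1R I h _ 0%N oI Iz hI).
by apply: C1at_near_eq (C1atM hc hc); apply: near_always => x; rewrite expr2.
Qed.

Lemma C1at_fiber z b c : warped_domain z -> C1at (fun x : 'rV[R]_(1 + n) => G (rsubmx x) b c) z.
Proof.
move=> [_ Ez]; apply: (@C1at_chain _ _ _ (fun y => G y b c) rsubmx).
  by apply: (smooth_on_C1at oE Ez); exact: smooth_on_entry.
move=> a; apply: C1at_near_eq (C1at_coord (rshift 1 a) z).
by apply: near_always => x; rewrite mxE.
Qed.

Lemma C1at_warped z b c : warped_domain z -> C1at (fun x => W x b c) z.
Proof.
move=> Dz; case: (ord_1nP b) => [|{}b]; case: (ord_1nP c) => [|{}c].
- by apply: C1at_near_eq (C1at_cst 1 z); apply: near_always => x; rewrite warped00.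
- by apply: C1at_near_eq (C1at_cst 0 z); apply: near_always => x; rewrite warped0r.
- by apply: C1at_near_eq (C1at_cst 0 z); apply: near_always => x; rewrite warpedr0.
- apply: C1at_near_eq (C1atM (C1at_warp Dz) (C1at_fiber b c Dz)).
  by apply: near_always => x; rewrite warpedrr.
Qed.

Lemma partial_warped0 z i c : partial i (fun x => W x 0 c) z = 0.
Proof.
case: (ord_1nP c) => [|{}c].
- rewrite -(partial_cst 1 z i); apply: partial_near_eq.
  by apply: near_always => x; rewrite warped00.
- rewrite -[RHS](partial_cst 0 z i); apply: partial_near_eq.
  by apply: near_always => x; rewrite warped0r.
Qed.

(** The time derivative of the warped metric is [2 (h' / h)] times its fibre part [W - dt^2]; the
    identity is multiplied out by [h]. *)
Lemma partial0_warped z b c : warped_domain z ->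
  h (z 0 0) * partial 0 (fun x => W x b c) z
   = 2 * derive1 h (z 0 0) * (W z b c - (b == 0)%:R * (c == 0)%:R).
Proof.
move=> Dz; case: (ord_1nP b) => [|{}b].
  rewrite partial_warped0 mulr0 eqxx mul1r; case: (ord_1nP c) => [|{}c].
    by rewrite warped00 eqxx subrr mulr0.
  by rewrite warped0r; case: eqP => // _; rewrite subrr mulr0.
have rn0 (a : 'I_n) : (rshift 1 a == 0 :> 'I_(1 + n)) = false by [].
rewrite rn0 mul0r subr0; case: (ord_1nP c) => [|{}c].
  rewrite warpedr0 mulr0 -[RHS](mulr0 (h (z 0 0))); congr (_ * _).
  rewrite -[RHS](partial_cst 0 z 0); apply: partial_near_eq.
  by apply: near_always => x; rewrite warpedr0.
rewrite warpedrr.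
transitivity (h (z 0 0) * partial 0 (fun x : 'rV[R]_(1 + n) => h (x 0 0) ^+ 2 * G (rsubmx x) b c) z).
  congr (_ * _); apply: partial_near_eq; apply: near_always => x; exact: warpedrr.
rewrite (partialM 0 (C1at_warp Dz) (C1at_fiber b c Dz)).
have -> : partial 0 (fun x : 'rV[R]_(1 + n) => G (rsubmx x) b c) z = 0.
  have [_ Ez] := Dz.
  have dG : differentiable (fun y => G y b c) (rsubmx z).
    by apply: C1at_differentiable; apply: (smooth_on_C1at oE Ez); exact: smooth_on_entry.
  have dT a : differentiable (fun x : 'rV[R]_(1 + n) => @rsubmx R 1 1 n x 0 a) z.
    apply: C1at_differentiable.
    apply: C1at_near_eq (C1at_coord (rshift 1 a) z).
    by apply: near_always => x; rewrite mxE.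
  apply: etrans (partial_chain 0 dG dT) _; apply: big1 => a _.
  rewrite (_ : partial 0 _ z = 0) ?mul0r //.
  transitivity (partial 0 (fun x : 'rV[R]_(1 + n) => x 0 (rshift 1 a)) z).
    by apply: partial_near_eq; apply: near_always => x; rewrite mxE.
  by rewrite partial_coord rn0.
have [Iz _] := Dz.
have hc : C1at (fun x : 'rV[R]_(1 + n) => h (x 0 0)) z.
  apply: (@C1at_comp1 _ _ h (fun x : 'rV[R]_(1 + n) => x 0 0)); first exact: C1at_coord.
  exact: (@smooth_real_C1R I h _ 0%N oI Iz hI).
have -> : partial 0 (fun x : 'rV[R]_(1 + n) => h (x 0 0) ^+ 2) z
    = 2 * h (z 0 0) * derive1 h (z 0 0).
  transitivity (partial 0 (fun x : 'rV[R]_(1 + n) => h (x 0 0) * h (x 0 0)) z).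
    by apply: partial_near_eq; apply: near_always => x; rewrite expr2.
  rewrite (partialM 0 hc hc).
  rewrite (@partial_comp1 _ _ h (fun x : 'rV[R]_(1 + n) => x 0 0)).
  - by rewrite partial_coord eqxx mulr1; ring.
  - exact: differentiable_coord.
  - exact: (@hI 0%N _ Iz).
by ring.
Qed.

Section Field.
Variable z : 'rV[R]_(1 + n).
Hypothesis Dz : warped_domain z.
Let X : 'rV[R]_(1 + n) := row_mx (h (z 0 0))%:M 0.

Lemma warped_fieldE b : X 0 b = (b == 0)%:R * h (z 0 0).
Proof.
rewrite /X; case: (ord_1nP b) => [|{}b].
  have E0 (A : 'M[R]_1) (B : 'rV[R]_n) : row_mx A B 0 0 = A 0 0.
    by rewrite [X in row_mx A B _ X]ord0_lshift row_mxEl.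
  by rewrite E0 mxE eqxx mul1r.
by rewrite row_mxEr mxE mul0r.
Qed.

Lemma warped_field_inner (u : 'rV[R]_(1 + n)) : (u *m W z *m X^T) 0 0 = u 0 0 * h (z 0 0).
Proof.
rewrite mx3E exchange_big (bigD1 0) //= [X in _ + X]big1 ?addr0; last first.
  by move=> b b0; rewrite big1 // => a _; rewrite warped_fieldE (negbTE b0) mul0r mulr0.
rewrite (bigD1 0) //= [X in _ + X]big1 ?addr0; last first.
  move=> a a0; case: (ord_1nP a) a0 => [//|{}a _]; by rewrite warpedr0 mulr0 mul0r.
by rewrite warped00 warped_fieldE eqxx mul1r mulr1.
Qed.

(** Row 0 of [W] is constant, so lowering the index 0 changes nothing and only the time derivative
    of [W] survives. *)
Lemma warped_christoffel0 b c : h (z 0 0) * christoffel W 0 b c z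
  = - (derive1 h (z 0 0) * (W z b c - (b == 0)%:R * (c == 0)%:R)).
Proof.
have -> : christoffel W 0 b c z = \sum_a christoffel W a b c z * W z a 0.
  rewrite (bigD1 0) //= warped00 mulr1 big1 ?addr0 // => a a0.
  by case: (ord_1nP a) a0 => [//|{}a _]; rewrite warpedr0 mulr0.
rewrite christoffel_lowered; [|exact: warped_sym|exact: warped_unitmx].
rewrite !partial_warped0 addr0 sub0r mulrCA mulrN (partial0_warped b c Dz).
by field.
Qed.

End Field.

(** Expresses that [h d_t] is a closed conformal gradient field. The first two terms on the right
    are the second derivative of a primitive of [h] composed with [tau], and the last is [h'] times
    the induced metric. *)
Lemma warped_cov_derivative (m : nat) (D : set 'rV[R]_m) (f : 'rV[R]_m -> 'rV[R]_(1 + n)) y k l :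
  open D -> smooth_on D f -> D y -> warped_domain (f y) ->
  let t := f y 0 0 in let tau z := f z 0 0 in
  (cov_derivative f W y k l *m W (f y) *m (row_mx (h t)%:M 0 : 'rV[R]_(1 + n))^T) 0 0
   = h t * partial k (partial l tau) y + derive1 h t * partial k tau y * partial l tau y
     - derive1 h t * ('J f y *m W (f y) *m ('J f y)^T) k l.
Proof.
move=> oD fD Dy Dz t tau; rewrite warped_field_inner.
rewrite (@cov_derivativeE _ _ _ D) // mulrDl -/tau -/t mulrC -addrA; congr (_ + _).
rewrite mx3E mulr_suml.
transitivity (\sum_b \sum_c - (derive1 h t * (W (f y) b c - (b == 0)%:R * (c == 0)%:R))
   * 'J f y k b * 'J f y l c).
  apply: eq_bigr => b _; rewrite mulr_suml; apply: eq_bigr => c _.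
  by rewrite -(warped_christoffel0 Dz) -/t; ring.
have J0 q : 'J f y q 0 = partial q tau y by rewrite (@jacobian_smooth _ _ _ D).
have -> : derive1 h t * partial k tau y * partial l tau y
  = \sum_b \sum_c derive1 h t * ((b == 0)%:R * (c == 0)%:R) * 'J f y k b * 'J f y l c.
  rewrite (bigD1 0) //= [X in _ + X]big1 ?addr0; last first.
    by move=> b b0; apply: big1 => c _; rewrite (negbTE b0) mul0r mulr0 !mul0r.
  rewrite (bigD1 0) //= [X in _ + X]big1 ?addr0; last first.
    by move=> c c0; rewrite (negbTE c0) mulr0 mulr0 !mul0r.
  by rewrite ?eqxx !J0 (_ : true%:R = 1 :> R) // !mulr1.
rewrite mulr_sumr -sumrB; apply: eq_bigr => b _.
rewrite mulr_sumr -sumrB; apply: eq_bigr => c _; ring.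
Qed.

End Warped.
End Coordinates.

(** * Transporting the soliton equation between charts *)

Section Transport.
Context {R : realType}.

Section Local.
Variables (m n : nat) (f0 : 'rV[R]_m -> 'rV[R]_n) (f : 'rV[R]_m -> 'rV[R]_n).
Variables (T : 'rV[R]_m -> 'rV[R]_m) (D D0 E : set 'rV[R]_m) (y : 'rV[R]_m).
Hypothesis oD : open D.
Hypothesis oD0 : open D0.
Hypothesis oE : open E.
Hypothesis fD : smooth_on D f.
Hypothesis f0D : smooth_on D0 f0.
Hypothesis TE : smooth_on E T.
Hypothesis Dy : D y.
Hypothesis D0y : D0 (T y).
Hypothesis Ey : E y.
Hypothesis fE : \forall z \near y, f z = f0 (T z).
Variable G : 'rV[R]_n -> 'M[R]_n.

Let S := 'J T y.
Let Tz a z := T z 0 a.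
Let fe e z := f z 0 e.
Let f0e e z := f0 z 0 e.

Let TC a : C1at (Tz a) y.
Proof. by apply: (smooth_on_C1at oE Ey); exact: (smooth_entry oE TE). Qed.

Let T_cont : {for y, continuous T}.
Proof. by apply: differentiable_continuous; exact: (smooth_differentiable oE TE). Qed.

Let near_good : \forall z \near y, [/\ E z, D0 (T z) & \forall x \near z, f x = f0 (T x)].
Proof.
have n1 := open_nbhs_nbhs (conj oE Ey).
have n2 : \forall z \near y, D0 (T z).
  by have c := T_cont; apply: (c D0); exact: open_nbhs_nbhs.
have n3 := near_join fE.
by apply: filterS3 n1 n2 n3 => z.
Qed.

Lemma jacobian_transport : 'J f y = S *m 'J f0 (T y).
Proof.
apply/matrixP => k e; rewrite (jacobian_smooth oD fD) // mxE.
transitivity (partial k (fun z => f0e e (T z)) y).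
  by apply: partial_near_eq; apply: filterS fE => z ->.
rewrite (@partial_chain _ _ _ (f0e e) T).
- apply: eq_bigr => a _; rewrite /S (jacobian_smooth oE TE) //.
  by rewrite (jacobian_smooth oD0 f0D).
- by apply: C1at_differentiable; apply: (smooth_on_C1at oD0 D0y); exact: (smooth_entry oD0 f0D).
- by move=> a; exact: C1at_differentiable (TC a).
Qed.

Lemma partial2_transport k l e : partial k (partial l (fe e)) y
  = \sum_a (partial k (partial l (Tz a)) y * partial a (f0e e) (T y)
      + partial l (Tz a) y * \sum_b partial k (Tz b) y * partial b (partial a (f0e e)) (T y)).
Proof.
have f0C a : C1at (partial a (f0e e)) (T y).
  apply: (smooth_on_C1at oD0 D0y); apply: smooth_on_partial; exact: (smooth_entry oD0 f0D).
have TlC a : C1at (partial l (Tz a)) y.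
  apply: (smooth_on_C1at oE Ey); apply: smooth_on_partial; exact: (smooth_entry oE TE).
have cC a : C1at (fun z => partial a (f0e e) (T z)) y.
  exact: (@C1at_chain R m m (partial a (f0e e)) T y (f0C a)).
transitivity (partial k (fun z => \sum_a partial l (Tz a) z * partial a (f0e e) (T z)) y).
  apply: partial_near_eq; apply: filterS near_good => z [Ez D0z fz].
  transitivity (partial l (fun z => f0e e (T z)) z).
    by apply: partial_near_eq; apply: filterS fz => x; rewrite /fe => ->.
  apply: partial_chain.
    by apply: C1at_differentiable; apply: (smooth_on_C1at oD0 D0z); exact: (smooth_entry oD0 f0D).
  move=> a; apply: C1at_differentiable; apply: (smooth_on_C1at oE Ez).
  exact: (smooth_entry oE TE).
rewrite partial_sum => [|a _]; last exact: C1atM.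
apply: eq_bigr => a _; rewrite (partialM k (TlC a) (cC a)); congr (_ + _ * _).
apply: partial_chain; first exact: C1at_differentiable (f0C a).
by move=> b; exact: C1at_differentiable (TC b).
Qed.

(** Under a change of source coordinates the failure to be a tensor is a combination of rows of the
    Jacobian, that is, a tangent vector; the normal projection removes it. *)
Lemma cov_transport k l : cov_derivative f G y k l
  = \sum_a \sum_b (S k a * S l b) *: cov_derivative f0 G (T y) a b
    + \sum_a partial k (partial l (Tz a)) y *: row a ('J f0 (T y)).
Proof.
apply/rowP => e; rewrite (cov_derivativeE oD fD) // [RHS]mxE partial2_transport.
have -> : (\sum_a \sum_b (S k a * S l b) *: cov_derivative f0 G (T y) a b) 0 e
  = \sum_a \sum_b (S k a * S l b * partial a (partial b (f0e e)) (T y)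
     + S k a * S l b * \sum_c \sum_d christoffel G e c d (f0 (T y)) * 'J f0 (T y) a c
         * 'J f0 (T y) b d).
  rewrite summxE; apply: eq_bigr => a _; rewrite summxE; apply: eq_bigr => b _.
  by rewrite [LHS]mxE (cov_derivativeE oD0 f0D) // mulrDr.
have -> : (\sum_a partial k (partial l (Tz a)) y *: row a ('J f0 (T y))) 0 e
  = \sum_a partial k (partial l (Tz a)) y * 'J f0 (T y) a e.
  by rewrite summxE; apply: eq_bigr => a _; rewrite [LHS]mxE [X in _ * X]mxE.
rewrite (nbhs_singleton fE) big_split /= -addrA [RHS]addrC; congr (_ + _).
  by apply: eq_bigr => a _; rewrite (jacobian_smooth oD0 f0D).
under [RHS]eq_bigr do rewrite big_split.
rewrite big_split; congr (_ + _) => /=.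
  rewrite [RHS]exchange_big; apply: eq_bigr => a _ /=; rewrite mulr_sumr.
  apply: eq_bigr => b _; rewrite /S !(jacobian_smooth oE TE) //.
  by rewrite (smooth_on_partial_comm b a oD0 D0y (smooth_entry oD0 f0D e)) -/(f0e e) mulrA [X in X * _]mulrC.
rewrite jacobian_transport.
pose q a a' b c := christoffel G e b c (f0 (T y)) * (S k a * 'J f0 (T y) a b)
    * (S l a' * 'J f0 (T y) a' c).
transitivity (\sum_b \sum_c \sum_a \sum_a' q a a' b c).
  apply: eq_bigr => b _; apply: eq_bigr => c _; rewrite !mxE -mulrA big_distrlr mulr_sumr.
  apply: eq_bigr => a _; rewrite mulr_sumr; apply: eq_bigr => a' _ /=.
  by rewrite /q mulrA.
transitivity (\sum_a \sum_a' \sum_b \sum_c q a a' b c).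
  transitivity (\sum_b \sum_a \sum_a' \sum_c q a a' b c).
    apply: eq_bigr => b _; rewrite exchange_big; apply: eq_bigr => a _ /=.
    by rewrite exchange_big.
  rewrite exchange_big; apply: eq_bigr => a _ /=; by rewrite exchange_big.
apply: eq_bigr => a _; apply: eq_bigr => a' _; rewrite mulr_sumr; apply: eq_bigr => b _.
rewrite mulr_sumr; apply: eq_bigr => c _; rewrite /q; ring.
Qed.

End Local.

Lemma invmx_mul3 (m : nat) (A B C : 'M[R]_m) :
  A \in unitmx -> B \in unitmx -> C \in unitmx ->
  invmx (A *m B *m C) = invmx C *m invmx B *m invmx A.
Proof.
move=> Au Bu Cu.
have u : A *m B *m C \in unitmx by rewrite !unitmx_mul Au Bu.
rewrite -[LHS]mulmx1 -[RHS](mulKmx u); congr (_ *m _).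
by rewrite !mulmxA mulmxK // mulmxK // mulmxV.
Qed.

(** [normal_part] with the Jacobian and the metric as arguments, for use in any chart. *)
Definition normal_proj (m n : nat) (J : 'M[R]_(m, n)) (G : 'M[R]_n) (w : 'rV[R]_n) :=
  w - w *m G *m J^T *m invmx (J *m G *m J^T) *m J.

Section NormalProj.
Variables (m n : nat) (J : 'M[R]_(m, n)) (G : 'M[R]_n).
Implicit Types w : 'rV[R]_n.

Lemma normal_proj_is_linear : linear (normal_proj J G).
Proof.
move=> a u v; rewrite /normal_proj !mulmxDl -!scalemxAl scalerBr.
by rewrite opprD addrACA.
Qed.

HB.instance Definition _ :=
  GRing.isLinear.Build R 'rV[R]_n 'rV[R]_n _ (normal_proj J G) normal_proj_is_linear.

Lemma normal_proj_tangent k : J *m G *m J^T \in unitmx -> normal_proj J G (row k J) = 0.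
Proof.
by move=> Au; rewrite /normal_proj -!row_mul mulmxV // mul1mx subrr.
Qed.

(** [S *m J] and [J] have the same row space, hence define the same tangent space. *)
Lemma normal_proj_change (S : 'M[R]_m) w : S \in unitmx -> J *m G *m J^T \in unitmx ->
  normal_proj (S *m J) G w = normal_proj J G w.
Proof.
move=> Su Au; rewrite /normal_proj trmx_mul; congr (_ - _).
have Stu : S^T \in unitmx by rewrite unitmx_tr.
set A := J *m G *m J^T.
have -> : S *m J *m G *m (J^T *m S^T) = S *m A *m S^T by rewrite /A !mulmxA.
rewrite (invmx_mul3 Su Au Stu).
rewrite !mulmxA; congr (_ *m _).
by rewrite mulmxK // mulmxKV.
Qed.

End NormalProj.
End Transport.

Lemma sum_swap22 (V : nmodType) (J : finType) (F : J -> J -> J -> J -> V) :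
  \sum_k \sum_l \sum_a \sum_b F k l a b = \sum_a \sum_b \sum_k \sum_l F k l a b.
Proof.
transitivity (\sum_k \sum_a \sum_b \sum_l F k l a b).
  apply: eq_bigr => k _; rewrite exchange_big; apply: eq_bigr => a _ /=.
  exact: exchange_big.
rewrite exchange_big; apply: eq_bigr => a _; exact: exchange_big.
Qed.

Section Soliton.
Context {R : realType}.
Variables (m n : nat) (I : set R) (h : R -> R) (P : manifold_data R n) (M : manifold_data R m).
Let N := warped_product I h P.
Variables (psi : M -> N) (c : R).
Hypothesis oI : open I.
Hypothesis h0 : forall t, I t -> 0 < h t.
Hypothesis hI : smooth_real_on I h.
Hypothesis rP : riemannian_manifold P.
Hypothesis rM : riemannian_manifold M.
Hypothesis psiI : forall x : M, I (psi x).1.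
Hypothesis sol : mcf_soliton psi (@warped_field R n I h P) c.

Let sM := riemannian_manifold_smooth rM.
Let sP := riemannian_manifold_smooth rP.
Let iso : isometric_immersion psi := sol.1.
Let psi_cont : continuous psi := iso.1.1.

Definition pair_dom (i : index M) (j : index N) : set 'rV[R]_m :=
  coord i @` (dom i `&` psi @^-1` dom j).

Lemma pair_domE i j : pair_dom i j = chart_image i `&` param i @^-1` (psi @^-1` dom j).
Proof.
apply/seteqP; split => [y [x [ix jx] <-]|y [iy jy]].
  by split; [exact: chart_imageP|rewrite /= (manifold_coordK sM)].
by exists (param i y); [split => //; exact: dom_param|exact: paramK].
Qed.

Lemma open_warped_dom (j : index N) : open (dom j : set N).
Proof.
rewrite openE => -[t p] [It jp]; exists (I, @dom R n P j) => //=; split.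
  exact: open_nbhs_nbhs.
by apply: open_nbhs_nbhs; split => //; exact: manifold_dom_open.
Qed.

Lemma open_pair_dom i j : open (pair_dom i j).
Proof.
rewrite pair_domE; apply: open_param_preimage => //.
by apply: open_comp; [move=> x _; exact: psi_cont|exact: open_warped_dom].
Qed.

Lemma pair_dom_mem i j x : dom i x -> dom j (psi x) -> pair_dom i j (coord i x).
Proof. by move=> ix jx; exists x. Qed.

Lemma dom_chart_at_psi x : dom (chart_at (psi x)) (psi x).
Proof. by split; [exact: psiI|exact: (manifold_cover sP)]. Qed.

Lemma smooth_local_rep i j : smooth_on (pair_dom i j) (local_rep psi i j).
Proof. exact: iso.1.2. Qed.

Lemma local_repE i j y : local_rep psi i j y
  = row_mx (psi (param i y)).1%:M (coord (j : index P) (psi (param i y)).2).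
Proof. by []. Qed.

Lemma local_rep0 i j y : local_rep psi i j y 0 0 = (psi (param i y)).1.
Proof. by rewrite local_repE -(lsubmx00 (row_mx _ _)) row_mxKl mxE. Qed.

Let W (j : index N) := warped_metric h (metric (j : index P)).

Lemma local_rep_warped_domain i j y : pair_dom i j y ->
  warped_domain I (chart_image (j : index P)) (local_rep psi i j y).
Proof.
rewrite pair_domE => -[iy [Iy jy]]; split; first by rewrite local_rep0.
by rewrite local_repE row_mxKr; exact: chart_imageP.
Qed.

Lemma isometric_chart i j y : pair_dom i j y ->
  metric i y = 'J (local_rep psi i j) y *m W j (local_rep psi i j y)
                 *m ('J (local_rep psi i j) y)^T.
Proof.
rewrite pair_domE => -[iy jy].
have [_] := iso.2 i j (param i y) (dom_param sM iy) jy.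
by rewrite (paramK sM iy) => ->.
Qed.

Lemma metric_unitmx (i : index M) y : chart_image i y -> metric i y \in unitmx.
Proof.
move=> iy; apply: posdef_unitmx; first exact: (metric_sym rM).
by move=> u; exact: (metric_posdef rM).
Qed.

(** Only the source chart is changed, by the transition [T] to [chart_at x]; the target chart
    remains the one chosen at [psi x]. The factors [S] in the covariant derivatives are absorbed by
    the inverse metric. *)
Lemma chart_soliton i x : dom i x ->
  let j := chart_at (psi x) in let y := coord i x in
  let f := local_rep psi i j in let J := 'J f y in let G := W j (f y) in
  c *: normal_proj J G (row_mx (h (psi x).1)%:M 0)
  = \sum_k \sum_l invmx (metric i y) k l *: normal_proj J G (cov_derivative f (W j) y k l).
Proof.
move=> ix j y f J G.
pose i0 := chart_at x; pose y0 := coord i0 x; pose f0 := local_rep psi i0 j.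
have i0x : dom i0 x := manifold_cover sM x.
have jx := dom_chart_at_psi x.
pose T := transition i i0.
have Ty : T y = y0 by rewrite /T /transition /y (manifold_coordK sM).
have oE : open (overlap i i0).
  have -> : overlap i i0 = chart_image i `&` param i @^-1` dom i0.
    apply/seteqP; split => [z [u [iu i0u] <-]|z [iz i0z]].
      by split; [exact: chart_imageP|rewrite /= (manifold_coordK sM)].
    by exists (param i z); [split => //; exact: dom_param|exact: paramK].
  by apply: open_param_preimage => //; exact: manifold_dom_open.
have Ey : overlap i i0 y by exists x.
have Dy : pair_dom i j y by exact: pair_dom_mem.
have D0y : pair_dom i0 j (T y) by rewrite Ty; exact: pair_dom_mem.
have fE : \forall z \near y, f z = f0 (T z).
  apply: filterS (open_nbhs_nbhs (conj oE Ey)) => z [u [iu i0u] <-].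
  by rewrite /f /f0 /T /local_rep /transition !(manifold_coordK sM).
have TE := @manifold_transition _ _ _ sM i i0.
have JT := jacobian_transport (@open_pair_dom i j) (@open_pair_dom i0 j) oE
  (@smooth_local_rep i j) (@smooth_local_rep i0 j) TE Dy D0y Ey fE.
have KT := cov_transport (@open_pair_dom i j) (@open_pair_dom i0 j) oE
  (@smooth_local_rep i j) (@smooth_local_rep i0 j) TE Dy D0y Ey fE (W j).
set S := 'J T y in JT KT; set J0 := 'J f0 (T y) in JT KT.
have fy : f y = coord j (psi x) by rewrite /f /local_rep /y (manifold_coordK sM).
have f0y : f0 (T y) = coord j (psi x).
  by rewrite -(nbhs_singleton fE).
have A0E : metric i0 y0 = J0 *m G *m J0^T.
  by rewrite -Ty (isometric_chart D0y) /G fy -f0y.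
have AE : metric i y = S *m metric i0 y0 *m S^T.
  by rewrite (metric_change rM Ey) -/T Ty.
have A0u : metric i0 y0 \in unitmx by apply: metric_unitmx; exact: chart_imageP.
have Su : S \in unitmx.
  have : metric i y \in unitmx by apply: metric_unitmx; exact: chart_imageP.
  by rewrite AE unitmx_mul => /andP[]; rewrite unitmx_mul => /andP[].
have Stu : S^T \in unitmx by rewrite unitmx_tr.
have NJ w : normal_proj J G w = normal_proj J0 G w.
  by rewrite /J JT normal_proj_change // -A0E.
have NP w : normal_part psi x w = normal_proj J0 G w.
  rewrite /normal_proj /normal_part /differential_at /metric_at.
  by rewrite -/i0 -/y0 -/j /J0 Ty /G fy.
have solx := sol.2 x; rewrite NP in solx.
rewrite NJ solx /mean_curvature /second_fundamental_form.
have KE k l : covariant_derivative psi x k l = cov_derivative f0 (W j) (T y) k l.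
  by rewrite /cov_derivative /covariant_derivative f0y Ty.
have BE : invmx (metric i0 y0) = S^T *m invmx (metric i y) *m S.
  rewrite AE invmx_mul3 // !mulmxA mulmxV // mul1mx -mulmxA mulVmx // mulmx1.
  by [].
under [RHS]eq_bigr do under eq_bigr do rewrite NJ KT.
(* The second derivatives of [T] multiply tangent vectors and disappear. *)
have NK k l : normal_proj J0 G (\sum_a \sum_b (S k a * S l b) *: cov_derivative f0 (W j) (T y) a b
    + \sum_a partial k (partial l (fun z => T z 0 a)) y *: row a J0)
   = \sum_a \sum_b (S k a * S l b) *: normal_proj J0 G (cov_derivative f0 (W j) (T y) a b).
  rewrite linearD /= [X in _ + X]linear_sum [X in _ + X]big1 ?addr0; last first.
    by move=> a _; rewrite linearZ /= normal_proj_tangent ?scaler0 // -A0E.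
  rewrite linear_sum; apply: eq_bigr => a _; rewrite linear_sum; apply: eq_bigr => b _.
  by rewrite linearZ.
under [RHS]eq_bigr do under eq_bigr do rewrite NK scaler_sumr.
pose V a b := normal_proj J0 G (cov_derivative f0 (W j) (T y) a b).
transitivity (\sum_a \sum_b \sum_k \sum_l (invmx (metric i y) k l * (S k a * S l b)) *: V a b).
  apply: eq_bigr => a _; apply: eq_bigr => b _.
  rewrite NP KE -/(V a b) BE mxE.
  transitivity ((\sum_l \sum_k invmx (metric i y) k l * (S k a * S l b)) *: V a b).
    congr (_ *: _); apply: eq_bigr => l _; rewrite mxE mulr_suml; apply: eq_bigr => k _.
    by rewrite mxE; ring.
  rewrite exchange_big scaler_suml; apply: eq_bigr => k _ /=.
  by rewrite scaler_suml.
apply/esym.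
transitivity (\sum_k \sum_l \sum_a \sum_b (invmx (metric i y) k l * (S k a * S l b)) *: V a b).
  apply: eq_bigr => k _; apply: eq_bigr => l _; apply: eq_bigr => a _.
  by rewrite scaler_sumr; apply: eq_bigr => b _; rewrite scalerA.
exact: (sum_swap22 (fun k l a b => (invmx (metric i y) k l * (S k a * S l b)) *: V a b)).
Qed.

End Soliton.

(** * The Laplacian of eta in a chart *)

Section Laplace.
Context {R : realType}.
Variables (m n : nat) (I : set R) (h : R -> R) (P : manifold_data R n) (M : manifold_data R m).
Let N := warped_product I h P.
Variables (psi : M -> N) (c : R) (eh : R -> R).
Hypothesis oI : open I.
Hypothesis h0 : forall t, I t -> 0 < h t.
Hypothesis hI : smooth_real_on I h.
Hypothesis rP : riemannian_manifold P.
Hypothesis rM : riemannian_manifold M.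
Hypothesis psiI : forall x : M, I (psi x).1.
Hypothesis sol : mcf_soliton psi (@warped_field R n I h P) c.
Hypothesis ehd : forall t, I t -> is_derive t 1 eh (h t).

Let sM := riemannian_manifold_smooth rM.
Let sP := riemannian_manifold_smooth rP.

Definition time_chart (i : index M) (z : 'rV[R]_m) : R := (psi (param i z)).1.
Definition eta_chart (i : index M) (z : 'rV[R]_m) : R := eh (time_chart i z).

Let near_I t : I t -> \forall u \near t, I u.
Proof. by move=> It; apply: open_nbhs_nbhs. Qed.

Let h_C1R t : I t -> C1R h t.
Proof. by move=> It; exact: (@smooth_real_C1R R I h t 0%N oI It hI). Qed.

Let h_derivable t : I t -> derivable h t 1.
Proof. exact: (@hI 0%N t). Qed.

Lemma eh_C1R t : I t -> C1R eh t.
Proof.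
move=> It; apply: filterS (near_I It) => u Iu; split; first by have [] := ehd Iu.
apply: (@continuous_near_eq _ _ h).
  by apply: filterS (near_I Iu) => v Iv; rewrite derive1E; have [_ ->] := ehd Iv.
by apply: differentiable_continuous; apply/derivable1_diffP; exact: h_derivable.
Qed.

Section Chart.
Variable i : index M.
Implicit Types y z : 'rV[R]_m.

Lemma pair_dom_chart y : chart_image i y -> pair_dom psi i (chart_at (psi (param i y))) y.
Proof.
move=> iy; rewrite -{2}(paramK sM iy); apply: pair_dom_mem; first exact: dom_param.
exact: dom_chart_at_psi.
Qed.

Lemma time_smooth y : chart_image i y ->
  exists D, [/\ open D, D y & smooth_on D (time_chart i)].
Proof.
move=> iy; exists (pair_dom psi i (chart_at (psi (param i y)))).
have oD := open_pair_dom oI rP rM sol (i:=i) (j:=chart_at (psi (param i y))).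
split => //; first exact: pair_dom_chart.
have -> : time_chart i = fun z => local_rep psi i (chart_at (psi (param i y))) z 0 0.
  by apply/funext => z; rewrite local_rep0.
by apply: smooth_on_entry => //; exact: (smooth_local_rep sol).
Qed.

Lemma time_C1at y : chart_image i y -> C1at (time_chart i) y.
Proof. by move=> /time_smooth [D [oD Dy sD]]; exact: smooth_on_C1at oD Dy sD. Qed.

Lemma partial_time_C1at y q : chart_image i y -> C1at (partial q (time_chart i)) y.
Proof.
move=> /time_smooth [D [oD Dy sD]]; apply: (smooth_on_C1at oD Dy).
exact: smooth_on_partial.
Qed.

Lemma eta_C1at y : chart_image i y -> C1at (eta_chart i) y.
Proof.
move=> iy; apply: (@C1at_comp1 _ _ eh (time_chart i)); first exact: time_C1at.
by apply: eh_C1R; exact: psiI.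
Qed.

Lemma partial_eta y q : chart_image i y ->
  partial q (eta_chart i) y = h (time_chart i y) * partial q (time_chart i) y.
Proof.
move=> iy; have [dt <-] := ehd (psiI (param i y)).
rewrite (@partial_comp1 _ _ eh (time_chart i)) //; first by rewrite derive1E.
exact: C1at_differentiable (time_C1at iy).
Qed.

Lemma h_time_C1at y : chart_image i y -> C1at (fun z => h (time_chart i z)) y.
Proof.
move=> iy; apply: (@C1at_comp1 _ _ h (time_chart i)); first exact: time_C1at.
by apply: h_C1R; exact: psiI.
Qed.

Lemma partial_eta_near y q : chart_image i y -> \forall z \near y,
  h (time_chart i z) * partial q (time_chart i) z = partial q (eta_chart i) z.
Proof.
move=> iy; apply: filterS (near_chart_image sM iy) => z iz.
by rewrite partial_eta.
Qed.

(** [eh] is known only as a primitive of [h]; the next order of regularity comes from the formula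
    for [partial q (eta_chart i)], which holds on a neighbourhood. *)
Lemma partial_eta_C1at y q : chart_image i y -> C1at (partial q (eta_chart i)) y.
Proof.
move=> iy; apply: C1at_near_eq (partial_eta_near q iy) _.
by apply: C1atM; [exact: h_time_C1at|exact: partial_time_C1at].
Qed.

Lemma partial2_eta y p q : chart_image i y ->
  partial p (partial q (eta_chart i)) y
  = h (time_chart i y) * partial p (partial q (time_chart i)) y
    + derive1 h (time_chart i y) * partial p (time_chart i) y * partial q (time_chart i) y.
Proof.
move=> iy; rewrite -(partial_near_eq p (partial_eta_near q iy)).
rewrite (partialM p (h_time_C1at iy) (partial_time_C1at q iy)).
rewrite (@partial_comp1 _ _ h (time_chart i)); first exact: addrC.
  exact: C1at_differentiable (time_C1at iy).
by apply: h_derivable; exact: psiI.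
Qed.

Lemma metric_C1at y a b : chart_image i y -> C1at (fun z => metric i z a b) y.
Proof.
move=> iy; have oi := @manifold_image_open _ _ _ sM i.
apply: (smooth_on_C1at oi iy); apply: smooth_on_entry => //.
exact: (metric_smooth rM).
Qed.

(** The left side is the Laplacian of [eta] in the chart [i]. The proof checks the hypotheses of
    [soliton_algebra], with the target chart chosen at the image of the point. *)
Lemma chart_laplacian y : chart_image i y ->
  let t := time_chart i y in let B := invmx (metric i y) in
  let dG p : 'M[R]_m := \matrix_(a, b) partial p (fun z => metric i z a b) y in
  \sum_p \sum_q (B p q * partial p (partial q (eta_chart i)) y
     - (B *m dG p *m B) p q * partial q (eta_chart i) y
     + 2^-1 * \tr (B *m dG p) * B p q * partial q (eta_chart i) y)
  = m%:R * derive1 h t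
    + c * (h t ^+ 2 - \sum_p \sum_q B p q * partial p (eta_chart i) y * partial q (eta_chart i) y).
Proof.
move=> iy t B dG.
pose x := param i y; pose j := chart_at (psi x).
have ix : dom i x by exact: dom_param.
have Dy : pair_dom psi i j y by exact: pair_dom_chart.
have xy : coord i x = y by rewrite /x (paramK sM).
pose f := local_rep psi i j; pose W := warped_metric h (metric (j : index P)).
have oD := open_pair_dom oI rP rM sol (i:=i) (j:=j).
have fD : smooth_on (pair_dom psi i j) f := smooth_local_rep sol (i:=i) (j:=j).
have wy : warped_domain I (chart_image (j : index P)) (f y) := local_rep_warped_domain rM Dy.
have oP := @manifold_image_open _ _ _ sP j.
have Gt : forall z : 'rV[R]_n, chart_image (j : index P) z -> (metric (j : index P) z)^T = metric (j : index P) z.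
  by move=> z; exact: (metric_sym rP).
have Gpos : forall z u : 'rV[R]_n, chart_image (j : index P) z -> u != 0 ->
    0 < inner (metric (j : index P) z) u u.
  by move=> z u jz u0; exact: (metric_posdef rP).
have GE := metric_smooth rP (i:=j).
have Wt := warped_sym h Gt.
have Wu := warped_unitmx h0 Gt Gpos wy.
have WC a b := C1at_warped oI hI oP GE a b wy.
have Wtn : \forall z \near f y, (W z)^T = W z.
  by apply: filterS (near_warped_domain oI oP wy) => z; exact: Wt.
pose J := 'J f y.
have AE : metric i y = J *m W (f y) *m J^T := isometric_chart rM sol Dy.
pose K := cov_derivative f W y.
have t0 : f y 0 0 = t by rewrite /f local_rep0.
have tE : time_chart i = fun z => f z 0 0 by apply/funext => z; rewrite /f local_rep0.
pose X : 'rV[R]_(1 + n) := row_mx (h t)%:M 0.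
have Xin (u : 'rV[R]_(1 + n)) : (u *m W (f y) *m X^T) 0 0 = u 0 0 * h t.
  by rewrite /X -t0; exact: warped_field_inner.
(* [X] is the ambient gradient of [eh], so its products with the coordinate fields are the partial
   derivatives of [eta]. *)
have e_eq q : (J *m W (f y) *m X^T) q 0 = partial q (eta_chart i) y.
  have := Xin (row q J); rewrite -!row_mul mxE => ->.
  by rewrite mxE /J (jacobian_smooth oD fD) // partial_eta // -tE mulrC.
have := @soliton_algebra R m (1 + n) (metric i y) B dG J (W (f y)) K X
  (\matrix_(p, q) partial p (partial q (eta_chart i)) y) c (derive1 h t) (h t ^+ 2).
have BE : B = invmx (J *m W (f y) *m J^T) by rewrite /B AE.
have mt : (metric i y)^T = metric i y by exact: (metric_sym rM).
move=> /(_ _ _ mt).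
have -> : B^T = B by rewrite /B trmx_inv mt.
move=> /(_ erefl (mulVmx (metric_unitmx rM iy))) H.
have dAE p k l : dG p k l = (K p k *m W (f y) *m J^T) 0 l + (K p l *m W (f y) *m J^T) 0 k.
  rewrite [LHS]mxE -(metric_compat oD fD Dy WC Wtn Wu).
  apply: partial_near_eq; apply: filterS (open_nbhs_nbhs (conj oD Dy)) => z Dz.
  by rewrite (isometric_chart rM sol Dz).
have Ks k l : K k l = K l k := cov_derivative_sym oD fD Dy Wtn k l.
have sol_eq : c *: normal_proj J (W (f y)) X
   = \sum_k \sum_l B k l *: normal_proj J (W (f y)) (K k l).
  by have := chart_soliton oI rP rM psiI sol ix; rewrite xy.
have KX k l : (K k l *m W (f y) *m X^T) 0 0
    = (\matrix_(p, q) partial p (partial q (eta_chart i)) y) k l - derive1 h t * metric i y k l.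
  rewrite [X in _ = X - _]mxE partial2_eta // AE -/t tE /X -t0.
  exact: (warped_cov_derivative oI h0 hI oP GE Gt Gpos k l oD fD Dy wy).
have XX : (X *m W (f y) *m X^T) 0 0 = h t ^+ 2.
  by rewrite Xin /X -t0 warped_fieldE eqxx mul1r expr2.
rewrite /normal_proj -BE in sol_eq.
have {}H := H dAE Ks sol_eq KX XX (warped_sym h Gt wy).
transitivity (m%:R * derive1 h t
    + c * (h t ^+ 2 - \sum_p \sum_q B p q * (J *m W (f y) *m X^T) p 0 * (J *m W (f y) *m X^T) q 0)).
  rewrite -H; apply: eq_bigr => p _; apply: eq_bigr => q _.
  by rewrite e_eq [X in _ = _ * X - _ + _]mxE.
congr (_ + c * (_ - _)); apply: eq_bigr => p _; apply: eq_bigr => q _.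
by rewrite !e_eq.
Qed.

End Chart.
End Laplace.

(** * Compactly supported functions *)

Section Cutoff.
Context {R : realType}.

(** The square makes the positive part [C^1], the regularity that the divergence argument asks for.
    It is the building block of the chart cutoffs and of [phi]. *)
Definition psq (u : R) : R := Num.max 0 u ^+ 2.

Lemma psq_ge0 u : 0 <= psq u.
Proof. exact: sqr_ge0. Qed.

Lemma psq_le0 u : u <= 0 -> psq u = 0.
Proof. by move=> u0; rewrite /psq max_l // expr0n. Qed.

Lemma psq_gt0E u : 0 <= u -> psq u = u ^+ 2.
Proof. by move=> u0; rewrite /psq max_r. Qed.

Lemma is_derive_psq (u : R) : is_derive u 1 psq (2 * Num.max 0 u).
Proof.
have [u0|[u0|->]] : 0 < u \/ u < 0 \/ u = 0.
  by case: (ltgtP 0 u) => H; [left|right; left|right; right].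
- rewrite max_r; last exact: ltW.
  apply: (@near_eq_is_derive _ _ _ (fun v : R => v * v)).
    by apply: filterS (near_gt u0) => v v0; rewrite psq_gt0E ?expr2 // ltW.
  have H := @is_deriveM _ _ (id : R -> R) id u 1 1 1 (is_derive_id _ _) (is_derive_id _ _).
  by apply: (is_derive_eq H); rewrite /GRing.scale /=; ring.
- rewrite max_l ?ltW // mulr0.
  apply: (@near_eq_is_derive _ _ _ (fun=> 0 : R)).
  have : \forall v \near u, v < 0.
    by apply: (@open_nbhs_nbhs _ u [set w | w < 0]); split => //; exact: open_lt.
  by apply: filterS => v v0; rewrite psq_le0 // ltW.
- rewrite maxxx mulr0.
  suff H : (fun t : R => t^-1 *: ((psq \o shift 0) (t *: 1) - psq 0)) @ 0^' --> (0 : R).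
    by apply: DeriveDef; [apply/cvg_ex; exists 0|exact: cvg_lim H].
  apply/cvgrPdist_le => e e0.
  have n1 : \forall t \near (0 : R)^', `|t| <= e by exact: dnbhs0_le.
  apply: filterS n1 => t te.
  rewrite sub0r normrN /= addr0 [psq 0]psq_le0 // subr0 [t *: 1]mulr1.
  rewrite /GRing.scale /= normrM normfV.
  have [t0|t0] := leP t 0; first by rewrite psq_le0 // normr0 mulr0 ltW.
  have t0' : `|t| != 0 by rewrite normr_eq0 gt_eqF.
  by rewrite (psq_gt0E (ltW t0)) normrX expr2 mulrA mulVf // mul1r.
Qed.

Lemma C1R_psq (u : R) : C1R psq u.
Proof.
apply: near_always => v; split; first by have [] := is_derive_psq v.
apply: (@continuous_near_eq _ _ (fun u : R => 2 * Num.max 0 u)).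
  by apply: near_always => w; rewrite derive1E; have [_ ->] := is_derive_psq w.
apply: (@continuous_mul _ _ (fun=> 2)); first exact: continuous_cst.
by apply: continuous_max; [exact: cvg_cst|exact: cvg_id].
Qed.

Section OnManifold.
Variables (m : nat) (M : manifold_data R m).
Hypothesis sM : smooth_manifold M.
Implicit Types (i : index M) (x : M) (y : 'rV[R]_m) (w : M -> R).

Definition in_chart i w : 'rV[R]_m -> R := fun y => w (param i y).

Definition C1M w : Prop := forall i y, chart_image i y -> C1at (in_chart i w) y.

Lemma C1M_mul v w : C1M v -> C1M w -> C1M (fun x => v x * w x).
Proof. by move=> vC wC i y iy; apply: C1atM; [exact: vC|exact: wC]. Qed.

Lemma C1M_comp (g : R -> R) w : (forall u, C1R g u) -> C1M w -> C1M (fun x => g (w x)).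
Proof. by move=> gC wC i y iy; apply: C1at_comp1; [exact: wC|exact: gC]. Qed.

Lemma overlapE i j : overlap i j = chart_image i `&` param i @^-1` dom j.
Proof.
apply/seteqP; split => [z [u [iu ju] <-]|z [iz jz]].
  by split; [exact: chart_imageP|rewrite /= (manifold_coordK sM)].
by exists (param i z); [split => //; exact: dom_param|exact: paramK].
Qed.

Lemma open_overlap i j : open (overlap i j).
Proof. by rewrite overlapE; apply: open_param_preimage => //; exact: manifold_dom_open. Qed.

Lemma transition_C1at i j y a : overlap i j y -> C1at (fun z => transition i j z 0 a) y.
Proof.
move=> ijy; apply: (smooth_on_C1at (open_overlap (i:=i) (j:=j)) ijy).
by apply: smooth_on_entry; [exact: open_overlap|exact: manifold_transition].
Qed.

(** The set is the image of a compact ball, hence closed because [M] is Hausdorff. This is what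
    allows a function built in one chart to be extended by a constant to all of [M]. *)
Lemma closedball_image_closed i y0 (r : R) :
  (forall y, `|y - y0| <= r -> chart_image i y) ->
  closed [set x | dom i x /\ `|coord i x - y0| <= r].
Proof.
move=> ri; apply: compact_closed; first exact: (manifold_hausdorff sM).
have -> : [set x | dom i x /\ `|coord i x - y0| <= r]
    = param i @` [set y | `|y - y0| <= r].
  apply/seteqP; split => [x [ix xr]|x [y yr <-]].
    by exists (coord i x) => //; exact: manifold_coordK.
  have iy := ri _ yr; split; first exact: dom_param.
  by rewrite (paramK sM iy).
apply: continuous_compact.
  apply: continuous_in_subspaceT => y; rewrite inE => yr.
  by apply: param_continuous_at => //; exact: ri.
apply: bounded_closed_compact.
  exists (`|y0| + r); split; first exact: num_real.
  move=> t yt y /= yr; rewrite -(subrK y0 y) (le_trans (ler_normD _ _)) // addrC.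
  by rewrite (le_trans _ (ltW yt)) // lerD2l.
rewrite (_ : [set y | _] = (fun y => `|y - y0|) @^-1` [set t | t <= r]) //.
apply: closed_comp; last exact: closed_le.
move=> y _; apply: (@continuous_comp _ _ _ (fun y => y - y0) (fun v => `|v|)).
  by apply: (@cvgB _ _ _ (nbhs y) _ id (fun=> y0)); [exact: cvg_id|exact: cvg_cst].
exact: norm_continuous.
Qed.

(* [zeta] vanishes near [x0], and [1 - zeta] is supported in a ball of radius
   [r] of a chart in which the concentric cube of half side [2 * r] fits. *)
Definition chart_cutoff i y0 (r : R) (zeta : M -> R) : Prop :=
  [/\ 0 < r, cbox (\row_k (y0 0 k - 2 * r)) (4 * r) `<=` chart_image i,
    C1M zeta &
    forall x, ~ (dom i x /\ `|coord i x - y0| <= r) -> zeta x = 1].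

Lemma cutoff_exists x0 : exists i y0 r zeta, chart_cutoff i y0 r zeta /\
  \forall x \near x0, zeta x = 0.
Proof.
pose i := chart_at x0; pose y0 := coord i x0.
have ix0 : dom i x0 := manifold_cover sM x0.
have iy0 : chart_image i y0 by exact: chart_imageP.
have [d /= d0 dP] := (nbhs_ballP _ _).1 (near_chart_image sM iy0).
(* The cube of half side [2 * r = d / 2] then stays inside the ball of radius [d]. *)
pose r := d / 4.
have r0 : 0 < r by rewrite divr_gt0.
have rP y : `|y - y0| < d -> chart_image i y.
  by move=> yd; apply: dP; rewrite -ball_normE /= distrC.
(* A bump at [y0] of height [r ^+ 4]. With [C = 2 / r ^+ 4] the product [C * beta] equals 2 at [y0],
   so [zt] vanishes near [y0]; where [beta] is 0, in particular outside the cube of half side [r],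
   [zt] is 1. *)
pose beta y : R := psq (r ^+ 2 - \sum_k (y 0 k - y0 0 k) ^+ 2).
pose C := 2 / r ^+ 4.
pose zt y := psq (1 - C * beta y).
pose zeta x := if pselect (dom i x) then zt (coord i x) else 1.
have C0 : 0 < C by rewrite divr_gt0 // exprn_gt0.
have betaC y : C1at beta y.
  apply: (@C1at_comp1 _ _ psq); last exact: C1R_psq.
  apply: (@C1at_near_eq _ _ (fun z : 'rV[R]_m =>
      r ^+ 2 + (- 1) * \sum_k ((z 0 k + - y0 0 k) * (z 0 k + - y0 0 k)))).
    apply: near_always => z; rewrite mulN1r.
    by congr (_ - _); apply: eq_bigr => k _; rewrite expr2.
  apply: C1atD; first exact: C1at_cst.
  apply: C1atM; first exact: C1at_cst.
  apply: C1at_sum => k _.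
  have ck := C1atD (C1at_coord k y) (C1at_cst (- y0 0 k) y).
  exact: (C1atM ck ck).
have ztC y : C1at zt y.
  apply: (@C1at_comp1 _ _ psq); last exact: C1R_psq.
  apply: (@C1at_near_eq _ _ (fun z => 1 + (- C) * beta z)).
    by apply: near_always => z; rewrite mulNr.
  apply: C1atD; first exact: C1at_cst.
  by apply: C1atM; first exact: C1at_cst.
have zt1 y : ~ (`|y - y0| <= r) -> zt y = 1.
  move=> yr; suff b0 : beta y = 0 by rewrite /zt b0 mulr0 subr0 psq_gt0E // expr1n.
  apply: psq_le0.
  have [k yk] : exists k, r < `|y 0 k - y0 0 k|.
    apply: contrapT => /forallNP H; apply: yr; apply: rV_norm_le => [|k].
      exact: ltW.
    by rewrite !mxE leNgt; apply/negP; exact: H.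
  rewrite subr_le0 (bigD1 k) //= -[X in X <= _]addr0 lerD //; last first.
    by apply: sumr_ge0 => j _; exact: sqr_ge0.
  rewrite -[X in _ <= X](real_normK (num_real _)) lerXn2r // ?nnegrE.
  - exact: ltW.
  - exact: ltW.
have zeta1 x : ~ (dom i x /\ `|coord i x - y0| <= r) -> zeta x = 1.
  move=> H; rewrite /zeta; case: pselect => // ix; apply: zt1 => xr; exact: H.
exists i, y0, r, zeta; split; last first.
  have b0 : \forall y \near y0, 1 < C * beta y.
    have cb : {for y0, continuous (fun y => C * beta y)}.
      apply: (@continuous_mul _ _ (fun=> C)); first exact: continuous_cst.
      exact: C1at_continuous.
    have v0 : 1 < C * beta y0.
      rewrite /beta big1 ?subr0; last by move=> k _; rewrite subrr expr0n.
      rewrite psq_gt0E ?exprn_ge0 ?ltW // -exprM /C divfK ?ltr1n //.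
      by rewrite gt_eqF // exprn_gt0.
    exact: (cb [set t | 1 < t] (near_gt v0)).
  have n1 := coord_continuous_at sM ix0 b0.
  apply: filterS2 (near_dom sM ix0) n1 => x ix /= xb.
  rewrite /zeta; case: pselect => [?|//]; rewrite /zt psq_le0 // subr_le0; exact: ltW.
split => //.
- move=> y yb; apply: rP; apply: (@le_lt_trans _ _ (2 * r)); last by rewrite /r; lra.
  apply: rV_norm_le => [|k]; first by rewrite mulr_ge0 // ltW.
  have := yb k; rewrite !mxE ler_norml; lra.
- move=> j y jy.
  (* In another chart, [zeta] is [zt] after the transition map or, off [dom i], constant near the
     point, the coordinate ball being closed in [M]. *)
  have [ix|nix] := pselect (dom i (param j y)).
    have oy : overlap j i y by rewrite overlapE.
    apply: (@C1at_near_eq _ _ (fun z => zt (transition j i z))).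
      apply: filterS (open_nbhs_nbhs (conj (open_overlap (i:=j) (j:=i)) oy)) => z.
      rewrite overlapE => -[_ iz]; rewrite /in_chart /zeta; case: pselect => //.
    apply: (@C1at_chain _ _ _ zt); first exact: ztC.
    by move=> a; exact: transition_C1at.
  have cl : closed [set x | dom i x /\ `|coord i x - y0| <= r].
    by apply: closedball_image_closed => y' yr; apply: rP; rewrite (le_lt_trans yr) // /r; lra.
  apply: (@C1at_near_eq _ _ (fun=> 1)); last exact: C1at_cst.
  have nx : \forall x \near param j y, ~ (dom i x /\ `|coord i x - y0| <= r).
    apply: (@open_nbhs_nbhs _ _ (~` [set x | dom i x /\ `|coord i x - y0| <= r])).
    by split; [exact: closed_openC|move=> -[]].
  have nz : \forall z \near y, ~ (dom i (param j z) /\ `|coord i (param j z) - y0| <= r).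
    exact: (param_continuous_at sM jy nx).
  by apply: filterS nz => z /zeta1; rewrite /in_chart => ->.
Qed.

End OnManifold.
End Cutoff.

(** * The divergence theorem for compactly supported functions *)

Section GradInner.
Context {R : realType} {m : nat} {M : manifold_data R m}.
Hypothesis rM : riemannian_manifold M.
Let sM := riemannian_manifold_smooth rM.
Implicit Types (i : index M) (x : M) (v w : M -> R).

Lemma borel_measurable (U : set M) (f : M -> R) : open U ->
  (forall x, U x -> {for x, continuous f}) ->
  @measurable_fun _ _ (borelType M) R U f.
Proof.
move=> oU fc mU; apply: (measurability _ (RGenOInfty.measurableE R)) => //.
move=> /= _ [_ [a ->] <-]; apply: borel_open; rewrite openE => x [Ux fx].
have n1 : nbhs x U by exact: open_nbhs_nbhs.
have fx' : a < f x by move: fx; rewrite /= in_itv /= andbT.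
have n2 : \forall z \near x, a < f z by exact: (fc x Ux _ (near_gt fx')).
apply: filterS2 n1 n2 => z Uz az; split => //.
by rewrite /= in_itv /= az.
Qed.

Definition grad_chart i (f g : 'rV[R]_m -> R) (y : 'rV[R]_m) : R :=
  \sum_p \sum_q invmx (metric i y) p q * partial p f y * partial q g y.

Definition grad_inner v w x : R :=
  let i := chart_at x in grad_chart i (in_chart i v) (in_chart i w) (coord i x).

(** Independence of the chart: the Jacobians [S] of the two differentials cancel against those of
    the inverse metric. *)
Lemma grad_inner_chart i x v w : dom i x -> C1M v -> C1M w ->
  grad_inner v w x = grad_chart i (in_chart i v) (in_chart i w) (coord i x).
Proof.
move=> ix vC wC; rewrite /grad_inner /=.
pose i0 := chart_at x; pose y0 := coord i0 x; pose y := coord i x.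
have i0x : dom i0 x := manifold_cover sM x.
have Ey : overlap i i0 y by exists x.
pose T := transition i i0.
have Ty : T y = y0 by rewrite /T /transition /y (manifold_coordK sM).
have oE := open_overlap sM (i:=i) (j:=i0).
have TE : smooth_on (overlap i i0) T by exact: manifold_transition.
have i0y : chart_image i0 (T y) by rewrite Ty; exact: chart_imageP.
pose S := 'J T y.
have dE u k : C1M u -> partial k (in_chart i u) y
    = \sum_a S k a * partial a (in_chart i0 u) (T y).
  move=> uC; transitivity (partial k (fun z => in_chart i0 u (T z)) y).
    apply: partial_near_eq; apply: filterS (open_nbhs_nbhs (conj oE Ey)) => z.
    rewrite (overlapE sM) => -[iz i0z].
    by rewrite /in_chart /T /transition (manifold_coordK sM).
  rewrite (@partial_chain _ _ _ (in_chart i0 u) T).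
  - by apply: eq_bigr => a _; rewrite /S (jacobian_smooth oE TE).
  - by apply: C1at_differentiable; exact: uC.
  - by move=> a; apply: C1at_differentiable; exact: transition_C1at.
have AE : metric i y = S *m metric i0 y0 *m S^T by rewrite (metric_change rM Ey) -/T Ty.
have A0u : metric i0 y0 \in unitmx by apply: (metric_unitmx rM); exact: chart_imageP.
have Su : S \in unitmx.
  have : metric i y \in unitmx by apply: (metric_unitmx rM); exact: chart_imageP.
  by rewrite AE unitmx_mul => /andP[]; rewrite unitmx_mul => /andP[].
have Stu : S^T \in unitmx by rewrite unitmx_tr.
have BE : invmx (metric i0 y0) = S^T *m invmx (metric i y) *m S.
  by rewrite AE invmx_mul3 // !mulmxA mulmxV // mul1mx -mulmxA mulVmx // mulmx1.
rewrite -/i0 -/y0 -/y /grad_chart.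
pose B := invmx (metric i y).
pose F k l a b := B k l * (S k a * S l b)
  * partial a (in_chart i0 v) (T y) * partial b (in_chart i0 w) (T y).
transitivity (\sum_a \sum_b \sum_k \sum_l F k l a b).
  apply: eq_bigr => a _; apply: eq_bigr => b _; rewrite BE mxE -Ty.
  rewrite exchange_big !mulr_suml; apply: eq_bigr => l _ /=.
  rewrite mxE !mulr_suml; apply: eq_bigr => k _; rewrite [S^T _ _]mxE /F -/B.
  set p := partial _ _ _; set q := partial _ _ _; ring.
rewrite -(sum_swap22 F); apply: eq_bigr => k _; apply: eq_bigr => l _.
rewrite (dE v k vC) (dE w l wC) -mulrA big_distrlr mulr_sumr.
apply: eq_bigr => a _; rewrite mulr_sumr; apply: eq_bigr => b _; rewrite /F -/B.
rewrite /=; set p := partial _ _ _; set q := partial _ _ _; ring.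
Qed.

End GradInner.

Section Integral.
Context {R : realType}.
Variables (m n : nat) (I : set R) (h : R -> R) (P : manifold_data R n) (M : manifold_data R m).
Let N := warped_product I h P.
Variables (psi : M -> N) (c : R) (eh : R -> R).
Variable vol : {measure set (borelType M) -> \bar R}.
Hypothesis oI : open I.
Hypothesis h0 : forall t, I t -> 0 < h t.
Hypothesis hI : smooth_real_on I h.
Hypothesis rP : riemannian_manifold P.
Hypothesis rM : riemannian_manifold M.
Hypothesis vM : is_riemannian_volume vol.
Hypothesis psiI : forall x : M, I (psi x).1.
Hypothesis sol : mcf_soliton psi (@warped_field R n I h P) c.
Hypothesis ehd : forall t, I t -> is_derive t 1 eh (h t).

Let sM := riemannian_manifold_smooth rM.
Implicit Types (i : index M) (x : M) (v w : M -> R) (y : 'rV[R]_m).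

Definition eta_fun x : R := eh (psi x).1.

Lemma eta_C1M : C1M eta_fun.
Proof. by move=> i y iy; exact: (eta_C1at oI hI rP rM psiI sol ehd iy). Qed.

(** The value that the soliton equation gives to the Laplacian of [eta]; in this form it refers to
    no choice of chart beyond [grad_inner]. *)
Definition eta_laplacian x : R := m%:R * derive1 h (psi x).1
  + c * (h (psi x).1 ^+ 2 - grad_inner eta_fun eta_fun x).

(* The divergence of [w * grad eta]. *)
Definition div_grad w x : R := w x * eta_laplacian x + grad_inner w eta_fun x.

Let sqdet i y := Num.sqrt (\det (metric i y)).
Let flux i w (p : 'I_m) y := sqdet i y * (in_chart i w y
   * \sum_q invmx (metric i y) p q * partial q (eta_chart psi eh i) y).

Let det_gt0 i y : chart_image i y -> 0 < \det (metric i y).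
Proof.
move=> iy; apply: posdef_det_gt0; first exact: (metric_sym rM).
by move=> u; exact: (metric_posdef rM).
Qed.

Let sqdet_gt0 i y : chart_image i y -> 0 < sqdet i y.
Proof. by move=> iy; rewrite sqrtr_gt0 det_gt0. Qed.

Let sqdet_C1at i y : chart_image i y -> C1at (sqdet i) y.
Proof.
move=> iy; apply: (@C1at_comp1 _ _ (@Num.sqrt R)).
  by apply: C1at_det => a b; exact: (metric_C1at rM).
by apply: C1R_sqrt; exact: det_gt0.
Qed.

Let flux_div i w y : C1M w -> chart_image i y ->
  (forall p, C1at (flux i w p) y) /\
  \sum_p partial p (flux i w p) y = sqdet i y * div_grad w (param i y).
Proof.
move=> wC iy.
have eC q : C1at (partial q (eta_chart psi eh i)) y.
  exact: (partial_eta_C1at oI hI rP rM psiI sol ehd).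
have gC a b : C1at (fun z => metric i z a b) y by exact: (metric_C1at rM).
have [|FC ->] := @divergence_expand R m (metric i) (in_chart i w) (eta_chart psi eh i) y
  gC _ (wC i y iy) eC.
  by apply: filterS (near_chart_image sM iy) => z; exact: det_gt0.
split; first exact: FC.
have cl := chart_laplacian oI h0 hI rP rM psiI sol ehd iy.
rewrite /div_grad /eta_laplacian -/(sqdet i y) /=; congr (_ * (_ + _)).
  rewrite cl; congr (_ * (_ + _ * (_ - _))).
  rewrite (grad_inner_chart rM (dom_param sM iy) eta_C1M eta_C1M).
  by rewrite (paramK sM iy).
rewrite (grad_inner_chart rM (dom_param sM iy) wC eta_C1M).
by rewrite (paramK sM iy).
Qed.

Lemma div_grad_near0 w x : C1M w -> (\forall z \near x, w z = 0) -> div_grad w x = 0.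
Proof.
move=> wC wx; rewrite /div_grad (nbhs_singleton wx) mul0r add0r.
rewrite /grad_inner /= /grad_chart; set i := chart_at x.
have ix : dom i x := manifold_cover sM x.
apply: big1 => p _; apply: big1 => q _.
rewrite (_ : partial p (in_chart i w) _ = 0) ?mulr0 ?mul0r //.
apply: etrans (partial_cst 0 (coord i x) p); apply: partial_near_eq.
have cx : chart_image i (coord i x) by exact: chart_imageP.
have wx' : \forall z \near param i (coord i x), w z = 0.
  by rewrite (manifold_coordK sM ix).
exact: (param_continuous_at sM cx wx').
Qed.

(** [w] lives in the cube of half side [r], the integration runs over the one of half side [2 * r];
    hence the flux vanishes on the faces. The divergence is a sum over [p] of functions to each of
    which [flux_zero] applies. *)
Lemma chart_integral i y0 (r : R) w : 0 < r ->
  cbox (\row_k (y0 0 k - 2 * r)) (4 * r) `<=` chart_image i -> C1M w ->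
  (forall x, ~ (dom i x /\ `|coord i x - y0| <= r) -> w x = 0) ->
  vol.-integrable [set: M] (EFin \o div_grad w) /\
  (\int[vol]_(x in [set: M]) (div_grad w x)%:E = 0)%E.
Proof.
move=> r0 Ki wC w0.
pose a : 'rV[R]_m := \row_k (y0 0 k - 2 * r); pose l := 4 * r.
have l0 : 0 < l by rewrite mulr_gt0.
pose A := chart_box i a l.
have mA : @measurable _ (borelType M) A by exact: chart_box_measurable.
have inK y : `|y - y0| <= r -> cbox a l y.
  move=> yr k; have := le_trans (rV_norm_ge (y - y0) k) yr.
  by rewrite !mxE ler_norml /l; lra.
have cl : closed [set x | dom i x /\ `|coord i x - y0| <= r].
  by apply: closedball_image_closed => // y yr; apply: Ki; exact: inK.
have off x : ~ A x -> div_grad w x = 0.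
  move=> Ax; apply: div_grad_near0 => //.
  have nx : \forall z \near x, ~ (dom i z /\ `|coord i z - y0| <= r).
    apply: (@open_nbhs_nbhs _ _ (~` [set x | dom i x /\ `|coord i x - y0| <= r])).
    split; first exact: closed_openC.
    move=> [ix xr]; apply: Ax; split=> // k.
    have := le_trans (rV_norm_ge (coord i x - y0) k) xr.
    by rewrite !mxE ler_norml /l; lra.
  by apply: filterS nx => z; exact: w0.
pose f p x := partial p (flux i w p) (coord i x) / sqdet i (coord i x).
have fC p x : dom i x -> {for x, continuous (f p)}.
  move=> ix; have cx : chart_image i (coord i x) by exact: chart_imageP.
  have [FC _] := flux_div wC cx.
  have cc := coord_continuous_at sM ix.
  apply: (@continuous_mul R _ (fun z => partial p (flux i w p) (coord i z))
      (fun z => (sqdet i (coord i z))^-1)).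
    apply: (@continuous_comp _ _ _ (coord i) (partial p (flux i w p))); first exact: cc.
    exact: C1at_partial_continuous (FC p).
  apply: (@continuousV _ _ (fun z => sqdet i (coord i z))).
    by rewrite gt_eqF // sqdet_gt0.
  apply: (@continuous_comp _ _ _ (coord i) (sqdet i)); first exact: cc.
  by apply: C1at_continuous; exact: sqdet_C1at.
have fI p : vol.-integrable A (EFin \o f p) /\ (\int[vol]_(x in A) (f p x)%:E = 0)%E.
  have H1 b s : cbox b s `<=` cbox a l ->
      @measurable _ (borelType M) (dom i `&` coord i @^-1` box b s).
    by move=> _; exact: chart_box_measurable.
  have H2 b s (u1 u2 : R) : cbox b s `<=` cbox a l -> 0 <= s -> 0 <= u1 -> u1 <= u2 ->
      (forall y, box b s y -> u1 <= sqdet i y <= u2) ->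
      ((u1 * s ^+ m)%:E <= vol (dom i `&` coord i @^-1` box b s) <= (u2 * s ^+ m)%:E)%E.
    by move=> bK; apply: chart_box_volume => // y /bK /Ki.
  have H3 y : cbox a l y -> {for y, continuous (sqdet i)}.
    by move=> /Ki iy; apply: C1at_continuous; exact: sqdet_C1at.
  have H4 y : cbox a l y -> 0 < sqdet i y by move=> /Ki; exact: sqdet_gt0.
  have H5 y : cbox a l y -> derivable (flux i w p) y (delta_mx 0 p).
    by move=> /Ki iy; apply: C1at_derivable; exact: (flux_div wC iy).1.
  have H6 y : cbox a l y -> {for y, continuous (partial p (flux i w p))}.
    by move=> /Ki iy; apply: C1at_partial_continuous; exact: (flux_div wC iy).1.
  have H7 y : cbox a l y -> y 0 p = a 0 p \/ y 0 p = a 0 p + l -> flux i w p y = 0.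
    move=> Ky yp; rewrite /flux (_ : in_chart i w y = 0) ?mul0r ?mulr0 //.
    apply: w0 => -[_]; rewrite (paramK sM (Ki _ Ky)) => yr.
    have := le_trans (rV_norm_ge (y - y0) p) yr.
    rewrite !mxE ler_norml => /andP[h1 h2].
    by case: yp; rewrite !mxE /l; lra.
  have H8 : @measurable_fun _ _ (borelType M) R (dom i `&` coord i @^-1` box a l) (f p).
    apply: (measurable_funS _ _ (borel_measurable _ (fC p))).
    + by apply: borel_open; exact: manifold_dom_open.
    + by move=> x [].
    + exact: manifold_dom_open.
  have H9 x : (dom i `&` coord i @^-1` box a l) x ->
      f p x * sqdet i (coord i x) = partial p (flux i w p) (coord i x).
    move=> [ix xb]; have cx : chart_image i (coord i x) by exact: chart_imageP.
    by rewrite /f divfK // gt_eqF // sqdet_gt0.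
  exact: (flux_zero l0 H1 H2 H3 H4 H5 H6 H7 H8 H9).
have sumE x : A x -> div_grad w x = \sum_p f p x.
  move=> [ix xb]; have cx : chart_image i (coord i x) by exact: chart_imageP.
  have [_ FE] := flux_div wC cx.
  have s0 : sqdet i (coord i x) != 0 by rewrite gt_eqF // sqdet_gt0.
  by rewrite -mulr_suml FE (manifold_coordK sM ix) mulrAC mulfV // mul1r.
have EI : (EFin \o div_grad w) \_ A = EFin \o div_grad w.
  apply/funext => x; rewrite /patch; case: ifPn => //; rewrite notin_setE => /off.
  by move=> /= ->.
have sI : vol.-integrable A (fun x => \sum_p (f p x)%:E)%E.
  by apply: integrable_sum => // p _; exact: (fI p).1.
have eqA : {in A, EFin \o div_grad w =1 (fun x => \sum_p (f p x)%:E)%E}.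
  by move=> x; rewrite inE => /sumE E; rewrite /= E sumEFin.
have wI : vol.-integrable A (EFin \o div_grad w).
  by apply: eq_integrable sI => // x xA; rewrite eqA.
split; first by have := (integrable_mkcond _ mA).1 wI; rewrite EI.
have -> : (\int[vol]_(x in [set: M]) (div_grad w x)%:E
    = \int[vol]_(x in A) (div_grad w x)%:E)%E.
  by rewrite [RHS]integral_mkcond; congr (integral _ _ _); exact: (esym EI).
transitivity (\int[vol]_(x in A) (\sum_p (f p x)%:E))%E.
  by apply: eq_integral => x xA; exact: eqA.
rewrite integral_sum //; last by move=> p; exact: (fI p).1.
by apply: big1 => p _; exact: (fI p).2.
Qed.

End Integral.

Section CompactIntegral.
Context {R : realType}.
Variables (m n : nat) (I : set R) (h : R -> R) (P : manifold_data R n) (M : manifold_data R m).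
Let N := warped_product I h P.
Variables (psi : M -> N) (c : R) (eh : R -> R).
Variable vol : {measure set (borelType M) -> \bar R}.
Hypothesis oI : open I.
Hypothesis h0 : forall t, I t -> 0 < h t.
Hypothesis hI : smooth_real_on I h.
Hypothesis rP : riemannian_manifold P.
Hypothesis rM : riemannian_manifold M.
Hypothesis vM : is_riemannian_volume vol.
Hypothesis psiI : forall x : M, I (psi x).1.
Hypothesis sol : mcf_soliton psi (@warped_field R n I h P) c.
Hypothesis ehd : forall t, I t -> is_derive t 1 eh (h t).

Let sM := riemannian_manifold_smooth rM.
Let dg := div_grad psi c eh.

Lemma div_gradD (v w : M -> R) x : C1M v -> C1M w ->
  dg (fun z => v z + w z) x = dg v x + dg w x.
Proof.
move=> vC wC; rewrite /dg /div_grad mulrDl -!addrA; congr (_ + _).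
rewrite addrCA; congr (_ + _); rewrite /grad_inner /= /grad_chart -big_split.
apply: eq_bigr => p _; rewrite -big_split; apply: eq_bigr => q _ /=.
have cx : chart_image (chart_at x) (coord (chart_at x) x).
  by apply: chart_imageP; exact: (manifold_cover sM).
by rewrite (partialD p (vC _ _ cx) (wC _ _ cx)) mulrDr mulrDl.
Qed.

(** Stands in for a partition of unity. By induction on [s], [w] splits as [w (1 - Z z) + w Z z]:
    the first part lives in one chart, and the second is annihilated by the product of the remaining
    cutoffs. *)
Lemma partition_integral (Z : M -> M -> R) (s : seq M) (w : M -> R) :
  (forall x, exists i y0 r, chart_cutoff i y0 r (Z x)) -> C1M w ->
  (forall x, w x * \prod_(z <- s) Z z x = 0) ->
  vol.-integrable [set: M] (EFin \o dg w) /\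
  (\int[vol]_(x in [set: M]) (dg w x)%:E = 0)%E.
Proof.
move=> ZC; elim: s w => [|z s IH] w wC w0.
  have dw0 x : dg w x = 0.
    apply: (div_grad_near0 psi c eh rM wC); apply: near_always => u.
    by have := w0 u; rewrite big_nil mulr1.
  have -> : EFin \o dg w = cst 0%E by apply/funext => x; rewrite /= dw0.
  split; first exact: integrable0.
  by apply: integral0_eq => x _; rewrite dw0.
have [i [y0 [r [r0 Ki zC z1]]]] := ZC z.
have ziC : C1M (fun x => 1 + (- 1) * Z z x).
  move=> j y jy; apply: C1atD; first exact: C1at_cst.
  by apply: C1atM; [exact: C1at_cst|exact: zC].
pose v1 x := w x * (1 + (- 1) * Z z x); pose v2 x := w x * Z z x.
have vC : C1M v1 := C1M_mul wC ziC.
have w'C : C1M v2 := C1M_mul wC zC.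
have [vi v0] : vol.-integrable [set: M] (EFin \o dg v1) /\
  (\int[vol]_(x in [set: M]) (dg v1 x)%:E = 0)%E.
  apply: (chart_integral oI h0 hI rP rM vM psiI sol ehd r0 Ki vC) => x /z1.
  by rewrite /v1 => ->; rewrite mulr1 subrr mulr0.
have [|wi w'0] := IH _ w'C.
  by move=> x; have := w0 x; rewrite big_cons mulrA.
have E x : dg w x = dg v1 x + dg v2 x.
  rewrite -div_gradD //; congr (dg _ _); apply/funext => u; rewrite /v1 /v2; ring.
have -> : EFin \o dg w = ((EFin \o dg v1) \+ (EFin \o dg v2))%E.
  by apply/funext => x; rewrite /= E.
split; first exact: integrableD.
transitivity (\int[vol]_(x in [set: M]) ((dg v1 x)%:E + (dg v2 x)%:E))%E.
  by apply: eq_integral => x _; rewrite -EFinD -E.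
by rewrite integralD //= v0 w'0 adde0.
Qed.

(** Each cutoff [Z x] vanishes near [x]; finitely many of these neighbourhoods cover [K], so the
    product of their cutoffs vanishes on [K], while [w] vanishes off [K]. *)
Lemma compact_integral (w : M -> R) (K : set M) : compact K -> C1M w ->
  (forall x, ~ K x -> w x = 0) ->
  vol.-integrable [set: M] (EFin \o dg w) /\
  (\int[vol]_(x in [set: M]) (dg w x)%:E = 0)%E.
Proof.
move=> cK wC w0.
have ex (x0 : M) : exists zeta : M -> R, (exists i y0 r, chart_cutoff i y0 r zeta) /\
    \forall x \near x0, zeta x = 0.
  have [i [y0 [r [zeta [H1 H2]]]]] := cutoff_exists sM x0.
  by exists zeta; split => //; exists i, y0, r.
pose Z (x0 : M) := projT1 (cid (ex x0)).
have ZP (x0 : M) : (exists i y0 r, chart_cutoff i y0 r (Z x0)) /\ \forall x \near x0, Z x0 x = 0.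
  exact: (projT2 (cid (ex x0))).
pose U (x0 : M) : set M := interior [set x | Z x0 x = 0].
have := cK; rewrite compact_cover => /(_ M setT U).
case=> [x _|x Kx|D _ KD]; first exact: open_interior.
  by exists x => //; exact: (ZP x).2.
apply: (@partition_integral Z (finmap.enum_fset D)) => //; first by move=> x; case: (ZP x).
move=> x; have [Kx|nKx] := pselect (K x); last by rewrite w0 // mul0r.
have [z zD zx] := KD x Kx.
have /= z0 := interior_subset zx.
by rewrite (big_rem z) //= z0 mul0r mulr0.
Qed.

Lemma compact_volume_lty (K : set M) : compact K -> @measurable _ (borelType M) K ->
  (vol K < +oo)%E.
Proof.
move=> cK mK.
have ex (x0 : M) : exists A : set M, [/\ @measurable _ (borelType M) A, (vol A < +oo)%E & nbhs x0 A].
  have [i [y0 [r [zeta [[r0 Ki _ z1] z0]]]]] := cutoff_exists sM x0.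
  pose a : 'rV[R]_m := \row_k (y0 0 k - 2 * r); pose l := 4 * r.
  exists (chart_box i a l); split; first exact: chart_box_measurable.
    have l0 : 0 <= l by rewrite mulr_ge0 // ltW.
    have sc y : chart_image i y -> {for y, continuous (fun y => Num.sqrt (\det (metric i y)))}.
      move=> iy; apply: (@continuous_comp _ _ _ (fun y => \det (metric i y)) (@Num.sqrt R)).
        apply: C1at_continuous; apply: C1at_det => p q; exact: (metric_C1at rM).
      exact: sqrt_continuous.
    have [C CP] := compact_bounded_above (compact_cbox (b:=a) (l:=l)) (fun y Ky => sc y (Ki y Ky)).
    have := @chart_box_volume R m M sM vol vM i a l 0 (Num.max 0 C) Ki l0 (lexx 0).
    rewrite le_max lexx => /(_ isT) H.
    have /H /andP[_ /le_lt_trans] : forall y, box a l y ->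
        0 <= Num.sqrt (\det (metric i y)) <= Num.max 0 C.
      by move=> y /sub_box_cbox /CP yC; rewrite sqrtr_ge0 /= le_max yC orbT.
    by apply; rewrite ltry.
  (* Where the cutoff is 0 it is not 1, so the point lies in the coordinate ball and hence in the
     box. *)
  apply: filterS z0 => x zx.
  have [[ix xr]|nx] := pselect (dom i x /\ `|coord i x - y0| <= r); last first.
    by have := z1 x nx; rewrite zx => /eqP; rewrite eq_sym oner_eq0.
  split=> // k; have := le_trans (rV_norm_ge (coord i x - y0) k) xr.
  by rewrite !mxE ler_norml /l; lra.
pose A x0 := projT1 (cid (ex x0)).
have AP (x0 : M) : [/\ @measurable _ (borelType M) (A x0), (vol (A x0) < +oo)%E & nbhs x0 (A x0)].
  exact: (projT2 (cid (ex x0))).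
have := cK; rewrite compact_cover => /(_ M setT (fun x => interior (A x))).
case=> [x _|x Kx|D _ KD]; first exact: open_interior.
  by exists x => //; case: (AP x).
pose s : seq M := finmap.enum_fset D.
have KS : K `<=` \big[setU/set0]_(z <- s) A z.
  move=> x /KD [z zD /interior_subset zx]; rewrite -bigcup_seq.
  by exists z.
have mS : @measurable _ (borelType M) (\big[setU/set0]_(z <- s) A z).
  by apply: bigsetU_measurable => z _; case: (AP z).
apply: (@le_lt_trans _ _ (vol (\big[setU/set0]_(z <- s) A z))).
  by apply: le_measure; rewrite ?inE.
elim: (s) => [|z t IH]; first by rewrite big_nil measure0.
rewrite big_cons; apply: le_lt_trans (measureU2 _ _ _) _.
- by case: (AP z).
- by apply: bigsetU_measurable => u _; case: (AP u).
- by rewrite lte_add_pinfty //; case: (AP z).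
Qed.

End CompactIntegral.

(** * The warping function *)

Section RealLine.
Context {R : realType}.

(** The definition by cases is replaced, near [t], by a difference of integrals [F] from a base
    point [a] to the left of both [t] and [t0]; the fundamental theorem applies to [F]. *)
Lemma is_derive_eta_hat (I : set R) (h : R -> R) (t0 t : R) :
  open I -> is_interval I -> I t0 -> I t ->
  (forall u, I u -> {for u, continuous h}) ->
  is_derive t 1 (eta_hat h t0) (h t).
Proof.
move=> oI iI It0 It hc.
have ex u : I u -> exists2 d, 0 < d & forall v, `|u - v| < d -> I v.
  move=> Iu; have [d /= d0 dP] := (nbhs_ballP _ _).1 (open_nbhs_nbhs (conj oI Iu)).
  by exists d => // v uv; apply: dP; rewrite -ball_normE.
have Imin : I (Num.min t t0) by case: leP.
have Imax : I (Num.max t t0) by case: leP.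
have [d1 d10 d1P] := ex _ Imin; have [d2 d20 d2P] := ex _ Imax.
(* A segment inside [I] with both [t] and [t0] in its interior. *)
pose a := Num.min t t0 - d1 / 2; pose b := Num.max t t0 + d2 / 2.
have Ia : I a.
  by apply: d1P; rewrite opprB addrC subrK gtr0_norm ?divr_gt0 // ltr_pdivrMr // ltr_pMr // ltr1n.
have Ib : I b.
  apply: d2P; rewrite opprD addrA subrr add0r normrN gtr0_norm ?divr_gt0 //.
  by rewrite ltr_pdivrMr // ltr_pMr // ltr1n.
have d120 : 0 < d1 / 2 by rewrite divr_gt0.
have d220 : 0 < d2 / 2 by rewrite divr_gt0.
have mt : Num.min t t0 <= t by rewrite ge_min lexx.
have mt0 : Num.min t t0 <= t0 by rewrite ge_min lexx orbT.
have Mt : t <= Num.max t t0 by rewrite le_max lexx.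
have Mt0 : t0 <= Num.max t t0 by rewrite le_max lexx orbT.
have at_ : a < t by rewrite /a; lra.
have at0 : a < t0 by rewrite /a; lra.
have tb : t < b by rewrite /b; lra.
have t0b : t0 < b by rewrite /b; lra.
have abI u : a <= u <= b -> I u by exact: iI.
have int u v : a <= u -> v <= b -> lebesgue_measure.-integrable `[u, v] (EFin \o h).
  move=> au vb; apply: continuous_compact_integrable; first exact: segment_compact.
  apply: continuous_in_subspaceT => w; rewrite inE /= in_itv /= => /andP[uw wv].
  by apply: hc; apply: abI; rewrite (le_trans au uw) (le_trans wv vb).
pose F y := \int[lebesgue_measure]_(s in `[a, y]) h s.
have [dF F'] := @continuous_FTC1_closed R h a t b tb (int a b (lexx _) (lexx _)) at_ (hc t It).
have key u v : a < u -> u <= v -> v < b ->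
    \int[lebesgue_measure]_(s in `[u, v]) h s = F v - F u.
  move=> au uv vb; rewrite /F Rintegral_itvB.
  - rewrite Rintegral_itv_obnd_cbnd //.
    apply: (@integrableS _ _ _ lebesgue_measure `[u, v]) => //.
      by apply: subset_itv_oc_cc.
    by apply: int; exact: ltW.
  - by apply: int => //; exact: ltW.
  - by rewrite bnd_simp ltW.
  - by rewrite bnd_simp.
have E u : a < u < b -> F u - F t0 = eta_hat h t0 u.
  move=> /andP[au ub]; rewrite /eta_hat; case: leP => H; first by rewrite key.
  by rewrite key ?opprB // ltW.
have nt : \forall u \near t, a < u < b.
  apply: (@open_nbhs_nbhs _ t [set u | a < u < b]); split; last by rewrite /= at_ tb.
  rewrite (_ : [set u | _] = `]a, b[%classic); first exact: itv_open.
  by apply/seteqP; split => u /=; rewrite in_itv.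
apply: (@near_eq_is_derive _ _ _ (fun u => F u - F t0)); first by apply: filterS nt => u /E.
have dF' : is_derive t 1 F (h t) by apply: DeriveDef; [exact: dF|rewrite -derive1E].
by have := is_deriveB dF' (is_derive_cst (F t0) t 1); rewrite subr0.
Qed.

Lemma nonincreasing_on (T : set R) (f df : R -> R) : is_interval T ->
  (forall t, T t -> is_derive t 1 f (df t)) -> (forall t, T t -> df t <= 0) ->
  forall s t, T s -> T t -> s <= t -> f t <= f s.
Proof.
move=> iT fd df0 s t Ts Tt st.
have Tst u : s <= u <= t -> T u by exact: iT.
have [||u] := @MVT_segment _ f df s t st.
- by move=> u; rewrite in_itv /= => /andP[su ut]; apply: fd; apply: Tst; rewrite !ltW.
- apply: derivable_within_continuous => u; rewrite in_itv /= => /Tst /fd [].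
  by [].
- rewrite in_itv /= => /Tst Tu E; rewrite -subr_le0 E.
  by rewrite mulr_le0_ge0 ?df0 // subr_ge0.
Qed.

Section Ode.
Variables (I T : set R) (h eh : R -> R) (c k lam q : R).
Hypothesis iT : is_interval T.
Hypothesis TI : T `<=` I.
Hypothesis h0 : forall t, I t -> 0 < h t.
Hypothesis hI : smooth_real_on I h.
Hypothesis ehd : forall t, I t -> is_derive t 1 eh (h t).
Hypothesis c0 : c < 0.
Hypothesis k0 : 0 < k.
Hypothesis lam0 : 0 < lam.
Hypothesis hq : forall t, T t -> q <= derive1 h t.
(** In the application [T] is the set of times reached by the immersion, where alone the bounds are
    known, and [k] is [m - 1]. *)
Hypothesis curv : forall t, T t -> lam + c * derive1 h t <= k * - (derive1n 2 h t / h t).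
Hypothesis unb : forall A, exists2 t, T t & A < eh t.

Let h_der t : T t -> is_derive t 1 h (derive1 h t).
Proof. by move=> /TI It; rewrite derive1E; apply: derivableP; exact: (@hI 0%N). Qed.

Let dh_der t : T t -> is_derive t 1 (derive1 h) (derive1n 2 h t).
Proof. by move=> /TI It; rewrite /= derive1E; apply: derivableP; exact: (@hI 1%N). Qed.

Lemma eh_lt s t : T s -> T t -> eh s < eh t -> s <= t.
Proof.
move=> Ts Tt; apply: contraTT; rewrite -ltNge -leNgt => ts.
have := @nonincreasing_on T (fun u => - eh u) (fun u => - h u) iT _ _ t s Tt Ts (ltW ts).
rewrite lerN2; apply=> u Tu; first by apply: is_deriveN; exact: (ehd (TI Tu)).
by rewrite oppr_le0 ltW // h0 //; exact: TI.
Qed.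

(* The factor [expR (- alpha * eh)] turns the differential inequality for
   [h' - beta] into monotonicity: if [h' < beta] somewhere then [h'] tends to
   [-oo] along [T]. *)
Lemma derive_ge : forall t, T t -> lam / - c <= derive1 h t.
Proof.
have Nc0 : 0 < - c by rewrite oppr_gt0.
(* With these constants [curv] reads [h'' <= alpha h (h' - beta)], and [h] is the derivative of
   [eh]. *)
pose beta := lam / - c; pose alpha := - c / k.
have a0 : 0 < alpha by rewrite divr_gt0.
pose G t := (derive1 h t - beta) * expR (- alpha * eh t).
pose dG t := (derive1n 2 h t - alpha * h t * (derive1 h t - beta)) * expR (- alpha * eh t).
have Gd t : T t -> is_derive t 1 G (dG t).
  move=> Tt; have d1 : is_derive t 1 (fun t => derive1 h t - beta) (derive1n 2 h t).
    by have := is_deriveB (dh_der Tt) (is_derive_cst beta t 1); rewrite subr0.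
  have d2 : is_derive t 1 (fun t => - alpha * eh t) (- alpha * h t).
    have := @is_deriveZ _ _ _ eh (- alpha) t 1 _ (ehd (TI Tt)).
    by [].
  have d3 : is_derive t 1 (fun t => expR (- alpha * eh t)) (- alpha * h t * expR (- alpha * eh t)).
    have := @is_derive1_comp R expR (fun t => - alpha * eh t) t _ _ (is_derive_expR _) d2.
    by rewrite mulrC.
  have := is_deriveM d1 d3 => H; apply: (is_derive_eq H).
  by rewrite /dG /GRing.scale /=; ring.
have dG0 t : T t -> dG t <= 0.
  move=> Tt; rewrite /dG mulr_le0_ge0 ?expR_ge0 // subr_le0.
  have ht : 0 < h t by apply: h0; exact: TI.
  have := curv Tt; rewrite mulrN mulrA lerNr ler_pdivrMr // => H.
  rewrite -(ler_pM2l k0) (le_trans H) //.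
  have -> : k * (alpha * h t * (derive1 h t - beta)) = - (lam + c * derive1 h t) * h t.
    have kn0 : k != 0 by rewrite gt_eqF.
    have cn0 : c != 0 by rewrite lt_eqF.
    by rewrite /alpha /beta; field; rewrite kn0 cn0.
  by [].
move=> t1 Tt1; rewrite leNgt; apply/negP => ht1; rewrite -/beta in ht1.
pose w := beta - derive1 h t1.
have w0 : 0 < w by rewrite subr_gt0.
(* Past this level [beta - h'], which grows at least like [w * alpha * (eh - eh t1)], exceeds
   [beta - q], against [q <= h']. *)
pose A := eh t1 + (`|beta - q| + 1) / (w * alpha).
have [t2 Tt2 At2] := unb A.
have D0 : 0 < (`|beta - q| + 1) / (w * alpha) by apply: divr_gt0; [rewrite ltr_wpDl|exact: mulr_gt0].
have t12 : t1 <= t2.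
  by apply: eh_lt => //; apply: lt_trans At2; rewrite ltrDl.
have := nonincreasing_on iT Gd dG0 Tt1 Tt2 t12; rewrite /G.
have E : expR (- alpha * eh t1) = expR (alpha * (eh t2 - eh t1)) * expR (- alpha * eh t2).
  by rewrite -expRD; congr expR; ring.
rewrite E mulrA ler_pM2r ?expR_gt0 // => H.
have e1 : 1 + alpha * (eh t2 - eh t1) <= expR (alpha * (eh t2 - eh t1)) := expR_ge1Dx _.
have : w * (alpha * (eh t2 - eh t1)) <= beta - derive1 h t2.
  have : w * (1 + alpha * (eh t2 - eh t1)) <= w * expR (alpha * (eh t2 - eh t1)).
    by rewrite ler_pM2l.
  by rewrite -/w in H *; move: H; rewrite /w; lra.
have : `|beta - q| + 1 < w * (alpha * (eh t2 - eh t1)).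
  have wa := mulr_gt0 w0 a0.
  by move: At2; rewrite /A -ltrBrDl ltr_pdivrMr // => At2; lra.
have := hq Tt2; have := ler_norm (beta - q); lra.
Qed.

(** By [derive_ge], the derivative [2 h h'] of [h^2] is at least [2 (lam / - c)] times that of [eh];
    the term [h t1 ^+ 2] is dropped. *)
Lemma warping_sqr_ge t1 t : T t1 -> T t -> eh t1 < eh t ->
  2 * (lam / - c) * (eh t - eh t1) <= h t ^+ 2.
Proof.
move=> Tt1 Tt e12; have t12 := eh_lt Tt1 Tt e12.
pose beta := lam / - c.
pose G u := 2 * beta * eh u - h u * h u.
pose dG u := 2 * beta * h u - (h u * derive1 h u + h u * derive1 h u).
have Gd u : T u -> is_derive u 1 G (dG u).
  move=> Tu; apply: is_deriveB.
    exact: (@is_deriveZ _ _ _ eh (2 * beta) u 1 _ (ehd (TI Tu))).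
  exact: (is_deriveM (h_der Tu) (h_der Tu)).
have dG0 u : T u -> dG u <= 0.
  move=> Tu; have -> : dG u = 2 * (h u * (beta - derive1 h u)) by rewrite /dG; ring.
  rewrite pmulr_rle0 // pmulr_rle0 ?subr_le0; first exact: derive_ge.
  by apply: h0; exact: TI.
have := nonincreasing_on iT Gd dG0 Tt1 Tt t12; rewrite /G -/beta expr2 => H.
by have := sqr_ge0 (h t1); rewrite expr2; lra.
Qed.

End Ode.
End RealLine.

(** * Finiteness of the weighted volume *)

Section Cutoff.
Context {R : realType}.
Variables (c k : R).
Hypothesis k1 : 1 <= k.
Let k0 : 0 < k. Proof. by rewrite (lt_le_trans _ k1). Qed.

Definition cut (s : R) : R := psq (2 * k - s) * (k ^- 2 * expR (c * s)).

(** The derivative of [cut], with the nonpositive contribution of [phi'] set apart. *)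
Definition dcut (s : R) : R :=
  c * cut s - 2 * Num.max 0 (2 * k - s) * (k ^- 2 * expR (c * s)).

Let kV0 : 0 < k ^- 2. Proof. by rewrite invr_gt0 exprn_gt0. Qed.

Let ke0 s : 0 < k ^- 2 * expR (c * s). Proof. by rewrite mulr_gt0 // expR_gt0. Qed.

Lemma is_derive_cut (s : R) : is_derive s 1 cut (dcut s).
Proof.
have d1 : is_derive s 1 (fun u => 2 * k - u) (- 1).
  by have := is_deriveB (is_derive_cst (2 * k) s 1) (is_derive_id s 1); rewrite sub0r.
have d2 : is_derive s 1 (fun u => psq (2 * k - u)) (- 1 * (2 * Num.max 0 (2 * k - s))).
  have H := @is_derive1_comp R psq (fun u => 2 * k - u) s _ _ (is_derive_psq _) d1.
  by apply: (is_derive_eq H); rewrite mulrC.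
have d3 : is_derive s 1 (fun u => c * u) c.
  by have := @is_deriveZ _ _ _ (@id R) c s 1 _ (is_derive_id s 1); rewrite /GRing.scale /= mulr1.
have d4 : is_derive s 1 (fun u => expR (c * u)) (c * expR (c * s)).
  have H := @is_derive1_comp R expR (fun u => c * u) s _ _ (is_derive_expR _) d3.
  by apply: (is_derive_eq H); rewrite mulrC.
have d5 : is_derive s 1 (fun u => k ^- 2 * expR (c * u)) (k ^- 2 * (c * expR (c * s))).
  exact: (@is_deriveZ _ _ _ (fun u => expR (c * u)) (k ^- 2) s 1 _ d4).
have H := is_deriveM d2 d5; apply: (is_derive_eq H).
by rewrite /dcut /cut /GRing.scale /=; ring.
Qed.

Lemma C1R_cut (s : R) : C1R cut s.
Proof.
apply: near_always => v; split; first by have [] := is_derive_cut v.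
apply: (@continuous_near_eq _ _ dcut).
  by apply: near_always => w; rewrite derive1E; have [_ ->] := is_derive_cut w.
have cc (a : R) : {for v, continuous (fun=> a : R)} by exact: continuous_cst.
have cm : {for v, continuous (fun s => Num.max 0 (2 * k - s) : R)}.
  apply: continuous_max; first exact: cvg_cst.
  by apply: cvgB; [exact: cvg_cst|exact: cvg_id].
have ce : {for v, continuous (fun s => k ^- 2 * expR (c * s))}.
  apply: (@continuous_mul _ _ (fun=> k ^- 2)); first exact: continuous_cst.
  apply: (@continuous_comp _ _ _ (fun s => c * s) expR); last exact: continuous_expR.
  by apply: (@continuous_mul _ _ (fun=> c)); [exact: continuous_cst|exact: cvg_id].
have cu : {for v, continuous cut}.
  apply: differentiable_continuous; apply/derivable1_diffP.
  by have [] := is_derive_cut v.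
apply: (@continuous_add _ _ (fun s => c * cut s)
   (fun s => - (2 * Num.max 0 (2 * k - s) * (k ^- 2 * expR (c * s))))).
  by apply: (@continuous_mul _ _ (fun=> c)); first exact: continuous_cst.
apply: (@continuousN _ _ _ (fun s => 2 * Num.max 0 (2 * k - s) * (k ^- 2 * expR (c * s)))).
apply: (@continuous_mul _ _ (fun s => 2 * Num.max 0 (2 * k - s))) => //.
by apply: (@continuous_mul _ _ (fun=> 2)); first exact: continuous_cst.
Qed.

Lemma cut_ge0 s : 0 <= cut s.
Proof. by rewrite mulr_ge0 ?psq_ge0 // ltW. Qed.

Lemma cut_eq0 s : 2 * k < s -> cut s = 0.
Proof. by move=> ks; rewrite /cut psq_le0 ?mul0r // subr_le0 ltW. Qed.

Lemma cut_ge s : s <= k -> expR (c * s) <= cut s.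
Proof.
move=> sk; rewrite /cut psq_gt0E; last by move: k0; lra.
rewrite mulrA ler_peMl ?expR_ge0 // ler_pdivlMr ?exprn_gt0 // mul1r.
have k2 : k <= 2 * k - s by lra.
by rewrite lerXn2r // ?nnegrE; [exact: ltW|exact: le_trans (ltW k0) k2].
Qed.

(** For [k >= 1] and [s >= - D] one has [2 k - s <= (2 + D) k]. The bound being independent of [k],
    so is the contribution of the compact part. *)
Lemma cut_le (D s : R) : 0 <= D -> - s <= D -> cut s <= (2 + D) ^+ 2 * expR (c * s).
Proof.
move=> D0 sD; rewrite /cut mulrA ler_pM2r ?expR_gt0 //.
rewrite ler_pdivrMr ?exprn_gt0 // -exprMn.
have Dk : 0 <= (2 + D) * k by rewrite mulr_ge0 ?addr_ge0 // ltW.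
rewrite /psq lerXn2r ?nnegrE ?le_max ?lexx // ge_max Dk /=.
have : D <= D * k by rewrite ler_peMr.
by rewrite mulrDl; lra.
Qed.

Lemma dcut_le s : dcut s <= c * cut s.
Proof.
rewrite /dcut gerBl mulr_ge0 ?mulr_ge0 //; first by rewrite le_max lexx.
exact: ltW.
Qed.

End Cutoff.

Section WeightedVolume.
Context {R : realType}.
Variables (m n : nat) (I : set R) (h : R -> R) (P : manifold_data R n) (M : manifold_data R m).
Let N := warped_product I h P.
Variables (psi : M -> N) (c : R) (eh : R -> R).
Variable vol : {measure set (borelType M) -> \bar R}.
Hypothesis oI : open I.
Hypothesis h0 : forall t, I t -> 0 < h t.
Hypothesis hI : smooth_real_on I h.
Hypothesis rP : riemannian_manifold P.
Hypothesis rM : riemannian_manifold M.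
Hypothesis vM : is_riemannian_volume vol.
Hypothesis psiI : forall x : M, I (psi x).1.
Hypothesis sol : mcf_soliton psi (@warped_field R n I h P) c.
Hypothesis ehd : forall t, I t -> is_derive t 1 eh (h t).
Hypothesis eta_infty : tends_to_pinfty_at_infinity (eta_fun psi eh).

Let sM := riemannian_manifold_smooth rM.
Let eta := eta_fun psi eh.
Let dg := div_grad psi c eh.
Let etaC : C1M eta.
Proof. exact: (eta_C1M oI hI rP rM psiI sol ehd). Qed.

Lemma grad_inner_ge0 (v : M -> R) x : 0 <= grad_inner v v x.
Proof.
rewrite /grad_inner /= /grad_chart; set i := chart_at x; set y := coord i x.
have iy : chart_image i y by apply: chart_imageP; exact: (manifold_cover sM).
have [F ->] := posdef_invmx_factor (metric_sym rM iy) (fun u => metric_posdef rM iy (u := u)).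
set d := fun p => partial p (in_chart i v) y.
rewrite (_ : \sum_p _ = \sum_r (\sum_p F r p * d p) ^+ 2).
  by apply: sumr_ge0 => r _; exact: sqr_ge0.
transitivity (\sum_p \sum_q \sum_r (F r p * d p) * (F r q * d q)).
  apply: eq_bigr => p _; apply: eq_bigr => q _.
  rewrite [(F^T *m F) p q]mxE -mulrA mulr_suml; apply: eq_bigr => r _.
  by rewrite [F^T p r]mxE -/(d p) -/(d q) mulrACA.
under eq_bigr do rewrite exchange_big.
rewrite exchange_big; apply: eq_bigr => r _.
rewrite expr2 mulr_suml; apply: eq_bigr => p _.
by rewrite mulr_sumr.
Qed.

Lemma grad_inner_comp (g dg0 : R -> R) (v w : M -> R) x :
  (forall s : R, is_derive s 1 g (dg0 s)) -> C1M v -> C1M w ->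
  grad_inner (fun z => g (v z)) w x = dg0 (v x) * grad_inner v w x.
Proof.
move=> gd vC wC; rewrite /grad_inner /= /grad_chart; set i := chart_at x.
have ix : dom i x := manifold_cover sM x.
have iy : chart_image i (coord i x) by exact: chart_imageP.
rewrite mulr_sumr; apply: eq_bigr => p _; rewrite mulr_sumr; apply: eq_bigr => q _.
have gv : derivable g (in_chart i v (coord i x)) 1 by have [] := gd (in_chart i v (coord i x)).
have E := partial_comp1 p (C1at_differentiable (vC i _ iy)) gv.
have [_ gE] := gd (in_chart i v (coord i x)).
rewrite derive1E gE {2}/in_chart (manifold_coordK sM ix) in E.
rewrite (_ : partial p (in_chart i (fun z => g (v z))) (coord i x)
  = dg0 (v x) * partial p (in_chart i v) (coord i x)); last by exact: E.
by rewrite !mulrA; congr (_ * _ * _); rewrite mulrC.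
Qed.

Lemma div_grad_cut_le (k : R) x : 1 <= k ->
  dg (fun z => cut c k (eta z)) x
  <= cut c k (eta x) * (m%:R * derive1 h (psi x).1 + c * h (psi x).1 ^+ 2).
Proof.
move=> k1; rewrite /dg /div_grad /eta_laplacian.
rewrite (grad_inner_comp x (is_derive_cut c k) etaC etaC).
have := ler_wpM2r (grad_inner_ge0 eta x) (dcut_le c k1 (eta x)).
set a := derive1 h _; set b := grad_inner eta eta x; set C := cut _ _ _.
by rewrite -/eta -/b; lra.
Qed.

Lemma eta_continuous : continuous eta.
Proof.
move=> x; apply: (@continuous_comp _ _ _ (fun z : M => (psi z).1) eh).
  apply: (@continuous_comp _ _ _ psi (fun z : N => z.1)); first exact: sol.1.1.1.
  exact: cvg_fst.
apply: differentiable_continuous; apply/derivable1_diffP.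
by have [] := ehd (psiI x).
Qed.

Lemma weighted_volume_finite (Hb A : R) : 0 <= Hb ->
  (forall x, m%:R * derive1 h (psi x).1 + c * h (psi x).1 ^+ 2 <= Hb) ->
  (forall x, A < eta x -> m%:R * derive1 h (psi x).1 + c * h (psi x).1 ^+ 2 <= - 1) ->
  (\int[vol]_(x in [set: M]) (expR (c * eta x))%:E < +oo)%E.
Proof.
move=> Hb0 HHb HA.
have etac := eta_continuous.
have sub (B : R) : open [set x | B < eta x].
  by rewrite openE => x /= Bx; exact: (etac x _ (near_gt Bx)).
have msub (B : R) : @measurable _ (borelType M) [set x | eta x <= B].
  rewrite (_ : [set x | _] = ~` [set x | B < eta x]).
    by apply: measurableC; apply: borel_open.
  by apply/seteqP; split => x /=; rewrite leNgt => /negP.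
pose SA := [set x | eta x <= A].
have cSA : compact SA.
  have [K cK KP] := eta_infty A; apply: subclosed_compact cK _.
    rewrite (_ : SA = ~` [set x | A < eta x]); first exact: open_closedC.
    by apply/seteqP; split => x /=; rewrite /SA /= leNgt => /negP.
  by move=> x /= Ax; apply: contrapT => /KP; rewrite ltNge Ax.
have vSA := compact_volume_lty rM vM cSA (msub A).
have [D0 DP] := compact_bounded_above (f := fun x => - eta x) cSA
  (fun x _ => @continuousN _ _ _ eta x (etac x)).
pose D := Num.max 0 D0.
have D_ge0 : 0 <= D by rewrite le_max lexx.
have expc : continuous (fun x : M => expR (c * eta x)).
  move=> x; apply: (@continuous_comp _ _ _ (fun z : M => c * eta z) expR); last exact: continuous_expR.
  by apply: (@continuous_mul _ _ (fun=> c)); [exact: continuous_cst|exact: etac].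
have [E0 EP] := compact_bounded_above cSA (fun x _ => expc x).
pose E := Num.max 0 E0.
have E_ge0 : 0 <= E by rewrite le_max lexx.
(* On [SA] the weight is at most [E] and the divergence at most [Hb * ((2 + D) ^+ 2 * E)]. *)
pose Q := E + Hb * ((2 + D) ^+ 2 * E).
have Q0 : 0 <= Q by rewrite addr_ge0 // mulr_ge0 // mulr_ge0 // sqr_ge0.
(* The weight on an increasing exhaustion by sublevel sets; [k.+1] meets the condition [1 <= k] of
   the cutoffs. *)
pose f (k : nat) (x : M) : \bar R := (expR (c * eta x) * \1_[set x | eta x <= k.+1%:R] x)%:E.
have f0 k x : (0 <= f k x)%E by rewrite lee_fin mulr_ge0 ?expR_ge0.
have bound k : (\int[vol]_(x in [set: M]) f k x <= Q%:E * vol SA)%E.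
  have k1 : (1 : R) <= k.+1%:R by rewrite ler1n.
  pose w x := cut c k.+1%:R (eta x).
  have [K cK KP] := eta_infty (2 * k.+1%:R).
  have wC : C1M w by apply: C1M_comp => // u; exact: C1R_cut.
  have [wI w0] := compact_integral oI h0 hI rP rM vM psiI sol ehd cK wC
    (fun x nKx => cut_eq0 c (KP x nKx)).
  have QI : vol.-integrable [set: M] (EFin \o (fun x => Q * \1_SA x)).
    have H : vol.-integrable [set: M] (EFin \o (\1_SA : M -> R)).
      apply/integrableP; split.
        by apply/measurable_EFinP; apply: measurable_indic; exact: msub.
      have -> : (\int[vol]_(x in [set: M]) `|(EFin \o (\1_SA : M -> R)) x|
          = \int[vol]_(x in [set: M]) (\1_SA x)%:E)%E.
        by apply: eq_integral => x _; rewrite /= ger0_norm.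
      by rewrite integral_indic ?setIT //; exact: (msub A).
    exact: (integrableZl _ Q H).
  (* The divergence integrates to 0, so the bound follows from the pointwise inequality
     [f k <= Q * \1_SA - dg w]. Off [SA] it holds because [dg w <= - w]. *)
  have -> : (Q%:E * vol SA = \int[vol]_(x in [set: M]) (Q * \1_SA x - dg w x)%:E)%E.
    have IB := integralB_EFin (measurableT : measurable [set: borelType M]) QI wI.
    apply: etrans (esym IB); rewrite w0 sube0.
    have ZI := @integralZl_indic _ (borelType M) R vol [set: M] measurableT (fun=> SA) Q.
    apply: etrans (esym (ZI _ (msub A))); last by rewrite ltNge Q0.
    congr (_ * _)%E; have := integral_indic vol (measurableT : measurable [set: borelType M]) (msub A).
    by rewrite setIT => ->.
  apply: ge0_le_integral_any => [x _|x _]; first exact: f0.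
  rewrite lee_fin lerBrDr.
  have dgle := div_grad_cut_le x k1; rewrite -/(w x) in dgle.
  have w_ge0 : 0 <= w x by exact: cut_ge0.
  apply: le_trans (lerD (lexx _) dgle) _.
  have fw : expR (c * eta x) * \1_[set x | eta x <= k.+1%:R] x <= w x.
    rewrite indicE; case: (boolP (x \in _)) => [|_]; last by rewrite mulr0.
    by rewrite inE mulr1 => /= ?; exact: cut_ge.
  case: (leP (eta x) A) => Ax; last first.
    have nS : ~ SA x by move=> H; move: Ax; rewrite ltNge H.
    rewrite [\1_SA x]indicE memNset // mulr0.
    have := ler_wpM2l w_ge0 (HA x Ax); lra.
  rewrite [\1_SA x]indicE mem_set // mulr1.
  have e1 : expR (c * eta x) <= E by rewrite le_max EP ?orbT.
  have e2 : w x <= (2 + D) ^+ 2 * expR (c * eta x).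
    by apply: cut_le => //; rewrite le_max DP ?orbT.
  have e3 : w x <= (2 + D) ^+ 2 * E.
    by apply: le_trans e2 _; apply: ler_wpM2l => //; exact: sqr_ge0.
  have e4 : expR (c * eta x) * \1_[set x | eta x <= k.+1%:R] x <= E.
    apply: le_trans e1; rewrite ler_piMr ?expR_ge0 // indicE; case: (_ \in _); rewrite ?ler01 //.
  have := ler_wpM2l w_ge0 (HHb x); have := ler_wpM2l Hb0 e3.
  rewrite /Q [Hb * w x]mulrC; lra.
have mf k : measurable_fun [set: borelType M] (f k).
  apply/measurable_EFinP; apply: measurable_funM.
    exact: (borel_measurable openT (fun x _ => expc x)).
  by apply: measurable_indic; exact: msub.
have lim x : f ^~ x @ \oo --> (expR (c * eta x))%:E.
  apply: cvg_near_cst; apply: filterS (nbhs_infty_gtr (eta x)) => k kx.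
  rewrite /f indicE mem_set ?mulr1 //= ltW // (lt_trans kx) //.
  by rewrite ltr_nat.
have nd x : [set: M] x -> nondecreasing_seq (f ^~ x).
  move=> _ a b ab; rewrite lee_fin ler_wpM2l ?expR_ge0 // !indicE.
  case: (boolP (x \in _)) => [|_]; last by case: (_ \in _).
  rewrite inE /= => xa; rewrite mem_set //= (le_trans xa) //.
  by rewrite ler_nat.
have -> : (\int[vol]_(x in [set: M]) (expR (c * eta x))%:E
  = \int[vol]_(x in [set: M]) limn (f ^~ x))%E.
  by apply: eq_integral => x _; apply/esym/cvg_lim => //; exact: lim.
have cvgf := @cvg_monotone_convergence _ _ _ vol [set: M] measurableT f mf
  (fun k x _ => f0 k x) nd.
apply: (@le_lt_trans _ _ (Q%:E * vol SA)%E); last by rewrite lte_mul_pinfty.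
rewrite -(cvg_lim _ cvgf) //; apply: lime_le; first by apply/cvg_ex; eexists; exact: cvgf.
by apply: nearW => k; exact: bound.
Qed.
End WeightedVolume.

(** * From the extended-real hypotheses to the growth bound *)

(** The point [x0], the strict gap and the upper bound together make the three extremal values
    finite. Then [lam] is the size of the gap, and [q], [q'] are the infimum and the supremum of
    [d]. *)
Lemma ereal_gap_bounds (R : realType) (T : Type) (F d : T -> R) (a : R) (x0 : T) :
  0 < a ->
  (ereal_sup [set (F x)%:E | x in [set: T]]
     < a%:E * ereal_inf (range (fun x => (d x)%:E)))%E ->
  (a%:E * ereal_sup (range (fun x => (d x)%:E)) < +oo)%E ->
  exists lam q q' : R, 0 < lam /\ forall x, [/\ F x + lam <= a * d x, q <= d x & d x <= q'].
Proof.
move=> a0.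
have SP x : ((F x)%:E <= ereal_sup [set (F x)%:E | x in [set: T]])%E.
  by apply: ereal_sup_ubound; exists x.
have IP x : (ereal_inf (range (fun x => (d x)%:E)) <= (d x)%:E)%E.
  by apply: ereal_inf_lbound; exists x.
have UP x : ((d x)%:E <= ereal_sup (range (fun x => (d x)%:E)))%E.
  by apply: ereal_sup_ubound; exists x.
move: SP IP UP; set S := ereal_sup _; set J := ereal_inf _; set U := ereal_sup _.
case: J => [j| |] SP IP UP; last 2 first.
- by have := IP x0; rewrite leNgt ltry.
- by rewrite gt0_muleNy ?lte_fin // => /(le_lt_trans (SP x0)); rewrite ltNge leNye.
case: S SP => [s| |] SP //; last by move=> _ _; have := SP x0; rewrite leNgt ltNyr.
case: U UP => [u| |] UP; last 2 first.
- by rewrite gt0_muley ?lte_fin // ltxx.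
- by have := UP x0; rewrite leNgt ltNyr.
rewrite -EFinM lte_fin => sj _; exists (a * j - s), j, u; split; first by rewrite subr_gt0.
move=> x; have := SP x; have := IP x; have := UP x; rewrite !lee_fin => h1 h2 h3; split => //.
by have : a * j <= a * d x by [rewrite ler_pM2l|]; lra.
Qed.

Section SecondFundamentalForm.
Context {R : realType}.
Variables (m n : nat) (I : set R) (h : R -> R) (P : manifold_data R n) (M : manifold_data R m).
Hypothesis h0 : forall t, I t -> 0 < h t.
Hypothesis rP : riemannian_manifold P.
Hypothesis rM : riemannian_manifold M.
Variable psi : M -> warped_product I h P.

Lemma second_fundamental_form_sqnorm_ge0 (x : M) : I (psi x).1 ->
  0 <= second_fundamental_form_sqnorm psi x.
Proof.
move=> Ix; have sM := riemannian_manifold_smooth rM; have sP := riemannian_manifold_smooth rP.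
have cx : chart_image (chart_at x) (coord (chart_at x) x).
  by apply: chart_imageP; exact: (manifold_cover sM).
apply: tensor_sqnorm_ge0.
- exact: (metric_sym rM cx).
- by move=> u; exact: (metric_posdef rM cx).
move=> u; have [->|u0] := eqVneq u 0; first by rewrite /inner mul0mx mul0mx mxE.
apply: ltW; apply: (@warped_posdef R n I h (chart_image (chart_at (psi x).2))
    (metric (chart_at (psi x).2)) h0 _ _ u _ u0).
  by move=> y v; exact: (metric_posdef rP).
split; last by rewrite row_mxKr; apply: chart_imageP; exact: (manifold_cover sP).
by rewrite -(lsubmx00 (row_mx _ _)) row_mxKl mxE.
Qed.

End SecondFundamentalForm.
Theorem proposition6p7 (R : realType) (m n : nat)
  (I : set R) (t0 : R) (h : R -> R)
  (P : manifold_data R n) (M : manifold_data R m)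
  (psi : M -> warped_product I h P) (c kappa Lambda : R) (o : M)
  (vol : {measure set (borelType M) -> \bar R}) (chi : R -> R) :
  let eta := fun x : M => eta_hat h t0 (psi x).1 in
  let dh := fun x : M => (derive1 h (psi x).1)%:E in
  let S := ereal_sup [set (second_fundamental_form_sqnorm psi x
             - (m%:R - 1) * varkappa h kappa (psi x).1)%:E | x in [set: M]] in
  (2 <= m)%N ->
  open I -> is_interval I -> I t0 ->
  (forall t, I t -> 0 < h t) -> smooth_real_on I h ->
  riemannian_manifold P ->
  riemannian_manifold M -> connected [set: M] -> complete_manifold M ->
  is_riemannian_volume vol ->
  (forall x : M, I (psi x).1) ->
  c < 0 -> mcf_soliton psi (@warped_field R n I h P) c ->
  constant_sectional_curvature P kappa ->
  ricci_le M Lambda ->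
  (S < +oo)%E ->
  C1_real chi ->
  (forall u, (eta_hat h t0 @` I) u -> 0 <= chi u) ->
  (forall t, I t ->
     is_derive t 1 (eta_hat h t0) (Num.sqrt (chi (eta_hat h t0 t)))) ->
  tends_to_pinfty_at_infinity eta ->
  (S < (- c)%:E * ereal_inf (range dh))%E ->
  ((- c)%:E * ereal_inf (range dh) <= (- c)%:E * ereal_sup (range dh))%E ->
  ((- c)%:E * ereal_sup (range dh) < +oo)%E ->
  exists mu C : R, [/\ 0 < mu, 0 < C &
    \forall r \near +oo,
      (\int[vol]_(x in geodesic_ball o r) (expR (c * eta x))%:E
         <= (C * r `^ mu)%:E)%E].
Proof.
move=> eta dh S m2 oI iI It0 h0 hI rP rM cM _ vM psiI c0 sol _ _ _ _ _ _ eta_infty gap _ supb.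
have c0' : 0 < - c by rewrite oppr_gt0.
pose eh := eta_hat h t0.
have ehd t : I t -> is_derive t 1 eh (h t).
  move=> It; apply: (is_derive_eta_hat oI iI It0 It) => u Iu.
  apply: differentiable_continuous; apply/derivable1_diffP; exact: (@hI 0%N u Iu).
have [lam [q [q' [lam0 bnd]]]] := ereal_gap_bounds o c0' gap supb.
pose T := range (fun x : M => (psi x).1).
have TI : T `<=` I by move=> _ [x _ <-]; exact: psiI.
have iT : is_interval T.
  apply/connected_intervalP; apply: connected_continuous_connected => //.
  apply: continuous_subspaceT => x.
  apply: (@continuous_comp _ _ _ psi (fun z : warped_product I h P => z.1)); first exact: sol.1.1.1.
  exact: cvg_fst.
have k0 : 0 < m%:R - 1 :> R by rewrite subr_gt0 ltr1n.
(* Uses that the squared norm of the second fundamental form is nonnegative and that [varkappa] is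
   at most its first entry [- h'' / h]. *)
have curv t : T t -> lam + c * derive1 h t <= (m%:R - 1) * - (derive1n 2 h t / h t).
  move=> [x _ <-]; have [b1 _ _] := bnd x.
  have b2 := second_fundamental_form_sqnorm_ge0 h0 rP rM (psiI x).
  have : (m%:R - 1) * varkappa h kappa (psi x).1 <= (m%:R - 1) * - (derive1n 2 h (psi x).1 / h (psi x).1).
    by rewrite ler_pM2l // ge_min lexx.
  move: b1 b2; set a := second_fundamental_form_sqnorm _ _; set b := (_ * varkappa _ _ _).
  set d := (_ * - _); set e := derive1 h _; lra.
pose Hb := m%:R * `|q'|.
have Hb0 : 0 <= Hb by rewrite mulr_ge0.
have Hbb (x : M) : m%:R * derive1 h (psi x).1 <= Hb.
  by have [_ _ b] := bnd x; rewrite ler_wpM2l // (le_trans b) // ler_norm.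
have HHb (x : M) : m%:R * derive1 h (psi x).1 + c * h (psi x).1 ^+ 2 <= Hb.
  apply: le_trans (Hbb x); rewrite gerDl nmulr_rle0 // sqr_ge0 //.
have fin : (\int[vol]_(x in [set: M]) (expR (c * eta x))%:E < +oo)%E.
  (* If [eta] is bounded above, the region [A < eta] is empty and nothing about the growth of [h] is
     required. *)
  have [[A AP]|unb] := pselect (exists A, forall x, eta x <= A).
    apply: (weighted_volume_finite oI h0 hI rP rM vM psiI sol ehd eta_infty Hb0 (A := A) HHb).
    by move=> x; rewrite ltNge AP.
  (* By [warping_sqr_ge] from the time of [o], [c h^2 <= - 2 lam (eta x - eta o)], which is at most
     [- (Hb + 1)] beyond this level, while [m h' <= Hb]. *)
  pose A := eta o + (Hb + 1) / (2 * lam).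
  apply: (weighted_volume_finite oI h0 hI rP rM vM psiI sol ehd eta_infty Hb0 (A := A) HHb).
  move=> x; rewrite -[eta_fun psi eh x]/(eta x) => Ax.
  have unbT B : exists2 t, T t & B < eh t.
    apply: contrapT => H; apply: unb; exists B => z; rewrite leNgt; apply/negP => Bz.
    by apply: H; exists (psi z).1 => //; exists z.
  have hq t : T t -> q <= derive1 h t by move=> [z _ <-]; have [_ ] := bnd z.
  have L0 : 0 <= (Hb + 1) / (2 * lam) by rewrite divr_ge0 ?addr_ge0 // mulr_ge0 // ltW.
  have ox : eta o < eta x by apply: le_lt_trans Ax; rewrite lerDl.
  have To : T (psi o).1 by exists o.
  have Tx : T (psi x).1 by exists x.
  have W := warping_sqr_ge iT TI h0 hI ehd c0 k0 hq curv unbT To Tx ox.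
  have W' : c * h (psi x).1 ^+ 2 <= - (2 * lam * (eta x - eta o)).
    have -> : - (2 * lam * (eta x - eta o)) = c * (2 * (lam / - c) * (eta x - eta o)).
      by field; rewrite lt_eqF.
    by rewrite ler_nM2l.
  have : Hb + 1 <= 2 * lam * (eta x - eta o).
    by move: (ltW Ax); rewrite /A -lerBrDl ler_pdivrMr ?mulr_gt0 // mulrC.
  have := Hbb x; lra.
pose V := fine (\int[vol]_(x in [set: M]) (expR (c * eta x))%:E)%E.
have V0 : (0 <= \int[vol]_(x in [set: M]) (expR (c * eta x))%:E)%E.
  by apply: integral_ge0 => x _; rewrite lee_fin expR_ge0.
have VE : (\int[vol]_(x in [set: M]) (expR (c * eta x))%:E = V%:E)%E.
  by rewrite fineK // ge0_fin_numE.
have V0' : 0 <= V by rewrite -lee_fin -VE.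
(* [V] is the total weighted volume; adding 1 makes the constant positive, and [V <= (V + 1) * r] as
   soon as [r >= 1]. *)
exists 1, (V + 1); split => //; first by rewrite ltr_wpDl.
apply: filterS (nbhs_pinfty_ge (num_real 1)) => r r1.
rewrite powRr1; last exact: le_trans r1.
apply: (@le_trans _ _ V%:E); last first.
  by rewrite lee_fin (@le_trans _ _ (V + 1)) ?lerDl // ler_peMr // addr_ge0.
rewrite -VE [leLHS]integral_mkcond; apply: ge0_le_integral_any => x _; rewrite /patch; case: ifP => // _.
by rewrite lee_fin expR_ge0.
Qed.
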